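(* Let $n,l,m$ be positive integers and $T\in(0,+\infty)$. Assume: (A1) $A\in C([0,T];\mathbb{R}^{n\times n})$, $B\in C([0,T];\mathbb{R}^{n\times l})$, $S\in C([0,T];\mathbb{R}^{n\times l})$, $Q\in C([0,T];S^n_{>0})$ and $R\in C([0,T];S^l_{>0})$; and for each $i\in\{1,\dots,m\}$, $G_i\in S^n_{\ge 0}$, $a_i\in\mathbb{R}^n$ and $b_i\in\mathbb{R}$ are constant. (A2) The functions $$C_{pp}(t)=B(t)R(t)^{-1}B(t)^T,\quad C_{xx}(t)=Q(t)-S(t)R(t)^{-1}S(t)^T,\quad C_{xp}(t)=A(t)-B(t)R(t)^{-1}S(t)^T$$ satisfy $C_{pp}(t)\in S^n_{\ge0}$, $C_{xx}(t)\in S^n_{>0}$ and $C_{xp}(t)\in\mathbb{R}^{n\times n}$ for all $t\in[0,T]$. Define $$V_{NN}(t,x)=\min_{i\in\{1,\dots,m\}}V_i(t,x),\qquad V_i(t,x)=\tfrac12 x^TP_i(t)x+q_i(t)^Tx+r_i(t),\qquad t\in[0,T],\ x\in\mathbb{R}^n,$$ where, for each $i$, the functions $P_i\in C([0,T];S^n)$, $q_i\in C([0,T];\mathbb{R}^n)$, $r_i\in C([0,T];\mathbb{R})$ solve on $(0,T)$ the final value problems $$\dot P_i(t)=P_i(t)^TC_{pp}(t)P_i(t)-P_i(t)^TC_{xp}(t)-C_{xp}(t)^TP_i(t)-C_{xx}(t),\quad P_i(T)=G_i,$$ $$\dot q_i(t)=P_i(t)^TC_{pp}(t)q_i(t)-C_{xp}(t)^Tq_i(t),\quad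 q_i(T)=a_i,$$ $$\dot r_i(t)=\tfrac12 q_i(t)^TC_{pp}(t)q_i(t),\quad r_i(T)=b_i.$$ Then $V_{NN}$ is the unique viscosity solution of the Hamilton–Jacobi PDE $$\begin{cases}-\dfrac{\partial V}{\partial t}(t,x)+H(t,x,\nabla_xV(t,x))=0, & x\in\mathbb{R}^n,\ t\in(0,T),\\[4pt] V(T,x)=\Psi(x), & x\in\mathbb{R}^n,\end{cases}$$ where $$H(t,x,p)=\tfrac12p^TC_{pp}(t)p-\tfrac12x^TC_{xx}(t)x-p^TC_{xp}(t)x,\qquad \Psi(x)=\min_{i\in\{1,\dots,m\}}\left\{\tfrac12x^TG_ix+a_i^Tx+b_i\right\}.$$ Moreover, $V_{NN}$ equals the value function of the associated optimal control problem: for all $t_0\in[0,T]$ and $x_0\in\mathbb{R}^n$, $$V_{NN}(t_0,x_0)=\inf_{(x,u)\in\mathcal{C}(t_0,x_0)}\left\{\int_{t_0}^T\Big(\tfrac12x(s)^TQ(s)x(s)+\tfrac12u(s)^TR(s)u(s)+x(s)^TS(s)u(s)\Big)ds+\Psi(x(T))\right\},$$ where $\mathcal{C}(t_0,x_0)$ is the set of $(x(\cdot),u(\cdot))\in L^2(t_0,T;\mathbb{R}^n)\times L^2(t_0,T;\mathbb{R}^l)$ satisfying $\dot x(s)=A(s)x(s)+B(s)u(s)$ for $s\in(t_0,T)$ and $x(t_0)=x_0$.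
   Context: $S^n$ denotes the real symmetric $n\times n$ matrices; $S^n_{>0}$ and $S^n_{\ge0}$ denote the symmetric positive definite and symmetric positive semi-definite $n\times n$ matrices (similarly $S^l_{>0}$ for $l\times l$). $C([0,T];E)$ denotes the continuous functions from $[0,T]$ to $E$. The trajectory $x(\cdot)$ in the Cauchy problem is absolutely continuous and solves the differential equation almost everywhere. ''Viscosity solution'' is in the standard sense for the backward (terminal value) Hamilton–Jacobi PDE displayed in the claim. *)

(* Defs.v *)
From HB Require Import structures.
From mathcomp Require Import all_boot all_order all_algebra.
From mathcomp Require Import all_classical all_reals all_analysis.

Set Implicit Arguments.
Unset Strict Implicit.
Unset Printing Implicit Defensive.

Import Order.TTheory GRing.Theory Num.Theory.
Import numFieldNormedType.Exports.

Local Open Scope classical_set_scope.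
Local Open Scope ring_scope.

Section LinearAlgebra.
Context {R : realType}.

Definition dot n (x y : 'cV[R]_n) : R := (x^T *m y) ord0 ord0.

Definition posdef n (M : 'M[R]_n) : Prop :=
  M^T = M /\ forall x : 'cV[R]_n, x != 0 -> 0 < dot x (M *m x).

Definition possemidef n (M : 'M[R]_n) : Prop :=
  M^T = M /\ forall x : 'cV[R]_n, 0 <= dot x (M *m x).

(* Using F 0 as the starting value is harmless, since it is among the values
   being compared. *)
Definition min_ord m (hm : (0 < m)%N) (F : 'I_m -> R) : R :=
  \big[Num.min/F (Ordinal hm)]_(i < m) F i.

End LinearAlgebra.

Section HamiltonJacobi.
Context {R : realType} {n : nat}.
Implicit Types (T t : R) (x : 'cV[R]_n).
Implicit Types (V : R -> 'cV[R]_n -> R) (phi : R * 'cV[R]_n -> R).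

(* In finite dimension, continuity of z |-> 'd phi z in operator norm is the
   same as continuity of z |-> 'd phi z h for every h. *)
Definition C1_on (D : set (R * 'cV[R]_n)) phi : Prop :=
  forall z, D z -> differentiable phi z /\
    forall h, {for z, continuous (fun y => 'd phi y h)}.

Definition partial_t phi t x : R := 'D_1 (fun s => phi (s, x)) t.

Definition grad_x phi t x : 'cV[R]_n :=
  \col_i 'D_(delta_mx i ord0) (fun y => phi (t, y)) x.

(* The inequalities are those for the equation with the sign written in
   - V_t + H(t, x, grad_x V) = 0; the orientation matters since the equation
   is to be solved backward from T. *)
Definition viscosity_subsolution T (H : R -> 'cV[R]_n -> 'cV[R]_n -> R) V :=
  forall phi, C1_on (`]0, T[ `*` setT) phi ->
  forall t x, t \in `]0, T[ ->
    (\forall z \near (t, x), V z.1 z.2 - phi z <= V t x - phi (t, x)) ->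
    - partial_t phi t x + H t x (grad_x phi t x) <= 0.

Definition viscosity_supersolution T (H : R -> 'cV[R]_n -> 'cV[R]_n -> R) V :=
  forall phi, C1_on (`]0, T[ `*` setT) phi ->
  forall t x, t \in `]0, T[ ->
    (\forall z \near (t, x), V t x - phi (t, x) <= V z.1 z.2 - phi z) ->
    0 <= - partial_t phi t x + H t x (grad_x phi t x).

(* V is continuous up to both ends of [0, T]; no growth in x is imposed. *)
Definition viscosity_solution T (H : R -> 'cV[R]_n -> 'cV[R]_n -> R)
    (Psi : 'cV[R]_n -> R) V : Prop :=
  [/\ {within `[0, T] `*` setT, continuous (fun z => V z.1 z.2)},
      viscosity_subsolution T H V,
      viscosity_supersolution T H V
    & forall x, V T x = Psi x].

End HamiltonJacobi.

Section Trajectories.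
Context {R : realType}.

Definition abs_continuous n (a b : R) (f : R -> 'cV[R]_n) : Prop :=
  forall e : R, 0 < e -> exists2 d : R, 0 < d &
    forall N (al be : 'I_N -> R),
      (forall k, [/\ a <= al k, al k <= be k & be k <= b]) ->
      trivIset setT (fun k => `]al k, be k[%classic) ->
      \sum_(k < N) (be k - al k) < d ->
      \sum_(k < N) `|f (be k) - f (al k)| < e.

Definition L2 n (a b : R) (f : R -> 'cV[R]_n) : Prop :=
  (forall i, measurable_fun `]a, b[ (fun s => f s i ord0)) /\
  (\int[lebesgue_measure]_(s in `]a, b[) (dot (f s) (f s))%:E < +oo)%E.

Definition admissible n l (A : R -> 'M[R]_n) (B : R -> 'M[R]_(n, l))
    (T t0 : R) (x0 : 'cV[R]_n) (x : R -> 'cV[R]_n) (u : R -> 'cV[R]_l) : Prop :=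
  [/\ L2 t0 T x, L2 t0 T u, abs_continuous t0 T x,
      {ae lebesgue_measure, forall s : R, s \in `]t0, T[ ->
        is_derive s (1 : R) x (A s *m x s + B s *m u s)}
    & x t0 = x0].

Definition cost n l (Q : R -> 'M[R]_n) (Rw : R -> 'M[R]_l)
    (S : R -> 'M[R]_(n, l)) (Psi : 'cV[R]_n -> R) (T t0 : R)
    (x : R -> 'cV[R]_n) (u : R -> 'cV[R]_l) : \bar R :=
  (\int[lebesgue_measure]_(s in `]t0, T[)
     (2^-1 * dot (x s) (Q s *m x s) + 2^-1 * dot (u s) (Rw s *m u s)
      + dot (x s) (S s *m u s))%:E
   + (Psi (x T))%:E)%E.

End Trajectories.

Section LinearQuadratic.
Context {R : realType} {n l : nat}.

Definition Cpp (B : R -> 'M[R]_(n, l)) (Rw : R -> 'M[R]_l) (t : R) : 'M[R]_n :=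
  B t *m invmx (Rw t) *m (B t)^T.

Definition Cxx (Q : R -> 'M[R]_n) (S : R -> 'M[R]_(n, l)) (Rw : R -> 'M[R]_l)
    (t : R) : 'M[R]_n :=
  Q t - S t *m invmx (Rw t) *m (S t)^T.

Definition Cxp (A : R -> 'M[R]_n) (B S : R -> 'M[R]_(n, l))
    (Rw : R -> 'M[R]_l) (t : R) : 'M[R]_n :=
  A t - B t *m invmx (Rw t) *m (S t)^T.

Definition hamiltonian (cpp cxx cxp : R -> 'M[R]_n) (t : R)
    (x p : 'cV[R]_n) : R :=
  2^-1 * dot p (cpp t *m p) - 2^-1 * dot x (cxx t *m x) - dot p (cxp t *m x).

Definition terminal_cost m (hm : (0 < m)%N) (G : 'I_m -> 'M[R]_n)
    (a : 'I_m -> 'cV[R]_n) (b : 'I_m -> R) (x : 'cV[R]_n) : R :=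
  min_ord hm (fun i => 2^-1 * dot x (G i *m x) + dot (a i) x + b i).

Definition V_NN m (hm : (0 < m)%N) (P : 'I_m -> R -> 'M[R]_n)
    (q : 'I_m -> R -> 'cV[R]_n) (r : 'I_m -> R -> R) (t : R)
    (x : 'cV[R]_n) : R :=
  min_ord hm (fun i => 2^-1 * dot x (P i t *m x) + dot (q i t) x + r i t).

End LinearQuadratic.

(* Main.v *)
Require Import Defs.
From HB Require Import structures.
From mathcomp Require Import all_boot all_order all_algebra.
From mathcomp Require Import all_classical all_reals all_analysis.
From mathcomp Require Import measurable_realfun ring lra.

(* [V_NN] is a minimum of classical solutions. At a point where a test function
   touches it from below the active [V_i] has the gradient of the test function;
   where one touches it from above, every [V_i] minus the test function would
   increase in the direction [(1, Cxp x - Cpp p)] if the subsolution inequality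
   failed, because the Hamiltonian is convex in [p].

   Uniqueness holds without growth conditions at infinity. If [W] is a solution,
   then [Z = W - V_i], read in the moving frame of the dynamics that are optimal
   for [V_i], solves [- Z_t + 1/2 Z_y . C(t) Z_y = 0] with [C] positive
   semidefinite and independent of [y]. With [M' = C], the subsolution property
   gives the Hopf-Lax inequality
     [Z(t1, y) <= Z(s, y + (M(s) - M(t1)) p) + 1/2 p . (M(s) - M(t1)) p].
   For [p = 0] this yields [W <= V_i]. For suitable [p] it bounds [Z(s, .)] from
   below by a quadratic function in the directions reached by the controls, which
   is the growth condition needed to compare [Z] with a soft minimum of the
   [V_j - V_i] on a short time slab; iterating backward from [T] gives
   [W >= min_j V_j].

   For the value function, completing the square shows that
   [s |-> V_i(s, x(s)) + \int_t0^s L] has nonnegative derivative almost everywhere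
   along an admissible trajectory and is constant along the feedback trajectory.

   The data are only controlled on [[0, T]]; composing them with the projection of
   the real line onto [[0, T]] makes them continuous everywhere. *)

Set Implicit Arguments.
Unset Strict Implicit.
Unset Printing Implicit Defensive.

Import Order.TTheory GRing.Theory Num.Theory.
Import numFieldNormedType.Exports.

Local Open Scope classical_set_scope.
Local Open Scope ring_scope.

(** * Linear algebra and limits of matrices *)

(** The obstacle to uniqueness is that a competitor may grow arbitrarily fast in [x], so that no
    penalty of prescribed growth localises extrema; growth bounds have to come from the equation.
    Upper bounds are easy, since the subsolution argument takes place in a tube around one curve.
    Lower bounds are harder because [C] may be degenerate: in the directions that the controls do
    not reach, nothing bounds [Z] from below at infinity. In those directions, however, [C]
    annihilates the gradient of a penalty, so a penalty of any strength is invisible to the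
    Hamiltonian. In the other directions the barrier is a concave paraboloid, whose curvature must
    increase backward in time at a rate quadratic in its size; it is controlled only on a slab whose
    length depends on its end time.

    Both comparisons use the viscosity inequalities only inside a cylinder. The final face is
    governed by the data, the lateral face by the penalties. The initial face carries no
    information, the equation being backward; a term exponential in time dominates there and makes
    the inequality strict inside. *)

Section Dot.
Context {R : realType}.

Lemma dotE n (x y : 'cV[R]_n) : dot x y = \sum_i x i ord0 * y i ord0.
Proof. by rewrite /dot mxE; apply: eq_bigr => i _; rewrite mxE. Qed.

Lemma dotC n (x y : 'cV[R]_n) : dot x y = dot y x.
Proof. by rewrite !dotE; apply: eq_bigr => i _; rewrite mulrC. Qed.

Lemma dotDl n (x y z : 'cV[R]_n) : dot (x + y) z = dot x z + dot y z.
Proof. by rewrite /dot linearD mulmxDl mxE. Qed.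

Lemma dotDr n (x y z : 'cV[R]_n) : dot x (y + z) = dot x y + dot x z.
Proof. by rewrite /dot mulmxDr mxE. Qed.

Lemma dotZl n a (x y : 'cV[R]_n) : dot (a *: x) y = a * dot x y.
Proof. by rewrite /dot linearZ /= -scalemxAl mxE. Qed.

Lemma dotZr n a (x y : 'cV[R]_n) : dot x (a *: y) = a * dot x y.
Proof. by rewrite dotC dotZl dotC. Qed.

Lemma dotNl n (x y : 'cV[R]_n) : dot (- x) y = - dot x y.
Proof. by rewrite -scaleN1r dotZl mulN1r. Qed.

Lemma dotNr n (x y : 'cV[R]_n) : dot x (- y) = - dot x y.
Proof. by rewrite dotC dotNl dotC. Qed.

Lemma dot0l n (x : 'cV[R]_n) : dot 0 x = 0.
Proof. by rewrite /dot trmx0 mul0mx mxE. Qed.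

Lemma dot0r n (x : 'cV[R]_n) : dot x 0 = 0.
Proof. by rewrite dotC dot0l. Qed.

Lemma dot_mull n k (A : 'M[R]_(n, k)) (x : 'cV[R]_n) (y : 'cV[R]_k) :
  dot x (A *m y) = dot (A^T *m x) y.
Proof. by rewrite /dot trmx_mul trmxK mulmxA. Qed.

Lemma dot_delta n (x : 'cV[R]_n) i : dot x (delta_mx i ord0) = x i ord0.
Proof.
rewrite dotE (bigD1 i) //= mxE !eqxx mulr1 big1 ?addr0 // => j ji.
by rewrite mxE (negbTE ji) mulr0.
Qed.

Lemma dot_deltal n (x : 'cV[R]_n) i : dot (delta_mx i ord0) x = x i ord0.
Proof. by rewrite dotC dot_delta. Qed.

Lemma dot_suml n I (r : seq I) (P : pred I) (F : I -> 'cV[R]_n) y :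
  dot (\sum_(i <- r | P i) F i) y = \sum_(i <- r | P i) dot (F i) y.
Proof.
by apply: (big_morph (fun x => dot x y)) => [a b|]; rewrite ?dotDl ?dot0l.
Qed.

Lemma dot_sqr_ge0 n (x : 'cV[R]_n) : 0 <= dot x x.
Proof. by rewrite dotE sumr_ge0 // => i _; rewrite -expr2 sqr_ge0. Qed.

Lemma le_norm_mx m n (A : 'M[R]_(m, n)) i j : `|A i j| <= `|A|.
Proof.
by rewrite [leRHS]/Num.Def.normr /= mx_normrE; apply: (le_bigmax _ _ (i, j)).
Qed.

Lemma norm_mx_le m n (A : 'M[R]_(m, n)) c : 0 <= c ->
  (forall i j, `|A i j| <= c) -> `|A| <= c.
Proof.
move=> c0 Ac; rewrite [leLHS]/Num.Def.normr /= mx_normrE.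
by apply: bigmax_le => // -[i j] _; exact: Ac.
Qed.

Lemma norm_dot n (x y : 'cV[R]_n) : `|dot x y| <= n%:R * `|x| * `|y|.
Proof.
rewrite dotE (le_trans (ler_norm_sum _ _ _))//.
rewrite -[n in n%:R]card_ord -mulrA mulr_natl -sumr_const.
apply: ler_sum => i _; rewrite normrM.
by apply: ler_pM => //; exact: le_norm_mx.
Qed.

Lemma norm_mulmx m n k (A : 'M[R]_(m, n)) (B : 'M[R]_(n, k)) :
  `|A *m B| <= n%:R * `|A| * `|B|.
Proof.
apply: norm_mx_le => [|i j]; first by rewrite !mulr_ge0.
rewrite mxE (le_trans (ler_norm_sum _ _ _))//.
rewrite -[n in n%:R]card_ord -mulrA mulr_natl -sumr_const.
apply: ler_sum => l _; rewrite normrM.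
by apply: ler_pM => //; exact: le_norm_mx.
Qed.

Lemma norm_sqr_dot n (x : 'cV[R]_n) : `|x| ^+ 2 <= dot x x.
Proof.
have d0 := dot_sqr_ge0 x.
rewrite -[leRHS]sqr_sqrtr // ler_pXn2r ?nnegrE ?sqrtr_ge0 //.
apply: norm_mx_le => [|i j]; first exact: sqrtr_ge0.
rewrite -sqrtr_sqr ler_sqrt // ord1 dotE (bigD1 i) //= expr2 lerDl.
by rewrite sumr_ge0 // => k _; rewrite -expr2 sqr_ge0.
Qed.

Lemma dot_eq0 n (x : 'cV[R]_n) : dot x x = 0 -> x = 0.
Proof.
move=> x0; have := norm_sqr_dot x; rewrite x0 => h.
by apply/eqP; rewrite -normr_eq0 -sqrf_eq0 eq_le h sqr_ge0.
Qed.

(* The quadratic form is nonnegative along the line [w + t v], whose values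
   form an affine function of [t] when [w] is isotropic. *)
Lemma psd_isotropic n (D : 'M[R]_n) (w : 'cV[R]_n) : possemidef D ->
  dot w (D *m w) = 0 -> D *m w = 0.
Proof.
move=> [DT D0] w0; apply: dot_eq0; set v := D *m w.
have h (t : R) : 0 <= t ^+ 2 * dot v (D *m v) + 2 * t * dot v v.
  have := D0 (w + t *: v); rewrite mulmxDr -scalemxAr !dotDl !dotDr !dotZl !dotZr.
  by rewrite w0 (dot_mull D w) DT -/v; nra.
have q0 := D0 v; have v0 := dot_sqr_ge0 v.
apply/eqP; rewrite eq_le v0 andbT leNgt; apply/negP => vp.
have d0 : 0 < 1 + dot v (D *m v) by rewrite ltr_wpDr.
have := h (- (dot v v / (1 + dot v (D *m v)))).
set a := dot v (D *m v) in q0 d0 *; set b := dot v v in vp v0 *.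
rewrite sqrrN mulrN mulNr subr_ge0 leNgt => /negP; apply.
have -> : (b / (1 + a)) ^+ 2 * a = (b / (1 + a)) * b * (a / (1 + a)).
  by field; rewrite gt_eqF.
have e0 : 0 < b / (1 + a) * b by rewrite mulr_gt0 ?divr_gt0.
have : a / (1 + a) < 1 by rewrite ltr_pdivrMr // mul1r; lra.
by move: e0; set e := b / (1 + a) * b => *; rewrite (_ : 2 * _ * b = 2 * e);
  [nra | rewrite /e; ring].
Qed.

End Dot.

Lemma continuous_pairr (X Y : topologicalType) (x : X) : continuous (fun y : Y => (x, y)).
Proof. by move=> y; apply: cvg_pair; [exact: cvg_cst | exact: cvg_id]. Qed.

Lemma continuous_pairl (X Y : topologicalType) (y : Y) : continuous (fun x : X => (x, y)).
Proof. by move=> x; apply: cvg_pair; [exact: cvg_id | exact: cvg_cst]. Qed.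

Lemma continuous_comp_fst (X Y U : topologicalType) (f : X -> U) :
  continuous f -> continuous (fun z : X * Y => f z.1).
Proof.
move=> cf z; have c0 : (fst : X * Y -> X) u @[u --> z] --> z.1 by exact: cvg_fst.
exact: (cvg_comp _ _ c0 (cf _)).
Qed.

Section MatrixLimits.
Context {R : realType}.

Lemma cvg_mx (X : Type) (F : set_system X) {FF : Filter F} m n
    (f : X -> 'M[R]_(m, n)) (l : 'M[R]_(m, n)) :
  (forall i j, f x i j @[x --> F] --> l i j) -> f x @[x --> F] --> l.
Proof.
move=> fl; apply/cvgrPdist_le => /= e e0.
have : \forall x \near F, forall ij : 'I_m * 'I_n, `|l ij.1 ij.2 - f x ij.1 ij.2| <= e.
  by apply: filter_forall => ij; move/cvgrPdist_le: (fl ij.1 ij.2); apply.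
apply: filterS => x h; apply: norm_mx_le => [|i j]; first exact: ltW.
by rewrite !mxE; exact: (h (i, j)).
Qed.

Lemma cvg_mx_coord (X : Type) (F : set_system X) {FF : Filter F} m n
    (f : X -> 'M[R]_(m, n)) (l : 'M[R]_(m, n)) i j :
  f x @[x --> F] --> l -> f x i j @[x --> F] --> l i j.
Proof.
move=> /cvgrPdist_le fl; apply/cvgrPdist_le => /= e /fl.
apply: filterS => x; apply: le_trans.
by have := le_norm_mx (l - f x) i j; rewrite !mxE.
Qed.

Lemma cvg_bigsum (X : Type) (F : set_system X) {FF : Filter F} I (r : seq I)
    (V : normedModType R) (f : I -> X -> V) (l : I -> V) :
  (forall i, f i x @[x --> F] --> l i) ->
  (\sum_(i <- r) f i x) @[x --> F] --> \sum_(i <- r) l i.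
Proof.
move=> fl; elim: r => [|i r IH].
  by rewrite big_nil; under eq_fun do rewrite big_nil; exact: cvg_cst.
by rewrite big_cons; under eq_fun do rewrite big_cons; apply: cvgD.
Qed.

Lemma cvg_mulmx (X : Type) (F : set_system X) {FF : Filter F} m n k
    (f : X -> 'M[R]_(m, n)) (g : X -> 'M[R]_(n, k))
    (l : 'M[R]_(m, n)) (l' : 'M[R]_(n, k)) :
  f x @[x --> F] --> l -> g x @[x --> F] --> l' ->
  (f x *m g x) @[x --> F] --> l *m l'.
Proof.
move=> fl gl; apply: cvg_mx => i j; rewrite mxE.
under eq_fun do rewrite mxE.
by apply: cvg_bigsum => s; apply: cvgM; exact: cvg_mx_coord.
Qed.

Lemma cvg_trmx (X : Type) (F : set_system X) {FF : Filter F} m n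
    (f : X -> 'M[R]_(m, n)) (l : 'M[R]_(m, n)) :
  f x @[x --> F] --> l -> (f x)^T @[x --> F] --> l^T.
Proof.
move=> fl; apply: cvg_mx => i j; rewrite mxE.
by under eq_fun do rewrite mxE; exact: cvg_mx_coord.
Qed.

Lemma cvg_dot (X : Type) (F : set_system X) {FF : Filter F} n
    (f g : X -> 'cV[R]_n) (l l' : 'cV[R]_n) :
  f x @[x --> F] --> l -> g x @[x --> F] --> l' ->
  dot (f x) (g x) @[x --> F] --> dot l l'.
Proof.
move=> fl gl; rewrite /dot.
by apply: cvg_mx_coord; apply: cvg_mulmx => //; exact: cvg_trmx.
Qed.

(** By Cramer's rule: the inverse is the adjugate divided by the determinant, and both are
    polynomials in the entries. *)
Lemma cvg_invmx (X : Type) (F : set_system X) {FF : Filter F} n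
    (f : X -> 'M[R]_n) (l : 'M[R]_n) : (forall x, f x \in unitmx) -> l \in unitmx ->
  f x @[x --> F] --> l -> invmx (f x) @[x --> F] --> invmx l.
Proof.
have prod_cvg d (Y : seq 'I_d) (h : 'I_d -> X -> R) (k : 'I_d -> R) : (forall i, h i x @[x --> F] --> k i) ->
    (\prod_(i <- Y) h i x) @[x --> F] --> \prod_(i <- Y) k i.
  move=> hk; elim: Y => [|i Y IH].
    by rewrite big_nil; under eq_fun do rewrite big_nil; exact: cvg_cst.
  by rewrite big_cons; under eq_fun do rewrite big_cons; apply: cvgM.
have det_cvg k (A : X -> 'M[R]_k) (B : 'M[R]_k) :
    A x @[x --> F] --> B -> \det (A x) @[x --> F] --> \det B.
  move=> AB; rewrite /determinant; apply: cvg_bigsum => s.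
  by apply: cvgM; [exact: cvg_cst | apply: prod_cvg => i; exact: cvg_mx_coord].
move=> fu lu fl.
have -> : invmx l = (\det l)^-1 *: \adj l by rewrite /invmx lu.
have -> : (fun x => invmx (f x)) = (fun x => (\det (f x))^-1 *: \adj (f x)).
  by apply: boolp.funext => x; rewrite /invmx fu.
apply: cvgZ.
  by apply: cvgV; [rewrite -unitfE -unitmxE | exact: det_cvg].
apply: cvg_mx => i j; rewrite mxE; under eq_fun do rewrite mxE.
apply: cvgM; first exact: cvg_cst.
apply: det_cvg; apply: cvg_mx => a c; rewrite !mxE.
by under eq_fun do rewrite !mxE; exact: cvg_mx_coord.
Qed.

End MatrixLimits.

(** * Test functions and viscosity inequalities *)

Section IsDiff.
Context {R : realType}.

Lemma is_diff_linear (V W : normedModType R) (f : V -> W) x :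
  linear f -> continuous f -> is_diff x f f.
Proof.
move=> fl fc.
pose fL : {linear V -> W} := HB.pack f (GRing.isLinear.Build _ _ _ _ _ fl).
have -> : f = fL by [].
by apply: DiffDef; [exact: linear_differentiable | rewrite diff_lin].
Qed.

Lemma is_diff_bigsum (V W : normedModType R) I (r : seq I) (f df : I -> V -> W) x :
  (forall i, is_diff x (f i) (df i)) ->
  is_diff x (fun z => \sum_(i <- r) f i z) (fun h => \sum_(i <- r) df i h).
Proof.
move=> fd; elim: r => [|i r IH].
  under eq_fun do rewrite big_nil; under [X in is_diff _ _ X]eq_fun do rewrite big_nil.
  exact: is_diff_cst.
under eq_fun do rewrite big_cons; under [X in is_diff _ _ X]eq_fun do rewrite big_cons.
exact: is_diffD.
Qed.

Lemma is_diff_mx (V : normedModType R) n (f df : V -> 'cV[R]_n) x :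
  (forall i, is_diff x (fun z => f z i ord0) (fun h => df h i ord0)) ->
  is_diff x f df.
Proof.
move=> fd.
have E (g : V -> 'cV[R]_n) : g = fun z => \sum_i g z i ord0 *: (delta_mx i ord0 : 'cV[R]_n).
  apply: boolp.funext => z; rewrite {1}[g z]matrix_sum_delta.
  by apply: eq_bigr => i _; rewrite big_ord1.
rewrite (E f) (E df); apply: is_diff_bigsum => i.
have fdi := fd i.
have h : differentiable (fun z => f z i ord0) x by exact: ex_diff.
apply: DiffDef; first exact: differentiableZl.
by rewrite (diffZl _ h) diff_val.
Qed.

End IsDiff.

Section TestFunctions.
Context {R : realType} {n : nat}.
Implicit Types (T : R) (phi : R * 'cV[R]_n -> R) (pt : R * 'cV[R]_n -> R).
Implicit Types (px : R * 'cV[R]_n -> 'cV[R]_n).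

(** A C^1 function on the open slab together with its partial derivatives. Carrying them explicitly
    turns the differentiation of a composite test function into an application of closure lemmas. *)
Record tfun T phi pt px : Prop := Tfun { tfunP : forall z, 0 < z.1 < T ->
  [/\ is_diff z phi (fun h => pt z * h.1 + dot (px z) h.2),
      {for z, continuous pt} & {for z, continuous px}] }.

Lemma tfun_ext T phi pt px phi' pt' px' : tfun T phi pt px ->
  phi =1 phi' -> pt =1 pt' -> px =1 px' -> tfun T phi' pt' px'.
Proof. by move=> h /funext <- /funext <- /funext <-. Qed.

Lemma tfun_cst T c : tfun T (fun=> c) (fun=> 0) (fun=> 0).
Proof.
split=> z _; split; [|exact: cvg_cst..].
apply: is_diff_eq; apply/funext => h /=.
by rewrite dot0l mul0r addr0.
Qed.

Lemma tfunD T phi pt px phi' pt' px' : tfun T phi pt px -> tfun T phi' pt' px' ->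
  tfun T (fun z => phi z + phi' z) (fun z => pt z + pt' z) (fun z => px z + px' z).
Proof.
move=> h h'; split=> z zT; have [d ct cx] := tfunP h zT; have [d' ct' cx'] := tfunP h' zT.
split; [|exact: cvgD..].
apply: is_diff_eq; apply/funext => k /=; rewrite !fctE dotDl; ring.
Qed.

Lemma tfunM T phi pt px phi' pt' px' : tfun T phi pt px -> tfun T phi' pt' px' ->
  tfun T (fun z => phi z * phi' z) (fun z => phi z * pt' z + phi' z * pt z)
         (fun z => phi z *: px' z + phi' z *: px z).
Proof.
move=> h h'; split=> z zT; have [d ct cx] := tfunP h zT; have [d' ct' cx'] := tfunP h' zT.
have c : {for z, continuous phi} by apply: differentiable_continuous; exact: ex_diff.
have c' : {for z, continuous phi'} by apply: differentiable_continuous; exact: ex_diff.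
split; [|by apply: cvgD; apply: cvgM|by apply: cvgD; apply: cvgZ].
apply: is_diff_eq; apply/funext => k /=; rewrite !fctE dotDl !dotZl /GRing.scale /=; ring.
Qed.

Lemma tfunZ T a phi pt px : tfun T phi pt px ->
  tfun T (fun z => a * phi z) (fun z => a * pt z) (fun z => a *: px z).
Proof.
move=> h; apply: tfun_ext (tfunM (tfun_cst T a) h) _ _ _ => // z.
  by rewrite mulr0 addr0.
by rewrite scaler0 addr0.
Qed.

Lemma tfunN T phi pt px : tfun T phi pt px ->
  tfun T (fun z => - phi z) (fun z => - pt z) (fun z => - px z).
Proof.
move=> h; apply: tfun_ext (tfunZ (-1) h) _ _ _ => z /=.
- exact: mulN1r.
- exact: mulN1r.
- exact: scaleN1r.
Qed.

Lemma tfun_sum T I (r : seq I) (phi pt : I -> R * 'cV[R]_n -> R) (px : I -> R * 'cV[R]_n -> 'cV[R]_n) :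
  (forall i, tfun T (phi i) (pt i) (px i)) ->
  tfun T (fun z => \sum_(i <- r) phi i z) (fun z => \sum_(i <- r) pt i z)
         (fun z => \sum_(i <- r) px i z).
Proof.
move=> h; elim: r => [|i r IH].
  by apply: tfun_ext (tfun_cst T 0) _ _ _ => z; rewrite big_nil.
by apply: tfun_ext (tfunD (h i) IH) _ _ _ => z; rewrite big_cons.
Qed.

Lemma tfun_comp T phi pt px (g g' : R -> R) : tfun T phi pt px ->
  (forall z, is_derive (phi z) (1 : R) g (g' (phi z))) ->
  (forall z, {for phi z, continuous g'}) ->
  tfun T (fun z => g (phi z)) (fun z => g' (phi z) * pt z) (fun z => g' (phi z) *: px z).
Proof.
move=> h dg cg; split=> z zT; have [d ct cx] := tfunP h zT.
have c : {for z, continuous phi} by apply: differentiable_continuous; exact: ex_diff.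
have cg' : {for z, continuous (g' \o phi)} by apply: continuous_comp; [|exact: cg].
split; [|exact: cvgM|exact: cvgZ].
have gd : is_diff (phi z) g (fun h => h * g' (phi z)).
  have dgz := dg z; apply: DiffDef; first exact/derivable1_diffP/ex_derive.
  rewrite deriv1E ?derive1E ?derive_val //; exact: ex_derive.
apply: is_diff_eq; apply/funext => k /=; rewrite dotZl; ring.
Qed.

Lemma tfun_time T (f f' : R -> R) :
  (forall t, 0 < t < T -> is_derive t (1 : R) f (f' t)) ->
  (forall t, 0 < t < T -> {for t, continuous f'}) ->
  tfun T (fun z => f z.1) (fun z => f' z.1) (fun=> 0).
Proof.
move=> df cf ; split=> z zT; split.
- have dfz := df _ zT.
  have gd : is_diff (z.1) f (fun h => h * f' z.1).
    apply: DiffDef; first exact/derivable1_diffP/ex_derive.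
    rewrite deriv1E ?derive1E ?derive_val //; exact: ex_derive.
  have fd : is_diff z (fst : R * 'cV[R]_n -> R) fst.
    by apply: is_diff_linear => // y; exact: cvg_fst.
  apply: is_diff_eq; apply/funext => k /=; rewrite dot0l; ring.
- by apply: (@continuous_comp _ _ _ fst f'); [exact: cvg_fst | exact: cf].
- exact: cvg_cst.
Qed.

Lemma tfun_coord T i :
  tfun T (fun z => z.2 i ord0) (fun=> 0) (fun=> delta_mx i ord0).
Proof.
split=> z zT; split; [|exact: cvg_cst..].
have fd : is_diff z (snd : R * 'cV[R]_n -> 'cV[R]_n) snd.
  by apply: is_diff_linear => // y; exact: cvg_snd.
have cd : is_diff (z.2) (fun x : 'cV[R]_n => x i ord0) (fun h => h i ord0).
  by apply: is_diff_linear => [a x y|]; [rewrite !mxE | exact: coord_continuous].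
by apply: (is_diff_eq (is_diff_comp fd cd)); apply/funext => k /=; rewrite dotC dot_delta mul0r add0r.
Qed.

End TestFunctions.

Lemma tfun_change (R : realType) (n k : nat) (T : R)
    (phi pt : R * 'cV[R]_n -> R) (px : R * 'cV[R]_n -> 'cV[R]_n)
    (G Gt : R * 'cV[R]_k -> 'cV[R]_n) (Gx : 'I_n -> R * 'cV[R]_k -> 'cV[R]_k) :
  tfun T phi pt px ->
  (forall i, tfun T (fun z => G z i ord0) (fun z => Gt z i ord0) (Gx i)) ->
  tfun T (fun z => phi (z.1, G z))
    (fun z => pt (z.1, G z) + dot (px (z.1, G z)) (Gt z))
    (fun z => \sum_i px (z.1, G z) i ord0 *: Gx i z).
Proof.
move=> h hG ; split=> z zT.
have [d ct cx] := tfunP h (zT : 0 < (z.1, G z).1 < T).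
have Gd : is_diff z G (fun h => \col_i (Gt z i ord0 * h.1 + dot (Gx i z) h.2)).
  apply: is_diff_mx => i.
  by under [X in is_diff _ _ X]eq_fun do rewrite mxE; have [] := tfunP (hG i) zT.
have fd : is_diff z (fst : R * 'cV[R]_k -> R) fst.
  by apply: is_diff_linear => // y; exact: cvg_fst.
have pd := is_diff_pair fd Gd.
have cG : {for z, continuous (fun z => (z.1, G z))}.
  by apply: differentiable_continuous; case: pd.
have cpx : {for z, continuous (fun z => px (z.1, G z))}.
  exact: (@continuous_comp _ _ _ (fun z => (z.1, G z)) px).
split.
- apply: (is_diff_eq (@is_diff_comp _ _ _ _ _ _ _ _ _ pd d)); apply/funext => h' /=.
  rewrite dot_suml mulrDl -addrA; congr (_ + _).
  rewrite !dotE mulr_suml -big_split /=; apply: eq_bigr => i _.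
  by rewrite mxE dotZl; ring.
- apply: cvgD; first exact: (@continuous_comp _ _ _ (fun z => (z.1, G z)) pt).
  by apply: cvg_dot => //; apply: cvg_mx => i j; rewrite ord1; have [] := tfunP (hG i) zT.
- apply: cvg_bigsum => i; apply: cvgZ; last by have [] := tfunP (hG i) zT.
  exact: cvg_mx_coord.
Qed.

Section Conversion.
Context {R : realType} {n : nat}.
Implicit Types (T : R) (phi pt : R * 'cV[R]_n -> R) (px : R * 'cV[R]_n -> 'cV[R]_n).

Lemma partial_tE phi t x : differentiable phi (t, x) ->
  partial_t phi t x = 'd phi (t, x) (1, 0).
Proof.
move=> d; have pd : is_diff (t, x) phi ('d phi (t, x)) by exact: DiffDef.
have id1 : is_diff t (fun s : R => s) id by exact: is_diff_id.
have cd : is_diff t (fun s : R => x) (fun=> 0) by exact: is_diff_cst.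
have := @is_diff_comp _ _ _ _ _ _ _ _ _ (is_diff_pair id1 cd) pd.
rewrite /partial_t => -[d1 d2]; rewrite deriveE //.
by have := congr1 (fun f : R -> R => f 1) d2.
Qed.

Lemma grad_xE phi t x : differentiable phi (t, x) ->
  grad_x phi t x = \col_i 'd phi (t, x) (0, delta_mx i ord0).
Proof.
move=> d; have pd : is_diff (t, x) phi ('d phi (t, x)) by exact: DiffDef.
have id1 : is_diff x (fun y : 'cV[R]_n => y) id by exact: is_diff_id.
have cd : is_diff x (fun y : 'cV[R]_n => t) (fun=> 0) by exact: is_diff_cst.
have := @is_diff_comp _ _ _ _ _ _ _ _ _ (is_diff_pair cd id1) pd.
move=> -[d1 d2]; apply/colP => i; rewrite !mxE deriveE //.
by have := congr1 (fun f : 'cV[R]_n -> R => f (delta_mx i ord0)) d2.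
Qed.

Lemma diff_partials phi z h : differentiable phi z ->
  'd phi z h = partial_t phi z.1 z.2 * h.1 + dot (grad_x phi z.1 z.2) h.2.
Proof.
case: z => t x d; rewrite partial_tE // grad_xE //.
case: h => a y /=; have -> : (a, y) = a *: (1, 0) + \sum_i y i ord0 *: (0, delta_mx i ord0).
  have -> : \sum_i y i ord0 *: ((0, delta_mx i ord0) : R * 'cV[R]_n) =
      (0, \sum_i y i ord0 *: (delta_mx i ord0 : 'cV[R]_n)).
    rewrite (big_morph (fun x : 'cV[R]_n => ((0, x) : R * 'cV[R]_n))
      (id1 := 0) (op1 := +%R)) //; last by move=> u v; congr pair; rewrite /= addr0.
    by apply: eq_bigr => i _; congr pair; rewrite scaler0.
  have -> : \sum_i y i ord0 *: (delta_mx i ord0 : 'cV[R]_n) = y.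
    by rewrite {2}[y]matrix_sum_delta; apply: eq_bigr => i _; rewrite big_ord1.
  by congr pair; rewrite ?scaler0 /= ?addr0 ?add0r ?scaler0 ?add0r /GRing.scale /= ?mulr1.
rewrite linearD linearZ linear_sum /=; congr (_ + _); first exact: mulrC.
rewrite dotE; apply: eq_bigr => i _.
by rewrite linearZ /= !mxE mulrC.
Qed.

Lemma near_eq_continuous (X Y : topologicalType) (f g : X -> Y) (z : X) :
  (\forall w \near z, f w = g w) -> {for z, continuous f} -> {for z, continuous g}.
Proof.
move=> fg cf; rewrite /prop_for /continuous_at -(nbhs_singleton fg).
by apply: cvg_trans cf; exact: near_eq_cvg.
Qed.

Lemma near_itv T (z : R * 'cV[R]_n) : 0 < z.1 < T -> \forall w \near z, 0 < w.1 < T.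
Proof.
move=> zT.
have c : {for z, continuous (fst : R * 'cV[R]_n -> R)} by exact: cvg_fst.
have zi : z.1 \in `]0, T[ by rewrite in_itv.
have h : \forall w \near z, w.1 \in `]0, T[ by exact: (c _ (near_in_itvoo zi)).
by near=> w; have : w.1 \in `]0, T[ by [near: w]; rewrite in_itv.
Unshelve. all: by end_near.
Qed.

Lemma C1_tfun T phi : C1_on (`]0, T[ `*` setT) phi ->
  tfun T phi (fun z => partial_t phi z.1 z.2) (fun z => grad_x phi z.1 z.2).
Proof.
move=> h; have hd z : 0 < z.1 < T -> differentiable phi z.
  by move=> zT; have [] // := h z; split => //=; rewrite in_itv.
split=> z zT; have [|d c] := h z; first by split => //=; rewrite in_itv.
split.
- by apply: DiffDef => //; apply/funext => k; exact: diff_partials.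
- apply: near_eq_continuous (c (1, 0)).
  near=> w; rewrite partial_tE; last by apply: hd; near: w; exact: near_itv.
  by rewrite -surjective_pairing.
- apply: cvg_mx => i j; rewrite ord1.
  apply: (near_eq_continuous (g := fun w => grad_x phi w.1 w.2 i ord0) _ (c (0, delta_mx i ord0))).
  near=> w; rewrite grad_xE; last by apply: hd; near: w; exact: near_itv.
  by rewrite mxE -surjective_pairing.
Unshelve. all: by end_near. Qed.

Lemma tfun_C1 T phi pt px : tfun T phi pt px -> C1_on (`]0, T[ `*` setT) phi.
Proof.
move=> h z [/= zT _]; rewrite in_itv /= in zT.
have [d ct cx] := tfunP h zT; split; first exact: ex_diff.
move=> k.
apply: (near_eq_continuous (f := fun w => pt w * k.1 + dot (px w) k.2)); last first.
  apply: cvgD; first by apply: cvgM => //; exact: cvg_cst.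
  by apply: cvg_dot => //; exact: cvg_cst.
near=> w; have wT : 0 < w.1 < T by near: w; exact: near_itv.
by have [dw _ _] := tfunP h wT; rewrite diff_val.
Unshelve. all: by end_near. Qed.

Lemma tfun_partials T phi pt px z : tfun T phi pt px -> 0 < z.1 < T ->
  partial_t phi z.1 z.2 = pt z /\ grad_x phi z.1 z.2 = px z.
Proof.
move=> h zT; have [d _ _] := tfunP h zT; case: z zT d => t x /= zT d.
have dd : differentiable phi (t, x) by exact: ex_diff.
rewrite partial_tE // grad_xE // diff_val /= dot0r mulr1 addr0; split => //.
by apply/colP => i; rewrite mxE mulr0 add0r dot_delta.
Qed.

(** The viscosity inequalities in terms of [tfun]. They look at [Z] only for times in []0, T[], so a
    solution can be replaced by a continuous function on the whole space that agrees with it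
    there. *)
Definition vsub T (H : R * 'cV[R]_n -> 'cV[R]_n -> R) (Z : R * 'cV[R]_n -> R) :=
  forall phi pt px, tfun T phi pt px -> forall z, 0 < z.1 < T ->
    (\forall w \near z, Z w - phi w <= Z z - phi z) -> - pt z + H z (px z) <= 0.

Definition vsuper T (H : R * 'cV[R]_n -> 'cV[R]_n -> R) (Z : R * 'cV[R]_n -> R) :=
  forall phi pt px, tfun T phi pt px -> forall z, 0 < z.1 < T ->
    (\forall w \near z, Z z - phi z <= Z w - phi w) -> 0 <= - pt z + H z (px z).

Variables (T : R) (H : R -> 'cV[R]_n -> 'cV[R]_n -> R) (V : R -> 'cV[R]_n -> R).
Variable Z : R * 'cV[R]_n -> R.
Hypothesis ZV : forall z, 0 < z.1 < T -> Z z = V z.1 z.2.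
Let Hz z := H z.1 z.2.

Lemma viscosity_vsub : viscosity_subsolution T H V -> vsub T Hz Z.
Proof.
move=> h phi pt px hp [t x] zT mx.
have [<- <-] := tfun_partials hp zT.
apply: h; [exact: tfun_C1 hp | by rewrite in_itv |].
near=> w; have wT : 0 < w.1 < T by near: w; exact: near_itv.
by rewrite -(ZV wT) -[V t x](ZV zT); near: w.
Unshelve. all: by end_near. Qed.

Lemma viscosity_vsuper : viscosity_supersolution T H V -> vsuper T Hz Z.
Proof.
move=> h phi pt px hp [t x] zT mx.
have [<- <-] := tfun_partials hp zT.
apply: h; [exact: tfun_C1 hp | by rewrite in_itv |].
near=> w; have wT : 0 < w.1 < T by near: w; exact: near_itv.
by rewrite -(ZV wT) -[V t x](ZV zT); near: w.
Unshelve. all: by end_near. Qed.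

Lemma vsub_viscosity : vsub T Hz Z -> viscosity_subsolution T H V.
Proof.
move=> h phi /C1_tfun hp t x; rewrite in_itv /= => tT mx.
apply: (h _ _ _ hp (t, x) tT).
near=> w; have wT : 0 < w.1 < T by near: w; exact: near_itv.
by rewrite (ZV wT) (@ZV (t, x) tT); near: w.
Unshelve. all: by end_near. Qed.

Lemma vsuper_viscosity : vsuper T Hz Z -> viscosity_supersolution T H V.
Proof.
move=> h phi /C1_tfun hp t x; rewrite in_itv /= => tT mx.
apply: (h _ _ _ hp (t, x) tT).
near=> w; have wT : 0 < w.1 < T by near: w; exact: near_itv.
by rewrite (ZV wT) (@ZV (t, x) tT); near: w.
Unshelve. all: by end_near. Qed.

End Conversion.

(** * Derivatives of matrix-valued functions and of quadratic functions of the state *)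

Section DeriveMatrix.
Context {R : realType}.

Lemma is_derive_coord (V : normedModType R) m n (M : V -> 'M[R]_(m, n)) dM t v i j :
  is_derive t v M dM -> is_derive t v (fun s => M s i j) (dM i j).
Proof.
move=> d; have dM' : derivable M t v by exact: ex_derive.
apply: DeriveDef; first exact: ((derivable_mxP M t v).1 dM' i j).
by have := derive_val (is_derive := d); rewrite derive_mx // => <-; rewrite mxE.
Qed.

Lemma is_derive_mx (V : normedModType R) m n (M : V -> 'M[R]_(m, n)) (dM : 'M[R]_(m, n)) t v :
  (forall i j, is_derive t v (fun s => M s i j) (dM i j)) -> is_derive t v M dM.
Proof.
move=> d; have dM' : derivable M t v.
  by apply/derivable_mxP => i j; exact: ex_derive.
apply: DeriveDef => //; rewrite derive_mx //; apply/matrixP => i j; rewrite mxE.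
by rewrite derive_val.
Qed.

Lemma is_derive_bigsum (V W : normedModType R) I (r : seq I) (f : I -> V -> W) df t v :
  (forall i, is_derive t v (f i) (df i)) ->
  is_derive t v (fun s => \sum_(i <- r) f i s) (\sum_(i <- r) df i).
Proof.
move=> d; elim: r => [|i r IH].
  under eq_fun do rewrite big_nil; rewrite big_nil; exact: is_derive_cst.
under eq_fun do rewrite big_cons; rewrite big_cons; exact: is_deriveD.
Qed.

Lemma is_derive_mulmx (V : normedModType R) m n k (A : V -> 'M[R]_(m, n))
    (B : V -> 'M[R]_(n, k)) dA dB t v :
  is_derive t v A dA -> is_derive t v B dB ->
  is_derive t v (fun s => A s *m B s) (dA *m B t + A t *m dB).
Proof.
move=> hA hB; apply: is_derive_mx => i j.
under eq_fun do rewrite mxE; rewrite !mxE -big_split /=.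
apply: is_derive_bigsum => l.
have dAl := is_derive_coord i l hA; have dBl := is_derive_coord l j hB.
have dp := is_deriveM dAl dBl; apply: (@is_derive_eq _ _ _ _ _ _ _ _ dp); rewrite /GRing.scale /=. by rewrite addrC (mulrC (dA i l)).
Qed.

Lemma is_derive_trmx (V : normedModType R) m n (A : V -> 'M[R]_(m, n)) dA t v :
  is_derive t v A dA -> is_derive t v (fun s => (A s)^T) dA^T.
Proof.
move=> hA; apply: is_derive_mx => i j; under eq_fun do rewrite mxE.
by rewrite mxE; exact: is_derive_coord.
Qed.

Lemma dot_inj n (u v : 'cV[R]_n) : (forall h, dot u h = dot v h) -> u = v.
Proof. by move=> uv; apply/colP => i; rewrite -!dot_delta uv. Qed.

End DeriveMatrix.

Section Quadratic.
Context {R : realType} {n : nat}.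

Definition vquad (P : R -> 'M[R]_n) (q : R -> 'cV[R]_n) (r : R -> R)
    (z : R * 'cV[R]_n) : R :=
  2^-1 * dot z.2 (P z.1 *m z.2) + dot (q z.1) z.2 + r z.1.

Lemma tfun_vquad (T : R) (P P' : R -> 'M[R]_n) (q q' : R -> 'cV[R]_n) (r r' : R -> R) :
  (forall t, (P t)^T = P t) ->
  (forall t : R, 0 < t < T -> is_derive t (1 : R) P (P' t)) ->
  (forall t : R, 0 < t < T -> {for t, continuous P'}) ->
  (forall t : R, 0 < t < T -> is_derive t (1 : R) q (q' t)) ->
  (forall t : R, 0 < t < T -> {for t, continuous q'}) ->
  (forall t : R, 0 < t < T -> is_derive t (1 : R) r (r' t)) ->
  (forall t : R, 0 < t < T -> {for t, continuous r'}) ->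
  tfun T (vquad P q r) (vquad P' q' r') (fun z => P z.1 *m z.2 + q z.1).
Proof.
move=> Ps dP cP dq cq dr cr.
have tP i j : tfun T (fun z : R * 'cV[R]_n => P z.1 i j) (fun z => P' z.1 i j) (fun=> 0).
  apply: (@tfun_time _ n T (fun t => P t i j) (fun t => P' t i j)) => t tT; first exact: is_derive_coord (dP t tT).
  by have := cP t tT; exact: cvg_mx_coord.
have tq i : tfun T (fun z : R * 'cV[R]_n => q z.1 i ord0) (fun z => q' z.1 i ord0) (fun=> 0).
  apply: (@tfun_time _ n T (fun t => q t i ord0) (fun t => q' t i ord0)) => t tT; first exact: is_derive_coord (dq t tT).
  by have := cq t tT; exact: cvg_mx_coord.
have tr := @tfun_time _ n _ _ _ dr cr.
have tx := @tfun_coord _ n T.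
have tPx i := tfun_sum (index_enum 'I_n) (fun j => tfunM (tP i j) (tx j)).
have txPx := tfunZ 2^-1 (tfun_sum (index_enum 'I_n) (fun i => tfunM (tx i) (tPx i))).
have tqx := tfun_sum (index_enum 'I_n) (fun i => tfunM (tq i) (tx i)).
apply: tfun_ext (tfunD (tfunD txPx tqx) tr) _ _ _ => -[t x] /=.
- rewrite /vquad /= (dotE (q t)) dotE; congr (_ * _ + _ + _).
  by apply: eq_bigr => i _; rewrite mxE.
- rewrite /vquad /= (dotE (q' t)) dotE; congr (_ * _ + _ + _).
    apply: eq_bigr => i _; rewrite mxE mulr0 addr0; congr (_ * _).
    by apply: eq_bigr => j _; rewrite mulr0 add0r mulrC.
  by apply: eq_bigr => i _; rewrite mulr0 add0r mulrC.
- apply: dot_inj => h; rewrite addr0 !dotDl dotZl !dot_suml; congr (_ + _).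
    have e : dot (P t *m x) h = dot x (P t *m h) by rewrite dot_mull Ps.
    rewrite [RHS](_ : _ = 2^-1 * (dot x (P t *m h) + dot (P t *m x) h)); last by rewrite e; field.
    congr (_ * _); rewrite !dotE -big_split /=; apply: eq_bigr => i _.
    rewrite dotDl !dotZl dot_deltal dot_suml !mxE; congr (_ * _ + _ * _).
    by apply: eq_bigr => j _; rewrite dotDl !dotZl dot0l mulr0 addr0 dot_deltal.
  rewrite dotE; apply: eq_bigr => i _.
  by rewrite dotDl !dotZl dot0l mulr0 addr0 dot_deltal.
Qed.

(** The three final value problems are the Hamilton-Jacobi equation of a quadratic function, sorted
    by degree 2, 1 and 0 in [x]. The two mixed terms of the Riccati equation have the same quadratic
    form; taking both keeps the right-hand side symmetric. *)
Lemma vquad_hamiltonian (cpp cxx cxp : R -> 'M[R]_n) (P : R -> 'M[R]_n)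
    (q : R -> 'cV[R]_n) (z : R * 'cV[R]_n) :
  (cpp z.1)^T = cpp z.1 -> (P z.1)^T = P z.1 ->
  vquad (fun t => (P t)^T *m cpp t *m P t - (P t)^T *m cxp t - (cxp t)^T *m P t - cxx t)
        (fun t => (P t)^T *m cpp t *m q t - (cxp t)^T *m q t)
        (fun t => 2^-1 * dot (q t) (cpp t *m q t)) z =
  hamiltonian cpp cxx cxp z.1 z.2 (P z.1 *m z.2 + q z.1).
Proof.
case: z => t x /= Cs Ps; rewrite /vquad /hamiltonian /= Ps.
set C := cpp t in Cs *; set Xp := cxp t; set M := P t in Ps *; set Xx := cxx t.
rewrite !mulmxBl -!mulmxA !mulmxDr !(dotDl, dotDr, dotNl, dotNr).
have e1 (y : 'cV[R]_n) : dot x (M *m y) = dot (M *m x) y by rewrite dot_mull Ps.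
have e2 (y : 'cV[R]_n) : dot x (Xp^T *m y) = dot y (Xp *m x) by rewrite dot_mull trmxK dotC.
have e3 (y : 'cV[R]_n) : dot y (M *m x) = dot (M *m y) x by rewrite dot_mull Ps.
rewrite !e1 !e2 (dotC (M *m _) x) e1 (dotC (Xp^T *m _) x) e2.
have e4 : dot (q t) (C *m (M *m x)) = dot (M *m x) (C *m q t).
  by rewrite dot_mull Cs dotC.
by rewrite e4; field.
Qed.

End Quadratic.

(** * Minima of finitely many classical solutions *)

Section MinSolution.
Context {R : realType}.

Lemma is_derive_gt (g : R -> R) (d : R) : is_derive (0 : R) (1 : R) g d -> 0 < d ->
  \forall h \near (0 : R)^'+, g 0 < g h.
Proof.
move=> gd d0.
have hd : h^-1 *: ((g \o shift 0) (h *: 1) - g 0) @[h --> (0 : R)^'] --> d.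
  by have [e <-] := gd; exact: e.
have nd : \forall h \near (0 : R), h != 0 -> 0 < h^-1 *: ((g \o shift 0) (h *: 1) - g 0).
  have : \forall h \near (0 : R)^', 0 < h^-1 *: ((g \o shift 0) (h *: 1) - g 0).
    exact: (cvgr_gt d hd 0 d0).
  by [].
have nd' : \forall h \near (0 : R)^'+, h != 0 -> 0 < h^-1 *: ((g \o shift 0) (h *: 1) - g 0).
  exact: cvg_within nd.
near=> h; have h0 : 0 < h by [].
have : h != 0 -> 0 < h^-1 *: ((g \o shift 0) (h *: 1) - g 0) by near: h.
rewrite gt_eqF // => /(_ isT).
rewrite /= addr0 /GRing.scale /= mulr1 pmulr_rgt0 ?invr_gt0 //.
by rewrite subr_gt0.
Unshelve. all: by end_near. Qed.

Context {n : nat}.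

Lemma tfun_line T (f ft : R * 'cV[R]_n -> R) fx z k : tfun T f ft fx -> 0 < z.1 < T ->
  is_derive (0 : R) (1 : R) (fun h => f (z + h *: k)) (ft z * k.1 + dot (fx z) k.2).
Proof.
move=> hf zT; have [d _ _] := tfunP hf zT.
have ld : is_diff (0 : R) (fun h : R => z + h *: k) (fun h => h *: k).
  have c : is_diff (0 : R) (cst z) 0 by exact: is_diff_cst.
  have l : is_diff (0 : R) ( *:%R ^~ k) ( *:%R ^~ k) by exact: is_diff_scalel.
  apply: (is_diff_eq (is_diffD c l)).
  by apply/funext => h; rewrite /= !fctE add0r.
have z0 : z = z + 0 *: k by rewrite scale0r addr0.
rewrite z0 in d.
have := is_diff_comp ld d => -[d1 d2].
apply: DeriveDef; first exact: diff_derivable.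
rewrite deriveE //.
have := congr1 (fun f : R -> R => f 1) d2; rewrite /= -z0 /comp => ->.
by rewrite !scale1r.
Qed.

Lemma near_line (z k : R * 'cV[R]_n) (A : set (R * 'cV[R]_n)) : nbhs z A ->
  \forall h \near (0 : R)^'+, A (z + h *: k).
Proof.
move=> zA; apply: cvg_within.
have c : {for (0 : R), continuous (fun h : R => z + h *: k)}.
  by apply: cvgD; [exact: cvg_cst | apply: cvgZ; [exact: cvg_id | exact: cvg_cst]].
by apply: c; rewrite scale0r addr0.
Qed.

Lemma tfun_line_gt T (f ft : R * 'cV[R]_n -> R) fx z k : tfun T f ft fx -> 0 < z.1 < T ->
  0 < ft z * k.1 + dot (fx z) k.2 ->
  \forall h \near (0 : R)^'+, f z < f (z + h *: k).
Proof.
move=> hf zT d0; have := is_derive_gt (tfun_line k hf zT) d0.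
by rewrite scale0r addr0.
Qed.

Lemma tfun_locmin T (f ft : R * 'cV[R]_n -> R) fx z : tfun T f ft fx -> 0 < z.1 < T ->
  (\forall w \near z, f z <= f w) -> ft z = 0 /\ fx z = 0.
Proof.
move=> hf zT mn.
have ge0 k : 0 <= ft z * k.1 + dot (fx z) k.2.
  rewrite leNgt; apply/negP => lt0.
  have := @tfun_line_gt _ _ _ _ _ k (tfunN hf) zT.
  rewrite dotNl mulNr -opprD oppr_gt0 => /(_ lt0) g.
  have [h []] := filter_ex (filterI g (near_line k mn)).
  by rewrite ltrN2 ltNge => /negP.
have eq0 k : ft z * k.1 + dot (fx z) k.2 = 0.
  apply/eqP; rewrite eq_le ge0 andbT.
  by have := ge0 (- k); rewrite /= dotNr mulrN -opprD oppr_ge0.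
split; first by have := eq0 (1, 0); rewrite /= dot0r mulr1 addr0.
apply: dot_inj => h; rewrite dot0l.
by have := eq0 (0, h); rewrite /= mulr0 add0r.
Qed.

Variables (T : R) (m : nat) (cpp cxx cxp : R -> 'M[R]_n).
Variables (v vt : 'I_m -> R * 'cV[R]_n -> R) (vx : 'I_m -> R * 'cV[R]_n -> 'cV[R]_n).
Variable Z : R * 'cV[R]_n -> R.
Let H (z : R * 'cV[R]_n) p := hamiltonian cpp cxx cxp z.1 z.2 p.
Hypothesis vT : forall i, tfun T (v i) (vt i) (vx i).
Hypothesis Zle : forall i z, Z z <= v i z.
Hypothesis Zex : forall z, exists i, Z z = v i z.
Hypothesis vH : forall i z, 0 < z.1 < T -> vt i z = H z (vx i z).

Lemma min_vsuper : vsuper T H Z.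
Proof.
move=> phi pt px hp z zT mn.
have [i Zi] := Zex z.
have [|e1 e2] := tfun_locmin (tfunD (vT i) (tfunN hp)) zT.
  by apply: filterS mn => w; rewrite Zi => h; rewrite (le_trans h) // lerB.
have <- : vx i z = px z by apply/eqP; rewrite -subr_eq0 e2.
have <- : vt i z = pt z by apply/eqP; rewrite -subr_eq0 e1.
by rewrite vH // addrC subrr.
Qed.

Hypothesis cpp_psd : forall t, possemidef (cpp t).

Lemma min_vsub : vsub T H Z.
Proof.
move=> phi pt px hp z zT mx; rewrite leNgt; apply/negP => gt0.
(* The space component is minus the gradient of [H z] at [px z]. As [H] is quadratic in [p], the
   derivative of [v i - phi] along [k] is exactly [- pt z + H z (px z)] plus [1/2 d . Cpp d], where
   [d = vx i z - px z]. *)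
pose k : R * 'cV[R]_n := (1, cxp z.1 *m z.2 - cpp z.1 *m px z).
have gt i : \forall h \near (0 : R)^'+, v i z - phi z < v i (z + h *: k) - phi (z + h *: k).
  apply: (tfun_line_gt (tfunD (vT i) (tfunN hp)) zT).
  have [Cs C0] := cpp_psd z.1; have := C0 (vx i z - px z).
  move: gt0; rewrite /= mulr1 vH // /H /hamiltonian.
  rewrite !(mulmxBr, dotDl, dotDr, dotNl, dotNr).
  have -> : dot (px z) (cpp z.1 *m vx i z) = dot (vx i z) (cpp z.1 *m px z).
    by rewrite dot_mull Cs dotC.
  lra.
have g : \forall h \near (0 : R)^'+, forall i,
    v i z - phi z < v i (z + h *: k) - phi (z + h *: k).
  exact: filter_forall.
have [h [/= h1 h2]] := filter_ex (filterI g (near_line k mx)).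
have [i Zi] := Zex (z + h *: k).
move: h2; rewrite Zi leNgt => /negP; apply.
by apply: le_lt_trans (h1 i); rewrite lerB.
Qed.

End MinSolution.

(** * The eikonal equation with a time-dependent quadratic Hamiltonian *)

Section MaxPrinciple.
Context {R : realType} {n : nat}.

Lemma compact_cylinder (a b rho : R) :
  compact [set z : R * 'cV[R]_n | a <= z.1 <= b /\ `|z.2| <= rho].
Proof.
have [r0|r0] := ltP rho 0.
  rewrite (_ : mkset _ = set0); first exact: compact0.
  rewrite -subset0 => z [_ zr]; have := le_lt_trans zr r0.
  by rewrite ltNge normr_ge0.
have cb : compact [set x : 'cV[R]_n | `|x| <= rho].
  rewrite (_ : mkset _ = trmx @` [set v : 'rV[R]_n | forall i, `[- rho, rho]%classic (v ord0 i)]).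
    apply: continuous_compact; last by apply: (@rV_compact _ _ (fun=> `[- rho, rho]%classic)) => _; exact: segment_compact.
    have ct : continuous (trmx : 'rV[R]_n -> 'cV[R]_n).
      have h (x : 'rV[R]_n) : y^T @[y --> x] --> x^T by exact: (cvg_trmx (F := nbhs x) (f := fun y => y) cvg_id).
      exact: h.
    exact: continuous_subspaceT.
  apply/seteqP; split => [x /= xr|_ [v vr <-] /=].
    exists x^T; rewrite ?trmxK // => i /=; rewrite mxE in_itv /= -ler_norml.
    exact: le_trans (le_norm_mx _ _ _) xr.
  apply: norm_mx_le => // i j; rewrite ord1 mxE.
  by have := vr i; rewrite /= in_itv /= -ler_norml.
rewrite (_ : mkset _ = `[a, b]%classic `*` [set x : 'cV[R]_n | `|x| <= rho]).
  by apply: compact_setX => //; exact: segment_compact.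
by apply/seteqP; split => -[t x] /=; rewrite in_itv.
Qed.

Lemma cylinder_bound (f : R * 'cV[R]_n -> R) (a b rho : R) : continuous f ->
  exists B, 0 < B /\ forall z, a <= z.1 <= b -> `|z.2| <= rho -> `|f z| <= B.
Proof.
move=> cf.
have /compact_bounded [B [_ hB]] := continuous_compact
  (continuous_subspaceT cf) (@compact_cylinder a b rho).
exists (`|B| + 1); split=> [|z zab zr]; first by rewrite ltr_wpDl.
by apply: hB; [rewrite ltr_pwDr // ler_norm | exists z].
Qed.

(** Tailored to viscosity inequalities: [D] will be the difference of a solution and a test
    function, and an interior local maximum is excluded because the inequality would fail there.
    Only the three kinds of faces remain to be checked. *)
Lemma max_principle (D : R * 'cV[R]_n -> R) (a b rho c : R) : continuous D ->
  (forall z, a <= z.1 <= b -> `|z.2| <= rho ->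
     [\/ z.1 = a, z.1 = b | `|z.2| = rho] -> D z <= c) ->
  (forall z, a < z.1 < b -> `|z.2| < rho -> ~ (\forall w \near z, D w <= D z)) ->
  forall z, a <= z.1 <= b -> `|z.2| <= rho -> D z <= c.
Proof.
move=> cD bd noint z zab zr.
set K := [set z : R * 'cV[R]_n | a <= z.1 <= b /\ `|z.2| <= rho].
have [||x] := @compact_EVT_max _ _ D K _ (@compact_cylinder a b rho).
- by exists z.
- exact: continuous_subspaceT.
rewrite inE => -[xab xr] xmax.
have Kle w : a <= w.1 <= b -> `|w.2| <= rho -> D w <= D x.
  by move=> wab wr; apply: xmax; rewrite inE.
apply: le_trans (Kle z zab zr) _.
have [xa|xa] := eqVneq x.1 a; first by apply: bd => //; exact: Or31.
have [xb|xb] := eqVneq x.1 b; first by apply: bd => //; exact: Or32.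
have [xrho|xrho] := eqVneq `|x.2| rho; first by apply: bd => //; exact: Or33.
have xab' : a < x.1 < b by rewrite !lt_neqAle eq_sym xa xb /=.
have xr' : `|x.2| < rho by rewrite lt_neqAle xrho.
exfalso; apply: (noint x xab' xr').
have c1 : {for x, continuous (fst : R * 'cV[R]_n -> R)} by exact: cvg_fst.
have c2 : {for x, continuous (fun w : R * 'cV[R]_n => `|w.2|)}.
  by apply: cvg_norm; exact: cvg_snd.
have xi : x.1 \in `]a, b[ by rewrite in_itv.
have h1 : \forall w \near x, w.1 \in `]a, b[ by exact: (c1 _ (near_in_itvoo xi)).
have h2 : \forall w \near x, `|w.2| < rho by exact: (c2 _ (lt_nbhsl xr')).
near=> w; apply: Kle; last by apply: ltW; near: w.
have : w.1 \in `]a, b[ by near: w.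
by rewrite in_itv /= => /andP[/ltW -> /ltW ->].
Unshelve. all: by end_near. Qed.

Lemma continuous_vquad (P : R -> 'M[R]_n) q r :
  continuous P -> continuous q -> continuous r -> continuous (vquad P q r).
Proof.
move=> cP cq cr z.
have c2 : (snd : R * 'cV[R]_n -> 'cV[R]_n) w @[w --> z] --> z.2 by exact: cvg_snd.
have c1 (U : topologicalType) (f : R -> U) : continuous f ->
    (f \o (fst : R * 'cV[R]_n -> R)) w @[w --> z] --> f z.1.
    move=> cf; have c0 : (fst : R * 'cV[R]_n -> R) w @[w --> z] --> z.1 by exact: cvg_fst.
    exact: (cvg_comp _ _ c0 (cf _)).
apply: cvgD; last exact: c1 cr.
apply: cvgD; last by apply: cvg_dot c2; exact: c1 cq.
apply: cvgM; first exact: cvg_cst.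
by apply: cvg_dot => //; apply: cvg_mulmx c2; exact: c1 cP.
Qed.

End MaxPrinciple.

(** Serves two purposes: with [N] constant it differentiates the squared-distance penalties, with
    [N] a flow it carries test functions into and out of the moving frame. *)
Lemma tfun_affine_change (R : realType) (n k : nat) (T : R)
    (phi pt : R * 'cV[R]_k -> R) (px : R * 'cV[R]_k -> 'cV[R]_k)
    (N N' : R -> 'M[R]_(k, n)) (w w' : R -> 'cV[R]_k) :
  let G (z : R * 'cV[R]_n) := N z.1 *m z.2 + w z.1 in
  (forall t : R, 0 < t < T -> is_derive t (1 : R) N (N' t)) ->
  (forall t : R, 0 < t < T -> {for t, continuous N'}) ->
  (forall t : R, 0 < t < T -> is_derive t (1 : R) w (w' t)) ->
  (forall t : R, 0 < t < T -> {for t, continuous w'}) ->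
  tfun T phi pt px ->
  tfun T (fun z => phi (z.1, G z))
    (fun z => pt (z.1, G z) + dot (px (z.1, G z)) (N' z.1 *m z.2 + w' z.1))
    (fun z => (N z.1)^T *m px (z.1, G z)).
Proof.
move=> G dN cN dw cw hphi.
have tG i : tfun T (fun z => G z i ord0) (fun z => (N' z.1 *m z.2 + w' z.1) i ord0)
    (fun z => (N z.1)^T *m delta_mx i ord0).
  have tN j : tfun T (fun z : R * 'cV[R]_n => N z.1 i j) (fun z => N' z.1 i j) (fun=> 0).
    apply: (@tfun_time _ n T (fun t => N t i j) (fun t => N' t i j)) => t tT.
      exact: is_derive_coord (dN t tT).
    by have := cN t tT; exact: cvg_mx_coord.
  have tw : tfun T (fun z : R * 'cV[R]_n => w z.1 i ord0) (fun z => w' z.1 i ord0) (fun=> 0).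
    apply: (@tfun_time _ n T (fun t => w t i ord0) (fun t => w' t i ord0)) => t tT.
      exact: is_derive_coord (dw t tT).
    by have := cw t tT; exact: cvg_mx_coord.
  have tx := @tfun_coord _ n T.
  have tS := tfun_sum (index_enum 'I_n) (fun j => tfunM (tN j) (tx j)).
  apply: tfun_ext (tfunD tS tw) _ _ _ => z.
  - by rewrite /G !mxE.
  - rewrite !mxE; congr (_ + _); apply: eq_bigr => j _.
    by rewrite mulr0 add0r mulrC.
  - apply: dot_inj => h; rewrite addr0 dot_suml -dot_mull dot_deltal mxE.
    by apply: eq_bigr => j _; rewrite dotDl !dotZl dot0l mulr0 addr0 dot_deltal.
apply: tfun_ext (tfun_change hphi tG) _ _ _ => // z.
apply: dot_inj => h; rewrite dot_suml -dot_mull dotE; apply: eq_bigr => i _.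
by rewrite dotZl -dot_mull dot_deltal.
Qed.

Lemma tfun_normsq (R : realType) n (T : R) :
  tfun T (fun z : R * 'cV[R]_n => dot z.2 z.2) (fun=> 0) (fun z => 2 *: z.2).
Proof.
have h : tfun T (vquad (fun=> 2%:M) (fun=> 0) (fun=> 0)) (vquad (fun=> 0) (fun=> 0) (fun=> 0))
    (fun z : R * 'cV[R]_n => 2%:M *m z.2 + 0).
  by apply: tfun_vquad => t *; [exact: tr_scalar_mx | exact: cvg_cst..].
apply: tfun_ext h _ _ _ => z.
- by rewrite /vquad mul_scalar_mx dotZr dot0l !addr0 mulrA mulVf // mul1r.
- by rewrite /vquad mul0mx dot0r dot0l mulr0 !addr0.
- by rewrite mul_scalar_mx addr0.
Qed.

Section Penalties.
Context {R : realType} {n : nat}.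
Implicit Type T : R.

Lemma tfun_sqdist T k (N : 'M[R]_(k, n)) (w w' : R -> 'cV[R]_k) :
  (forall t : R, 0 < t < T -> is_derive t (1 : R) w (w' t)) ->
  (forall t : R, 0 < t < T -> {for t, continuous w'}) ->
  let G (z : R * 'cV[R]_n) := N *m z.2 + w z.1 in
  tfun T (fun z => dot (G z) (G z)) (fun z => 2 * dot (G z) (w' z.1))
         (fun z => 2 *: (N^T *m G z)).
Proof.
move=> dw cw G.
have h : tfun T (fun z => dot (G z) (G z))
    (fun z => 0 + dot (2 *: G z) (0 *m z.2 + w' z.1)) (fun z => N^T *m (2 *: G z)).
  have dN (t : R) : 0 < t < T -> is_derive t (1 : R) (fun=> N) (0 : 'M[R]_(k, n)).
    by move=> _; exact: is_derive_cst.
  have cN (t : R) : 0 < t < T -> {for t, continuous (fun=> (0 : 'M[R]_(k, n)))}.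
    by move=> _; exact: cvg_cst.
  exact: (tfun_affine_change dN cN dw cw (tfun_normsq k T)).
apply: tfun_ext h _ _ _ => z //=.
- by rewrite mul0mx !add0r dotZl.
- by rewrite -scalemxAr.
Qed.

Lemma tfun_expR T e L t0 :
  tfun T (fun z : R * 'cV[R]_n => e * expR (L * (t0 - z.1)))
         (fun z => - (e * L * expR (L * (t0 - z.1)))) (fun=> 0).
Proof.
have dlin t : is_derive t (1 : R) (fun s : R => L * (t0 - s)) (- L).
  have h : is_derive t (1 : R) (fun s : R => t0 - s) (0 - 1).
    have d1 : is_derive t (1 : R) (cst t0) 0 by exact: is_derive_cst.
    have d2 : is_derive t (1 : R) (fun s : R => s) 1 by exact: is_derive_id.
    exact: is_deriveB d1 d2.
  apply: (@is_derive_eq _ _ _ _ _ _ _ _ (is_deriveZ L h)).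
  by rewrite /GRing.scale /= sub0r mulrN1.
have clin : continuous (fun s : R => L * (t0 - s)).
  move=> t; apply: cvgM; first exact: cvg_cst.
  by apply: cvgB; [exact: cvg_cst | exact: cvg_id].
have h : tfun T (fun z : R * 'cV[R]_n => L * (t0 - z.1)) (fun=> - L) (fun=> 0).
  apply: (@tfun_time _ n T (fun s => L * (t0 - s)) (fun=> - L)) => t _; exact: cvg_cst.
have h2 := tfun_comp h (fun z => is_derive_expR _) (fun z => @continuous_expR R _).
apply: tfun_ext (tfunZ e h2) _ _ _ => z //=.
- by ring.
- by rewrite !scaler0.
Qed.

End Penalties.

(** * The Hopf-Lax inequality for subsolutions *)

Section SubCurve.
Context {R : realType} {n : nat}.

Definition eikonal (C : R -> 'M[R]_n) (z : R * 'cV[R]_n) (p : 'cV[R]_n) : R :=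
  2^-1 * dot p (C z.1 *m p).

Variables (T : R) (C M : R -> 'M[R]_n) (Z : R * 'cV[R]_n -> R).
Hypothesis cC : continuous C.
Hypothesis C_psd : forall t, possemidef (C t).
Hypothesis cM : continuous M.
Hypothesis dM : forall t : R, 0 < t < T -> is_derive t (1 : R) M (C t).
Hypothesis cZ : continuous Z.
Hypothesis subZ : vsub T (eikonal C) Z.

(* The test function penalises the distance to the curve
   [t |-> xi + (M t - M t1) p], whose velocity is minus [C] times the gradient
   of the affine solution [- p . y + 1/2 p . M p]. *)
Lemma sub_curve (t1 s : R) (xi p : 'cV[R]_n) : 0 < t1 -> t1 < s -> s <= T ->
  Z (t1, xi) <= Z (s, xi + (M s - M t1) *m p) + 2^-1 * dot p ((M s - M t1) *m p).
Proof.
move=> t10 t1s sT; apply/ler_addgt0Pr => e2 e20.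
(* Half of the slack pays for the time penalty, which equals [e] at [t1]; the other half for the
   variation of [Z - base] near the end point [ys]. *)
pose e := e2 / 2; have e0 : 0 < e by rewrite divr_gt0.
pose tau := t1 / 2; have tau0 : 0 < tau by rewrite divr_gt0.
have taut1 : tau < t1 by rewrite /tau; lra.
pose w t := - (xi + (M t - M t1) *m p).
pose w' t := - (C t *m p).
pose r t := 2^-1 * dot p (M t *m p).
pose base := vquad (fun=> 0) (fun=> - p) r.
pose G (z : R * 'cV[R]_n) := 1%:M *m z.2 + w z.1.
have cw : continuous w.
  move=> t; apply: cvgN; apply: cvgD; first exact: cvg_cst.
  by apply: cvg_mulmx; [apply: cvgB; [exact: cM | exact: cvg_cst] | exact: cvg_cst].
have cr : continuous r.
  move=> t; apply: cvgM; first exact: cvg_cst.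
  apply: cvg_dot; first exact: cvg_cst.
  by apply: cvg_mulmx; [exact: cM | exact: cvg_cst].
have cbase : continuous base.
  by apply: continuous_vquad; [move=> t; exact: cvg_cst | move=> t; exact: cvg_cst | exact: cr].
have cCp : continuous (fun t => C t *m p).
  by move=> t; apply: cvg_mulmx; [exact: cC | exact: cvg_cst].
have dMp (t : R) : 0 < t < T -> is_derive t (1 : R) (fun s => M s *m p) (C t *m p).
  move=> tT; have d := is_derive_mulmx (dM tT) (is_derive_cst p t 1).
  by apply: (@is_derive_eq _ _ _ _ _ _ _ _ d); rewrite mulmx0 addr0.
have dw (t : R) : 0 < t < T -> is_derive t (1 : R) w (w' t).
  move=> tT.
  have d1 : is_derive t (1 : R) (cst (xi - M t1 *m p)) 0 by exact: is_derive_cst.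
  have d2 := is_deriveN (is_deriveD d1 (dMp t tT)).
  rewrite (_ : w = - (cst (xi - M t1 *m p) + (fun s => M s *m p))).
    by apply: (@is_derive_eq _ _ _ _ _ _ _ _ d2); rewrite add0r.
  by apply/funext => u; rewrite /w /= !fctE mulmxBl; congr (- _); rewrite addrAC addrA.
have dr (t : R) : 0 < t < T -> is_derive t (1 : R) r (2^-1 * dot p (C t *m p)).
  move=> tT; have d := is_derive_mulmx (is_derive_cst p^T t 1) (dMp t tT).
  have d1 := is_deriveZ 2^-1 (is_derive_coord ord0 ord0 d).
  by apply: (@is_derive_eq _ _ _ _ _ _ _ _ d1); rewrite mul0mx add0r.
have tbase : tfun T base (vquad (fun=> 0) (fun=> 0) (fun t => 2^-1 * dot p (C t *m p)))
    (fun z => 0 *m z.2 + - p).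
  apply: tfun_vquad => t *; [exact: trmx0 | exact: cvg_cst | exact: cvg_cst |].
  apply: cvgM; first exact: cvg_cst.
  by apply: cvg_dot; [exact: cvg_cst | exact: cCp].
have cw' t : {for t, continuous w'} by apply: cvgN; exact: cCp.
have tdist := tfun_sqdist 1%:M dw (fun t _ => cw' t).
have cG : continuous G.
  move=> z; have c0 : (fst : R * 'cV[R]_n -> R) u @[u --> z] --> z.1 by exact: cvg_fst.
  apply: cvgD; last exact: (cvg_comp _ _ c0 (cw _)).
  by apply: cvg_mulmx; [exact: cvg_cst | exact: cvg_snd].
pose ys := xi + (M s - M t1) *m p.
pose c := Z (s, ys) - base (s, ys) + e.
have [d d0 hd] : exists2 d, 0 < d & forall y, `|y - ys| < d -> Z (s, y) - base (s, y) <= c.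
  have cb : {for (s, ys), continuous (fun z => Z z - base z)}.
    by apply: cvgB; [exact: cZ | exact: cbase].
  have cs : {for ys, continuous (fun y => Z (s, y) - base (s, y))}.
    exact: (continuous_comp (continuous_pairr (x := s) (x0 := ys)) cb).
  have : \forall y \near ys, Z (s, y) - base (s, y) < c.
    have lt : Z (s, ys) - base (s, ys) < c by rewrite /c ltrDl.
    exact: (cs _ (lt_nbhsl lt)).
  move=> /nbhs_ballP [d /= d0 hd]; exists d => // y yd; apply: ltW; apply: hd.
  by rewrite -ball_normE /= distrC.
have [B1 [B10 hB1]] := cylinder_bound tau s 0 (fun z => cvg_norm (cG z)).
(* The curve stays in the ball of radius [B1], so on the lateral face the distance to it is at least
   1. *)
pose rho := B1 + 1.
have wB t : tau <= t <= s -> `|w t| <= B1.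
  move=> ts; have := hB1 (t, 0) ts; rewrite normr0 => /(_ (lexx _)).
  by rewrite /G /= mulmx0 add0r normr_id.
have cD0 : continuous (fun z => Z z - base z - c).
  by move=> z; apply: cvgB; [apply: cvgB; [exact: cZ | exact: cbase] | exact: cvg_cst].
have [B [B0 hB]] := cylinder_bound tau s rho cD0.
(* The penalty has to reach [B] in two places: at time [s] outside the ball of radius [d] around
   [ys], by the first summand, and at distance 1 on the lateral face, by the second. *)
pose Lam := B / d ^+ 2 + B.
have Lam0 : 0 < Lam by rewrite addr_gt0 // divr_gt0 // exprn_gt0.
(* With [1 + x <= expR x], this makes [chi] at least [e + B] on the initial face. *)
pose L := B / (e * (t1 - tau)).
have L0 : 0 < L by rewrite divr_gt0 // mulr_gt0 // subr_gt0.
pose chi (z : R * 'cV[R]_n) := e * expR (L * (t1 - z.1)).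
have chi0 z : 0 < chi z by rewrite mulr_gt0 ?expR_gt0.
pose phi z := base z + Lam * dot (G z) (G z) + chi z.
have tphi := tfunD (tfunD tbase (tfunZ Lam tdist)) (tfun_expR (n := n) T e L t1).
have cchi : continuous chi.
  move=> z; apply: cvgM; first exact: cvg_cst.
  have c0 : (fst : R * 'cV[R]_n -> R) u @[u --> z] --> z.1 by exact: cvg_fst.
  have c1 : (fun u : R * 'cV[R]_n => L * (t1 - u.1)) u @[u --> z] --> L * (t1 - z.1).
    by apply: cvgM; [exact: cvg_cst | apply: cvgB => //; exact: cvg_cst].
  exact: (cvg_comp _ _ c1 (@continuous_expR R _)).
have cD : continuous (fun z => Z z - phi z).
  move=> z; apply: cvgB; first exact: cZ.
  apply: cvgD; last exact: cchi.
  apply: cvgD; first exact: cbase.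
  by apply: cvgM; [exact: cvg_cst | apply: cvg_dot; exact: cG].
have LB x : 1 <= x -> B <= Lam * x.
  move=> x1; apply: (@le_trans _ _ Lam); last by rewrite ler_peMr // ltW.
  by rewrite /Lam lerDr divr_ge0 ?sqr_ge0 // ltW.
have Lge0 z : 0 <= Lam * dot (G z) (G z) by rewrite mulr_ge0 ?dot_sqr_ge0 // ltW.
have wt1 : w t1 = - xi by rewrite /w subrr mul0mx addr0.
have Gt1 : G (t1, xi) = 0 by rewrite /G /= wt1 mul1mx subrr.
have E1 : Z (t1, xi) - phi (t1, xi) = Z (t1, xi) - base (t1, xi) - e.
  by rewrite /phi /chi Gt1 /= subrr dot0l !mulr0 expR0 mulr1 addr0 opprD addrA.
have xiB : `|xi| <= rho.
  have : `|w t1| <= B1 by apply: wB; rewrite !ltW.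
  by rewrite wt1 normrN /rho; lra.
have bdiff : base (t1, xi) - base (s, ys) = 2^-1 * dot p ((M s - M t1) *m p).
  rewrite /base /vquad /= !mul0mx !dot0r !mulr0 !add0r /ys dotDr !dotNl mulmxBl dotDr dotNr.
  by rewrite /r; field.
have concl : Z (t1, xi) - base (t1, xi) - e <= c ->
    Z (t1, xi) <= Z (s, ys) + 2^-1 * dot p ((M s - M t1) *m p) + e2.
  by rewrite -bdiff /c (_ : e2 = e + e) /e; lra.
apply: concl; rewrite -E1.
apply: (@max_principle _ _ (fun z => Z z - phi z) tau s rho c cD) => //=; last by rewrite !ltW.
- move=> z zts zr; have Dle : Z z - base z - c <= B.
    by apply: le_trans (hB z zts zr); exact: ler_norm.
  rewrite /phi; have := chi0 z; have := Lge0 z.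
  move=> l1 l2 [zt|zs|zrho].
  + have : B <= chi z.
      rewrite /chi zt (le_trans (y := e * (1 + L * (t1 - tau))))//; last first.
        by rewrite ler_wpM2l ?expR_ge1Dx // ltW.
      rewrite (_ : e * _ = e + B); first by rewrite lerDr ltW.
      by rewrite /L; field; rewrite subr_eq0 !gt_eqF.
    lra.
  + have Gz : G z = z.2 - ys by rewrite /G zs mul1mx.
    have [lt|ge] := ltP `|z.2 - ys| d.
      have := hd _ lt; rewrite -zs -surjective_pairing; lra.
    have : B <= Lam * dot (G z) (G z).
      have h2 := norm_sqr_dot (G z).
      apply: (@le_trans _ _ (Lam * d ^+ 2)).
        rewrite /Lam mulrDl divfK ?gt_eqF ?exprn_gt0 // lerDl.
        by rewrite mulr_ge0 ?sqr_ge0 // ltW.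
      rewrite ler_wpM2l ?(ltW Lam0) // (le_trans _ h2) // Gz.
      by rewrite ler_pXn2r // nnegrE // ltW.
    lra.
  + have : B <= Lam * dot (G z) (G z).
      apply: LB; apply: le_trans (norm_sqr_dot _).
      rewrite expr_ge1 //.
      have := lerB_normD z.2 (w z.1); have := wB _ zts.
      by rewrite /G mul1mx zrho /rho; lra.
    lra.
- move=> z /andP[zt zs] zr mx.
  have zT : 0 < z.1 < T by rewrite (lt_trans tau0 zt) (lt_le_trans zs sT).
  have := subZ tphi zT mx; rewrite leNgt => /negP; apply.
  (* The motion of the curve cancels the cross terms between [p] and [g]. What is left is
     [2 Lam^2 g . C g] plus the positive contribution of [chi]. *)
  rewrite /eikonal /vquad !mul0mx dot0r dot0l mulr0 !add0r addr0 trmx1 !mul1mx; set g := z.2 + w z.1; move: g => g.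
  rewrite /w' scalerA mulmxDr mulmxN -scalemxAr !(dotDl, dotDr, dotNl, dotNr) !dotZl !dotZr.
  rewrite ?(dotNl, dotNr).
  have [Cs C0] := C_psd z.1.
  have -> : dot p (C z.1 *m g) = dot g (C z.1 *m p) by rewrite dot_mull Cs dotC.
  have : 0 <= Lam ^+ 2 * dot g (C z.1 *m g) by rewrite mulr_ge0 ?sqr_ge0.
  have : 0 < e * L * expR (L * (t1 - z.1)) by exact: mulr_gt0 (mulr_gt0 e0 L0) (expR_gt0 _).
  move: (dot g (C z.1 *m p)) (dot g (C z.1 *m g)) (dot p (C z.1 *m p)).
  by move=> x y u; lra.
Qed.

End SubCurve.

(** * Smooth minima of classical subsolutions *)

Section SoftMin.
Context {R : realType} {n : nat}.
Variables (T s1 s2 : R) (C : R -> 'M[R]_n).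
Hypothesis C_psd : forall t, possemidef (C t).

(** The inequality is required on []s1, s2[] only, while the derivatives live on []0, T[]: the
    paraboloid used in the comparison is a subsolution only for a short time. *)
Definition classical_sub (f : R * 'cV[R]_n -> R) : Prop := continuous f /\
  exists ft fx, tfun T f ft fx /\
    forall z, s1 < z.1 < s2 -> - ft z + eikonal C z (fx z) <= 0.

Lemma eikonal_convex z (x y : 'cV[R]_n) (a b : R) : 0 <= a -> 0 <= b -> a + b = 1 ->
  eikonal C z (a *: x + b *: y) <= a * eikonal C z x + b * eikonal C z y.
Proof.
move=> a0 b0 ab; have [Cs C0] := C_psd z.1; rewrite /eikonal.
have := C0 (x - y); rewrite mulmxBr mulmxDr -!scalemxAr !(dotDl, dotDr, dotNl, dotNr, dotZl, dotZr).
have -> : dot y (C z.1 *m x) = dot x (C z.1 *m y) by rewrite dot_mull Cs dotC.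
have -> : b = 1 - a by rewrite -ab addrC addKr.
have ab0 : 0 <= a * (1 - a) by rewrite mulr_ge0 // -ab addrAC subrr add0r.
move: (dot x _) (dot x _) (dot y _) => u v w uvw.
have := mulr_ge0 ab0 uvw; nra.
Qed.

(** A minimum is not a test function, so it is replaced by [- e ln (exp (- f / e) + exp (- g / e))].
    The derivatives of this function are convex combinations, with the same weights in time and
    space, of those of [f] and [g]; convexity of the Hamiltonian then preserves subsolutions. The
    value falls short of a common lower bound by at most [e ln 2 <= e]. *)
Lemma softmin2 (f g : R * 'cV[R]_n -> R) (e : R) : 0 < e ->
  classical_sub f -> classical_sub g ->
  exists h, [/\ classical_sub h, forall z, h z <= f z, forall z, h z <= g z
    & forall z c, c <= f z -> c <= g z -> c - e <= h z].
Proof.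
move=> e0 [cf [ft [fx [tf sf]]]] [cg [gt [gx [tg sg]]]].
have e1 : e != 0 by rewrite gt_eqF.
pose E (k : R * 'cV[R]_n -> R) z : R := expR (- e^-1 * k z).
pose S z := E f z + E g z.
have E0 k z : 0 < E k z by exact: expR_gt0.
have S0 z : 0 < S z by rewrite addr_gt0.
pose h z := - e * ln (S z).
have lnE k z : k z = - e * ln (E k z).
  by rewrite /E expRK mulNr mulNr mulrN opprK mulrA divff // mul1r.
have ln2 : ln 2 <= 1 :> R.
  rewrite -[leRHS]expRK ler_ln ?posrE ?expR_gt0 //.
  by have := expR_ge1Dx (1 : R).
have tE k kt kx : tfun T k kt kx ->
    tfun T (E k) (fun z => E k z * (- e^-1 * kt z)) (fun z => E k z *: (- e^-1 *: kx z)).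
  move=> tk; apply: (tfun_comp (tfunZ (- e^-1) tk)) => z.
  exact: continuous_expR.
have tS := tfunD (tE _ _ _ tf) (tE _ _ _ tg).
have tln := tfun_comp tS (fun z => is_derive1_ln (S0 z)) (fun z => inv_continuous (lt0r_neq0 (S0 z))).
pose a z := E f z / S z; pose b z := E g z / S z.
have ab z : a z + b z = 1 by rewrite /a /b -mulrDl -/(S z) divff // gt_eqF.
have a0 z : 0 <= a z by rewrite divr_ge0 // ltW.
have b0 z : 0 <= b z by rewrite divr_ge0 // ltW.
have th : tfun T h (fun z => a z * ft z + b z * gt z) (fun z => a z *: fx z + b z *: gx z).
  apply: tfun_ext (tfunZ (- e) tln) _ _ _ => z //.
  - have := lt0r_neq0 (S0 z); rewrite /= -/(S z) /a /b; move: (S z) => u u0.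
    by field; rewrite e1 u0.
  - have := lt0r_neq0 (S0 z); rewrite /= -/(S z) /a /b; move: (S z) => u u0.
    by rewrite !scalerDr !scalerA; congr (_ *: _ + _ *: _); field; rewrite e1 u0.
have hle k z : E k z <= S z -> h z <= k z.
  by move=> kS; rewrite (lnE k z) /h ler_nM2l ?oppr_lt0 // ler_ln ?posrE.
have cE k : continuous k -> continuous (E k).
  move=> ck z; have c1 : (- e^-1 * k u) @[u --> z] --> - e^-1 * k z.
    by apply: cvgM; [exact: cvg_cst | exact: ck].
  exact: (cvg_comp _ _ c1 (@continuous_expR R _)).
exists h; split.
- split.
    move=> z; apply: cvgM; first exact: cvg_cst.
    have c1 : S u @[u --> z] --> S z by apply: cvgD; exact: cE.
    exact: (cvg_comp _ _ c1 (continuous_ln (S0 z))).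
  exists (fun z => a z * ft z + b z * gt z), (fun z => a z *: fx z + b z *: gx z).
  split=> // z zs; have := eikonal_convex z (fx z) (gx z) (a0 z) (b0 z) (ab z).
  have := ler_wpM2l (a0 z) (sf z zs); have := ler_wpM2l (b0 z) (sg z zs).
  by rewrite !mulr0; lra.
- by move=> z; apply: hle; rewrite /S lerDl ltW.
- by move=> z; apply: hle; rewrite /S lerDr ltW.
- move=> z c cfz cgz.
  have key k : c <= k z -> E k z <= expR (- e^-1 * c).
    by move=> ck; rewrite /E ler_expR ler_nM2l // oppr_lt0 invr_gt0.
  have S2 : S z <= 2 * expR (- e^-1 * c).
    by have := key _ cfz; have := key _ cgz; rewrite /S; lra.
  have : ln (S z) <= ln 2 + (- e^-1 * c).
    rewrite -[X in _ + X]expRK -lnM ?posrE ?expR_gt0 // ler_ln ?posrE //.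
    by rewrite mulr_gt0 ?expR_gt0.
  rewrite /h => lS.
  have : e * ln (S z) <= e * (1 - e^-1 * c).
    by rewrite ler_wpM2l ?(ltW e0) // (le_trans lS) // -mulNr lerD2r.
  by rewrite mulrBr mulr1 mulrA divff // mul1r; lra.
Qed.

Lemma softmin (I : eqType) (r : seq I) (f : I -> R * 'cV[R]_n -> R) f0 (e : R) : 0 < e ->
  classical_sub f0 -> (forall i, classical_sub (f i)) ->
  exists h, [/\ classical_sub h, forall z, h z <= f0 z,
      forall z i, i \in r -> h z <= f i z
    & forall z c, c <= f0 z -> (forall i, c <= f i z) -> c - e <= h z].
Proof.
move=> e0 g0 gf; elim: r e e0 => [|i r IH] e e0.
  by exists f0; split=> // z c cf _; lra.
have e2 : 0 < e / 2 by rewrite divr_gt0.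
have [h [gh h0 hi hc]] := IH _ e2.
have [k [gk kh ki kc]] := softmin2 e2 gh (gf i).
exists k; split=> //.
- by move=> z; exact: le_trans (kh z) (h0 z).
- move=> z j; rewrite inE => /orP[/eqP -> //|jr].
  exact: le_trans (kh z) (hi z j jr).
- move=> z c c0 ci; rewrite [e]splitr opprD addrA.
  by apply: kc; [exact: hc | apply: le_trans (ci i); lra].
Qed.

End SoftMin.

Lemma is_derive_ndecr (R : realType) (f f' : R -> R) (a b : R) : a <= b ->
  continuous f -> (forall t : R, a < t < b -> is_derive t (1 : R) f (f' t)) ->
  (forall t, a < t < b -> 0 <= f' t) -> f a <= f b.
Proof.
move=> ab cf df f0.
apply: (@ger0_derive1_le_cc R f a b) => //.
- by move=> t; rewrite in_itv /= => tab; have d := df t tab; exact: ex_derive.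
- move=> t; rewrite in_itv /= => tab; have d := df t tab.
  by rewrite derive1E derive_val f0.
- exact: continuous_subspaceT.
- by rewrite in_itv /= lexx ab.
- by rewrite in_itv /= lexx ab.
Qed.

(** * Directions reached by the controls *)

Section Controllability.
Context {R : realType} {n : nat}.
Variables (T : R) (C M : R -> 'M[R]_n).
Hypothesis C_psd : forall t, possemidef (C t).
Hypothesis cM : continuous M.
Hypothesis Ms : forall t, (M t)^T = M t.
Hypothesis dM : forall t : R, 0 < t < T -> is_derive t (1 : R) M (C t).

Let quad (w : 'cV[R]_n) t := dot w (M t *m w).

Lemma is_derive_quad w (t : R) : 0 < t < T ->
  is_derive t (1 : R) (quad w) (dot w (C t *m w)).
Proof.
move=> tT; have d1 := is_derive_mulmx (dM tT) (is_derive_cst w t 1).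
have d := is_derive_coord ord0 ord0 (is_derive_mulmx (is_derive_cst w^T t 1) d1).
by apply: (@is_derive_eq _ _ _ _ _ _ _ _ d); rewrite mul0mx mulmx0 add0r addr0.
Qed.

Lemma quad_ndecr w s t : 0 <= s -> s <= t -> t <= T -> quad w s <= quad w t.
Proof.
move=> s0 st tT; apply: (@is_derive_ndecr _ _ (fun t => dot w (C t *m w))) => //.
- move=> u; apply: cvg_dot; first exact: cvg_cst.
  by apply: cvg_mulmx; [exact: cM | exact: cvg_cst].
- move=> u /andP[su ut]; apply: is_derive_quad.
  by rewrite (le_lt_trans s0 su) (lt_le_trans ut tT).
- by move=> u _; exact: (C_psd u).2.
Qed.

Lemma psd_increment s t : 0 <= s -> s <= t -> t <= T -> possemidef (M t - M s).
Proof.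
move=> s0 st tT; split; first by rewrite linearB /= !Ms.
by move=> x; rewrite mulmxBl dotDr dotNr subr_ge0; exact: quad_ndecr.
Qed.

(** The function [t |-> w . M(t) w] is nondecreasing with derivative [w . C(t) w]. Equal values at
    [a] and [b] make it constant in between, so [w] is isotropic for the two semidefinite matrices
    and hence lies in their kernels. *)
Lemma increment_kernel w a b s : 0 <= a -> a < s -> s < b -> b <= T ->
  dot w ((M b - M a) *m w) = 0 -> C s *m w = 0 /\ (M b - M s) *m w = 0.
Proof.
move=> a0 as_ sb bT; rewrite mulmxBl dotDr dotNr => /eqP; rewrite subr_eq0 => /eqP qab.
have cst t : a <= t <= b -> quad w t = quad w b.
  move=> /andP[at_ tb]; apply/eqP; rewrite eq_le quad_ndecr // ?(le_trans a0) //=.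
  by rewrite {1}/quad qab; apply: quad_ndecr => //; exact: le_trans tb bT.
split; apply: psd_isotropic => //.
- have sT : 0 < s < T by rewrite (le_lt_trans a0) //= (lt_le_trans sb).
  have sab : s \in `]a, b[ by rewrite in_itv /= as_ sb.
  have d1 := is_derive_quad w sT.
  have d2 : is_derive s (1 : R) (quad w) 0.
    apply: near_eq_is_derive (is_derive_cst (quad w b) s 1).
    apply: filterS (near_in_itvoo sab) => t; rewrite in_itv /= => /andP[/ltW at_ /ltW tb].
    by rewrite cst // at_ tb.
  by rewrite -(derive_val (is_derive := d1)) (derive_val (is_derive := d2)).
- by apply: psd_increment => //; [exact: le_trans (ltW as_) | exact: ltW].
- rewrite mulmxBl dotDr dotNr -/(quad w b) -/(quad w s) cst ?subrr //.
  by rewrite !ltW.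
Qed.

Variable Z : R * 'cV[R]_n -> R.
Hypothesis curveZ : forall (t1 s : R) (xi p : 'cV[R]_n), 0 < t1 -> t1 < s -> s <= T ->
  Z (t1, xi) <= Z (s, xi + (M s - M t1) *m p) + 2^-1 * dot p ((M s - M t1) *m p).

(* [N] is a projection along the range of [M ts - M t1], which contains the
   range of [C s]: the bound keeps [Z] itself in the directions of the image of [N],
   which the controls do not reach, and is quadratic in the others. *)
Lemma quadratic_lower_bound (t1 ts : R) : 0 < t1 -> t1 < ts -> ts <= T ->
  exists (N : 'M[R]_n) (K sa : R), [/\ 0 <= K, t1 < sa < ts,
    forall s, sa < s < ts -> C s *m N^T = 0
    & forall s y, sa < s <= ts -> Z (t1, N *m y) - K * dot y y <= Z (s, y)].
Proof.
move=> t10 t1s tsT.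
(* Since [Mt Mi Mt = Mt], [Pi] is a projection onto the column space of [Mt]. As [Mt] is symmetric,
   the image of [N^T] lies in its kernel, hence in the kernels of all [C s] and [D s] with
   [t1 < s < ts]. *)
pose Mt := M ts - M t1; pose Mi := pinvmx Mt; pose Pi := Mt *m Mi; pose N := 1%:M - Pi.
pose D s := M ts - M s.
have PiMt : Pi *m Mt = Mt by exact: mulmxKpV.
have MtT : Mt^T = Mt by rewrite linearB /= !Ms.
have MN : Mt *m N^T = 0.
  by apply: trmx_inj; rewrite trmx_mul trmxK MtT mulmxBl mul1mx PiMt subrr trmx0.
have ker (s : R) (v : 'cV[R]_n) : t1 < s -> s < ts -> C s *m (N^T *m v) = 0 /\ D s *m (N^T *m v) = 0.
  move=> s1 s2; apply: (@increment_kernel _ t1 ts s) => //; first exact: ltW.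
  by rewrite -/Mt dot_mull MtT mulmxA MN mul0mx dot0l.
have mx0 (A : 'M[R]_n) : (forall v : 'cV[R]_n, A *m v = 0) -> A = 0.
  move=> Av; apply/matrixP => i j; have := Av (delta_mx j ord0).
  by rewrite -colE => /colP /(_ i); rewrite !mxE.
have CN s : t1 < s -> s < ts -> C s *m N^T = 0.
  by move=> s1 s2; apply: mx0 => v; rewrite -mulmxA; have [] := ker s v s1 s2.
have DN s : t1 < s -> s <= ts -> Pi *m D s = D s.
  move=> s1; rewrite le_eqVlt => /predU1P[->|s2]; first by rewrite /D subrr mulmx0.
  have DT : (D s)^T = D s by rewrite linearB /= !Ms.
  have DN0 : D s *m N^T = 0.
    by apply: mx0 => v; rewrite -mulmxA; have [] := ker s v s1 s2.
  have : N *m D s = 0 by apply: trmx_inj; rewrite trmx_mul DT DN0 trmx0.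
  by rewrite mulmxBl mul1mx => /eqP; rewrite subr_eq0 => /eqP.
(* From [D s = Mt Mi D s] follows [M s - M t1 = Mt (1 - Mi D s)]. Close to [ts] the last factor is
   invertible, so the increment up to [s] already reaches every direction that the increment up to
   [ts] reaches. *)
have [sa [sats saD]] : exists sa, t1 < sa < ts /\
    forall s, sa < s <= ts -> n%:R * `|Mi *m D s| <= 2^-1.
  have cD : (fun s => n%:R * `|Mi *m D s|) s @[s --> ts] --> n%:R * `|Mi *m D ts|.
    apply: cvgM; first exact: cvg_cst.
    apply: cvg_norm; apply: cvg_mulmx; first exact: cvg_cst.
    by apply: cvgB; [exact: cvg_cst | exact: cM].
  have lt : n%:R * `|Mi *m D ts| < 2^-1 by rewrite /D subrr mulmx0 normr0 mulr0 invr_gt0.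
  have : \forall s \near ts, n%:R * `|Mi *m D s| < 2^-1 by exact: (cD _ (lt_nbhsl lt)).
  move=> /nbhs_ballP [d /= d0 hd].
  exists (Num.max ((t1 + ts) / 2) (ts - d / 2)); split.
    by rewrite lt_max gt_max; apply/andP; split; [apply/orP; left; lra | apply/andP; split; lra].
  move=> s /andP[]; rewrite gt_max => /andP[_ sd] st; apply: ltW; apply: hd.
  by rewrite -ball_normE /= ger0_norm; lra.
exists N, (n%:R * n%:R * n%:R * `|Mi| * `|Pi|), sa.
have /andP[sa1 sa2] := sats.
split=> //.
  by move=> s /andP[s1 s2]; apply: CN => //; exact: lt_trans s1.
move=> s y /andP[s1 s2].
have ts1 : t1 < s by exact: lt_trans s1.
pose A := 1%:M - Mi *m D s.
have half k (X : 'M[R]_(n, k)) : `|Mi *m D s *m X| <= 2^-1 * `|X|.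
  apply: le_trans (norm_mulmx _ _) _; apply: ler_wpM2r => //.
  by apply: saD; rewrite s1.
have Au : A \in unitmx.
  rewrite -unitmx_tr -row_free_unit -kermx_eq0 -trmx_eq0.
  set X := _^T; have AX : A *m X = 0.
    by apply: trmx_inj; rewrite trmx_mul trmxK mulmx_ker trmx0.
  have XE : X = Mi *m D s *m X.
    by apply/eqP; rewrite -subr_eq0 -{1}[X]mul1mx -mulmxBl AX.
  have := half _ X; rewrite -XE -normr_eq0; have := normr_ge0 X; lra.
(* With this slope the Hopf-Lax curve leads from [N y] to [y], and [p] is bounded by a multiple of
   [y] that does not depend on [s]; the cost of the curve is therefore quadratic in [y]. *)
pose p := invmx A *m (Mi *m y).
have Ap : A *m p = Mi *m y by rewrite mulmxA mulmxV // mul1mx.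
have pE : p = Mi *m y + Mi *m D s *m p.
  by rewrite -Ap /A mulmxBl mul1mx subrK.
have pn : `|p| <= 2 * (n%:R * `|Mi| * `|y|).
  have := ler_normD (Mi *m y) (Mi *m D s *m p); rewrite -pE.
  have := half _ p; have := norm_mulmx Mi y; lra.
have Mp : (M s - M t1) *m p = Pi *m y.
  have -> : M s - M t1 = Mt - D s by rewrite /Mt /D opprB [RHS]addrC subrKA.
  have e1 : D s *m p = Mt *m (Mi *m D s *m p) by rewrite -{1}(DN s ts1 s2) /Pi !mulmxA.
  have e2 : Pi *m y = Mt *m (Mi *m y) by rewrite /Pi -(mulmxA Mt Mi y).
  have e3 : p - Mi *m D s *m p = Mi *m y by apply/eqP; rewrite subr_eq -pE eqxx.
  by rewrite mulmxBl e1 e2 -mulmxBr e3.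
have := curveZ (N *m y) p t10 ts1 (le_trans s2 tsT).
rewrite Mp; have -> : N *m y + Pi *m y = y by rewrite -mulmxDl subrK mul1mx.
move=> h; rewrite lerBlDr (le_trans h) // lerD2l.
have h1 := ler_norm (dot p (Pi *m y)); have h2 := norm_dot p (Pi *m y).
have h3 := norm_mulmx Pi y; have h4 := norm_sqr_dot y.
have h5 : n%:R * `|p| * `|Pi *m y| <=
    n%:R * (2 * (n%:R * `|Mi| * `|y|)) * (n%:R * `|Pi| * `|y|).
  by rewrite ler_pM ?mulr_ge0 // ler_wpM2l.
have h6 : n%:R * n%:R * n%:R * `|Mi| * `|Pi| * `|y| ^+ 2 <=
    n%:R * n%:R * n%:R * `|Mi| * `|Pi| * dot y y.
  by rewrite ler_wpM2l // !mulr_ge0.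
have : n%:R * (2 * (n%:R * `|Mi| * `|y|)) * (n%:R * `|Pi| * `|y|) =
    2 * (n%:R * n%:R * n%:R * `|Mi| * `|Pi| * `|y| ^+ 2) by ring.
lra.
Qed.

End Controllability.

(** * Comparison from below, backward in time *)

Section LowerBound.
Context {R : realType} {n m : nat}.
Variables (T : R) (C M : R -> 'M[R]_n).
Hypothesis cC : continuous C.
Hypothesis C_psd : forall t, possemidef (C t).
Hypothesis cM : continuous M.
Hypothesis Ms : forall t, (M t)^T = M t.
Hypothesis dM : forall t : R, 0 < t < T -> is_derive t (1 : R) M (C t).
Variable Z : R * 'cV[R]_n -> R.
Hypothesis cZ : continuous Z.
Hypothesis subZ : vsub T (eikonal C) Z.
Hypothesis superZ : vsuper T (eikonal C) Z.
Variables (f : 'I_m -> R * 'cV[R]_n -> R) (i0 : 'I_m).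
Hypothesis f_sub : forall i, classical_sub T 0 T C (f i).

(** If all [f i] exceeded [Z] at a point, a soft minimum of the [f i] and of a concave paraboloid,
    lowered by a penalty along [N] and one in time, would touch [Z] from below inside a cylinder.
    The paraboloid keeps the test function under the quadratic lower bound of [Z] for large [y];
    where that bound still involves [Z] itself, the penalty along [N] takes over. *)
Lemma lower_bound_slab (ts : R) : 0 < ts -> ts <= T ->
  (forall y, exists i, f i (ts, y) <= Z (ts, y)) ->
  exists s1, 0 < s1 < ts /\
    forall t y, s1 < t < ts -> exists i, f i (t, y) <= Z (t, y).
Proof.
move=> ts0 tsT below.
pose t1 := ts / 2; have t10 : 0 < t1 by rewrite divr_gt0.
have t1s : t1 < ts by rewrite /t1; lra.
have curveZ := sub_curve cC C_psd cM dM cZ subZ.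
have [N [K [sa [K0 /andP[sa1 sa2] CN lowZ]]]] :=
  quadratic_lower_bound C_psd cM Ms dM curveZ t10 t1s tsT.
have [c0 [c00 hc0]] : exists c0, 0 < c0 /\ forall (t : R) (x : 'cV[R]_n),
    0 <= t <= T -> dot x (C t *m x) <= c0 * dot x x.
  have cn : continuous (fun z : R * 'cV[R]_0 => `|C z.1|).
    apply: (@continuous_comp_fst _ _ _ (fun t => `|C t|)) => t.
    by apply: cvg_norm; exact: cC.
  have [B [B0 hB]] := cylinder_bound 0 T 0 cn.
  exists (n%:R * n%:R * B + 1); split=> [|t x tT].
    by rewrite ltr_wpDl // !mulr_ge0 // ltW.
  have Ct : `|C t| <= B.
    by have := hB (t, 0) tT; rewrite normr0 /= normr_id => /(_ (lexx _)).
  have h1 := ler_norm (dot x (C t *m x)); have h2 := norm_dot x (C t *m x).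
  have h3 := norm_mulmx (C t) x; have h4 := norm_sqr_dot x.
  have h5 : n%:R * `|x| * `|C t *m x| <= n%:R * `|x| * (n%:R * B * `|x|).
    by rewrite ler_wpM2l ?mulr_ge0 // (le_trans h3) // ler_wpM2r // ler_wpM2l.
  have h6 : n%:R * n%:R * B * `|x| ^+ 2 <= n%:R * n%:R * B * dot x x.
    by rewrite ler_wpM2l // !mulr_ge0 // ltW.
  have -> : (n%:R * n%:R * B + 1) * dot x x = n%:R * n%:R * B * dot x x + dot x x by ring.
  have : n%:R * `|x| * (n%:R * B * `|x|) = n%:R * n%:R * B * `|x| ^+ 2 by ring.
  have := dot_sqr_ge0 x; lra.
(* Half the curvature [k0] exceeds the constant [K] of the lower bound by 1, so the paraboloid drops
   below that bound at infinity. Its curvature [kap] has rate [L0 = c0 (2 k0)^2], which makes it a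
   subsolution as long as [kap <= 2 k0]; this lasts for a time [k0 / L0]. *)
pose k0 := 2 * (K + 1); have k00 : 0 < k0 by rewrite /k0; lra.
pose L0 := 4 * c0 * k0 ^+ 2; have L00 : 0 < L0 by apply: mulr_gt0; [apply: mulr_gt0 | exact: exprn_gt0].
pose s1 := Num.max ((sa + ts) / 2) (ts - k0 / L0).
have s1a : sa < s1 by rewrite /s1 lt_max; apply/orP; left; lra.
have s1t : s1 < ts by rewrite gt_max ltrBlDr ltrDl divr_gt0 // andbT; lra.
have s10 : 0 < s1 by apply: lt_trans s1a; exact: lt_trans sa1.
pose kap t := k0 + L0 * (ts - t).
have kapE t : s1 <= t <= ts -> k0 <= kap t <= 2 * k0.
  rewrite /s1 ge_max => /andP[/andP[_ h] tle].
  have : L0 * (ts - t) <= L0 * (k0 / L0) by rewrite (ler_wpM2l (ltW L00)) //; lra.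
  rewrite mulrCA divff ?gt_eqF // mulr1.
  have : 0 <= L0 * (ts - t) by rewrite mulr_ge0 ?(ltW L00) // subr_ge0.
  by rewrite /kap => *; apply/andP; split; lra.
exists s1; split; first by rewrite s10.
move=> t0 y0 /andP[t0s t0t].
have [//|nb] := pselect (exists i, f i (t0, y0) <= Z (t0, y0)); exfalso.
have fZ i : Z (t0, y0) < f i (t0, y0).
  by rewrite ltNge; apply/negP => h; apply: nb; exists i.
(* Of the gap [3 e], one part is lost to the soft minimum and one to the time penalty at [t0]; the
   third gives the contradiction. The constant [c] below makes the paraboloid have the same gap at
   [(t0, y0)]. *)
have [e e0 he] : exists2 e, 0 < e & forall i, Z (t0, y0) + 3 * e <= f i (t0, y0).
  pose mi := \big[Num.min/f i0 (t0, y0)]_(i < m) f i (t0, y0).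
  have : Z (t0, y0) < mi by apply: lt_bigmin.
  move=> lt; exists ((mi - Z (t0, y0)) / 3); first by rewrite divr_gt0 // subr_gt0.
  move=> i; have : mi <= f i (t0, y0) by apply: bigmin_le_cond.
  lra.
pose c := Z (t0, y0) + 3 * e + 2^-1 * kap t0 * dot y0 y0.
pose psi := vquad (fun t => (- kap t)%:M) (fun=> (0 : 'cV[R]_n)) (fun=> c).
have psiE z : psi z = c - 2^-1 * kap z.1 * dot z.2 z.2.
  by rewrite /psi /vquad mul_scalar_mx dotZr dot0l; ring.
have ckap : continuous kap.
  move=> t; apply: cvgD; first exact: cvg_cst.
  by apply: cvgM; [exact: cvg_cst | apply: cvgB; [exact: cvg_cst | exact: cvg_id]].
have gpsi : classical_sub T s1 ts C psi.
  split.
    apply: continuous_vquad => [t|t|t]; [|exact: cvg_cst..].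
    apply: cvg_mx => i j; rewrite mxE; under eq_fun do rewrite mxE.
    by apply: cvgMn; apply: cvgN; exact: ckap.
  exists (vquad (fun=> L0%:M) (fun=> 0) (fun=> 0)), (fun z => (- kap z.1)%:M *m z.2 + 0).
  split.
    apply: tfun_vquad => t *; [exact: tr_scalar_mx | | exact: cvg_cst ..].
    apply: is_derive_mx => i j; under eq_fun do rewrite mxE; rewrite mxE.
    have d : is_derive t (1 : R) (fun s : R => - (k0 + L0 * (ts - s))) L0.
      have d1 : is_derive t (1 : R) (cst (- k0 - L0 * ts)) 0 by exact: is_derive_cst.
      have d2 := is_deriveD d1 (is_deriveZ L0 (is_derive_id t (1 : R))).
      rewrite (_ : (fun s : R => _) = cst (- k0 - L0 * ts) + (L0 *: id)); last first.
        by apply/funext => s; rewrite !fctE /GRing.scale /=; ring.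
      by apply: (@is_derive_eq _ _ _ _ _ _ _ _ d2); rewrite add0r /GRing.scale /= mulr1.
    have [_|_] := eqVneq i j; first by under eq_fun do rewrite mulr1n; rewrite mulr1n.
    by under eq_fun do rewrite mulr0n; rewrite mulr0n; exact: is_derive_cst.
  move=> z /andP[sz zt]; have zT : 0 <= z.1 <= T.
    by rewrite ltW ?(lt_trans s10 sz) //= ltW // (lt_le_trans zt).
  have /kapE /andP[ka kb] : s1 <= z.1 <= ts by rewrite !ltW.
  rewrite /eikonal /vquad !mul_scalar_mx !dot0l !addr0 -scalemxAr !dotZl !dotZr.
  have h1 := hc0 z.1 z.2 zT; have h2 := dot_sqr_ge0 z.2.
  have h3 : kap z.1 ^+ 2 <= (2 * k0) ^+ 2 by rewrite ler_pXn2r ?nnegrE //; lra.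
  have h4 : kap z.1 ^+ 2 * dot z.2 (C z.1 *m z.2) <= (2 * k0) ^+ 2 * (c0 * dot z.2 z.2).
    by rewrite ler_pM ?sqr_ge0 //; exact: (C_psd _).2.
  have : (2 * k0) ^+ 2 * (c0 * dot z.2 z.2) = L0 * dot z.2 z.2 by rewrite /L0; ring.
  have : - kap z.1 * (- kap z.1 * dot z.2 (C z.1 *m z.2)) =
    kap z.1 ^+ 2 * dot z.2 (C z.1 *m z.2) by ring.
  lra.
have gf i : classical_sub T s1 ts C (f i).
  have [cf [ft [fx [tf sf]]]] := f_sub i; split=> //; exists ft, fx; split=> // z /andP[sz zt].
  by apply: sf; rewrite (lt_trans s10 sz) (lt_le_trans zt).
have [h [[ch [ht [hx [th sh]]]] hpsi hf hc]] := softmin C_psd (enum 'I_m) e0 gpsi gf.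
have h_low : Z (t0, y0) + 2 * e <= h (t0, y0).
  have h1 : Z (t0, y0) + 3 * e <= psi (t0, y0) by rewrite psiE /c /=; lra.
  have := hc _ _ h1 he; lra.
pose G (z : R * 'cV[R]_n) := N *m z.2 + - (N *m y0).
have cG : continuous G.
  move=> z; apply: cvgB; last exact: cvg_cst.
  by apply: cvg_mulmx; [exact: cvg_cst | exact: cvg_snd].
have dw0 (t : R) : 0 < t < T -> is_derive t (1 : R) (fun=> - (N *m y0)) (0 : 'cV[R]_n).
  by move=> _; exact: is_derive_cst.
have cw0 (t : R) : 0 < t < T -> {for t, continuous (fun=> (0 : 'cV[R]_n))}.
  by move=> _; exact: cvg_cst.
have tG := tfun_sqdist N dw0 cw0.
(* The lower bound of [Z (s, y)] involves [Z (t1, N y)]. Wherever the penalty along [N] is small,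
   [N y] lies in this ball around the origin. *)
have [B2 [B20 hB2]] := cylinder_bound t1 t1 (`|N *m y0| + 1) cZ.
pose rho := `|c| + B2 + `|y0| + 1.
have cZf : continuous (fun z => Z z - f i0 z).
  by move=> z; apply: cvgB; [exact: cZ | exact: (f_sub i0).1].
(* Since [h <= f i0], this [B] bounds [h - Z] on the whole cylinder, so each penalty needs to reach
   only [B] on its face. *)
have [B [B0 hB]] := cylinder_bound s1 ts rho cZf.
pose L := B / (e * (t0 - s1)).
have L0' : 0 < L by rewrite divr_gt0 // mulr_gt0 // subr_gt0.
pose chi (z : R * 'cV[R]_n) := e * expR (L * (t0 - z.1)).
have chi0 z : 0 < chi z by rewrite mulr_gt0 ?expR_gt0.
have cchi : continuous chi.
  move=> z; apply: cvgM; first exact: cvg_cst.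
  have cf : (fst : R * 'cV[R]_n -> R) u @[u --> z] --> z.1 by exact: cvg_fst.
  have c1 : (fun u : R * 'cV[R]_n => L * (t0 - u.1)) u @[u --> z] --> L * (t0 - z.1).
    by apply: cvgM; [exact: cvg_cst | apply: cvgB => //; exact: cvg_cst].
  exact: (cvg_comp _ _ c1 (@continuous_expR R _)).
pose phi z := h z - B * dot (G z) (G z) - chi z.
have tphi := tfunD (tfunD th (tfunN (tfunZ B tG))) (tfunN (tfun_expR (n := n) T e L t0)).
have cphi : continuous phi.
  move=> z; apply: cvgB; last exact: cchi.
  apply: cvgB; first exact: ch.
  by apply: cvgM; [exact: cvg_cst | apply: cvg_dot; exact: cG].
have BG0 z : 0 <= B * dot (G z) (G z) by rewrite mulr_ge0 ?dot_sqr_ge0 // ltW.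
have hf0 z : h z <= f i0 z by apply: hf; rewrite mem_enum.
have : phi (t0, y0) - Z (t0, y0) <= 0.
  apply: (@max_principle _ _ (fun z => phi z - Z z) s1 ts rho 0) => //=.
  - by move=> z; apply: cvgB; [exact: cphi | exact: cZ].
  - move=> z zts zr; have fle : f i0 z - Z z <= B.
      by rewrite -opprB; apply: le_trans (hB z zts zr); rewrite -normrN ler_norm.
    rewrite /phi; have := hf0 z; have := chi0 z; have := BG0 z.
    move=> l1 l2 l3 [zt|zs|zrho].
    + have : B <= chi z.
        rewrite /chi zt (le_trans (y := e * (1 + L * (t0 - s1))))//; last first.
          by rewrite ler_wpM2l ?expR_ge1Dx // ltW.
        rewrite (_ : e * _ = e + B); first by rewrite lerDr ltW.
        by rewrite /L; field; rewrite subr_eq0 !gt_eqF.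
      lra.
    + have [i fi] := below z.2; have := hf z i; rewrite mem_enum => /(_ isT).
      by rewrite -{1}zs -{1}zs -surjective_pairing in fi; lra.
    (* On the lateral face either [G z] is large and the penalty reaches [B], or [N z.2] is close to
       [N y0] and the paraboloid lies below the quadratic lower bound: [rho] is at least 1 and at
       least [c + B2], hence so is its square. *)
    + have [lt|ge] := lerP 1 (dot (G z) (G z)).
        have : B <= B * dot (G z) (G z) by rewrite ler_peMr // ltW.
        lra.
      have Nz : `|N *m z.2| <= `|N *m y0| + 1.
        have -> : N *m z.2 = N *m y0 + G z by rewrite /G addrC subrK.
        rewrite (le_trans (ler_normD _ _)) // lerD2l.
        have := norm_sqr_dot (G z); have := normr_ge0 (G z); nra.
      have lz : - B2 - K * dot z.2 z.2 <= Z z.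
        have zsa : sa < z.1 <= ts.
          by case/andP: zts => zs1 ->; rewrite andbT (lt_le_trans s1a).
        have := @lowZ z.1 z.2 zsa; rewrite -surjective_pairing.
        apply: le_trans; rewrite lerD2r.
        have := hB2 (t1, N *m z.2); rewrite lexx => /(_ isT Nz) /ler_normlP[].
        by rewrite lerNl.
      have /kapE /andP[ka _] := zts.
      have hp := hpsi z; rewrite psiE in hp.
      have d0 := dot_sqr_ge0 z.2.
      have : k0 * dot z.2 z.2 <= kap z.1 * dot z.2 z.2 by rewrite ler_wpM2r.
      rewrite /k0 => kd.
      have : c + B2 <= dot z.2 z.2.
        apply: le_trans (norm_sqr_dot _); rewrite zrho.
        have r1 : 1 <= rho by rewrite /rho; have := normr_ge0 c; have := normr_ge0 y0; lra.
        apply: (@le_trans _ _ rho); last by rewrite expr2 ler_peMr //; lra.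
        by rewrite /rho; have := ler_norm c; have := normr_ge0 y0; lra.
      lra.
  - move=> z /andP[zs zt] zr mx.
    have zT : 0 < z.1 < T by rewrite (lt_trans s10 zs) (lt_le_trans zt tsT).
    have mn : \forall w \near z, Z z - phi z <= Z w - phi w.
      by apply: filterS mx => w; rewrite -(opprB (phi w)) -(opprB (phi z)) lerN2.
    have := superZ tphi zT mn; rewrite leNgt => /negP; apply.
    have zst : s1 < z.1 < ts by rewrite zs.
    have sat : sa < z.1 < ts by rewrite (lt_trans s1a zs).
    have := sh z zst; have CNz := CN _ sat.
    (* The gradient of the penalty lies in the kernel of [C], so it leaves the Hamiltonian
       unchanged, however large [B] is; the strict inequality comes from the time penalty. *)
    have CNG : C z.1 *m (N^T *m G z) = 0 by rewrite mulmxA CNz mul0mx.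
    have -> : hx z + - (B *: (2 *: (N^T *m (N *m z.2 + - (N *m y0))))) + - 0 =
        hx z - (B * 2) *: (N^T *m G z) by rewrite oppr0 addr0 scalerA.
    move: (N^T *m G z) CNG => g CNG.
    rewrite dot0r !mulr0 oppr0 addr0 /eikonal mulmxBr -!scalemxAr CNG scaler0 subr0.
    have gC : dot g (C z.1 *m hx z) = 0 by rewrite dot_mull (C_psd _).1 CNG dot0l.
    rewrite dotDl dotNl dotZl gC.
    have : 0 < e * L * expR (L * (t0 - z.1)) by exact: mulr_gt0 (mulr_gt0 e0 L0') (expR_gt0 _).
    by rewrite mulr0 subr0 opprD opprK; lra.
  - by rewrite !ltW.
  - by rewrite /rho; have := normr_ge0 c; lra.
rewrite /phi /chi /= subrr mulr0 expR0 mulr1 /G /= subrr dot0l mulr0; lra.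
Qed.

(** The length of a slab depends on its end time, so slabs cannot simply be counted. The infimum of
    the times from which the inequality holds up to [T] belongs to them by continuity, and a further
    slab shows that it is 0. *)
Lemma lower_bound : 0 < T -> (forall y, exists i, f i (T, y) <= Z (T, y)) ->
  forall t y, 0 <= t <= T -> exists i, f i (t, y) <= Z (t, y).
Proof.
move=> T0 belowT.
pose below t := forall y, exists i, f i (t, y) <= Z (t, y).
pose S := [set t | 0 <= t <= T /\ forall s, t <= s <= T -> below s].
have ST : S T.
  split; first by rewrite lexx ltW.
  by move=> s /andP[Ts sT]; have -> : s = T by apply/eqP; rewrite eq_le sT.
have S_lb : lbound S 0 by move=> t [/andP[]].
have hinf : has_inf S by split; [exists T | exists 0].
pose ts := inf S.
have ts0 : 0 <= ts by apply: lb_le_inf => //; exists T.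
have tsT : ts <= T by apply: ge_inf => //; exists 0.
have above s : ts < s -> s <= T -> below s.
  move=> tss sT; have [t [tT tb] ts'] := inf_lt hinf.1 tss.
  by apply: tb; rewrite ltW.
have below_ts : below ts.
  have [->//|tneT] := eqVneq ts T.
  have tltT : ts < T by rewrite lt_neqAle tneT.
  (* The index may vary with time, but if all of the finitely many [f i] exceed [Z] at [ts], they
     still do so at slightly later times. *)
  move=> y; have [//|nb] := pselect (exists i, f i (ts, y) <= Z (ts, y)); exfalso.
  have near_i i : \forall s \near ts, Z (s, y) < f i (s, y).
    have cfZ : continuous (fun z => f i z - Z z).
      by move=> z; apply: cvgB; [exact: (f_sub i).1 | exact: cZ].
    have cy : continuous (fun s : R => (s, y)) := @continuous_pairl _ _ y.
    have c1 : {for ts, continuous (fun s => f i (s, y) - Z (s, y))}.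
      exact: (continuous_comp (cy ts) (cfZ (ts, y))).
    have gt0 : 0 < f i (ts, y) - Z (ts, y).
      by rewrite subr_gt0 ltNge; apply/negP => h; apply: nb; exists i.
    have : \forall s \near ts, 0 < f i (s, y) - Z (s, y) by exact: (c1 _ (lt_nbhsr gt0)).
    by apply: filterS => s; rewrite subr_gt0.
  have allnear : \forall s \near ts, forall i, Z (s, y) < f i (s, y) by exact: (@filter_forall _ _ (fun (i : 'I_m) (s : R) => Z (s, y) < f i (s, y)) (nbhs ts) _ near_i).
  have [s [/= hs /andP[s1 s2]]] : exists s, (forall i, Z (s, y) < f i (s, y)) /\ ts < s <= T.
    move/nbhs_ballP : allnear => [d /= d0 hd].
    exists (Num.min (ts + d / 2) T); split.
      apply: hd; rewrite -ball_normE /= distrC ger0_norm.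
        by rewrite ltrBlDl gt_min; apply/orP; left; lra.
      by rewrite subr_ge0 le_min tsT andbT; lra.
    by rewrite lt_min tltT andbT ge_min lexx orbT andbT; lra.
  by have [i] := above s s1 s2 y; rewrite leNgt hs.
have ts_eq0 : ts = 0.
  apply/eqP; rewrite eq_le ts0 andbT leNgt; apply/negP => tsgt0.
  have [s1 [/andP[s10 s1t] hs1]] := lower_bound_slab tsgt0 tsT below_ts.
  pose s2 := (s1 + ts) / 2.
  have : ts <= s2.
    apply: ge_inf; first by exists 0.
    split; first by rewrite /s2; apply/andP; split; lra.
    move=> s /andP[s2s sT]; have [lt|gt|->] := ltgtP s ts.
    - by move=> y; apply: hs1; rewrite lt andbT; move: s2s; rewrite /s2; lra.
    - exact: above.
    - exact: below_ts.
  by rewrite /s2; lra.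
move=> t y /andP[t0 tT]; have [lt|gt|e] := ltgtP ts t.
- exact: above.
- by move: gt; rewrite ts_eq0 ltNge t0.
- by rewrite -e; exact: below_ts.
Qed.

End LowerBound.

(** * Linear differential equations and the moving frame *)

Lemma continuous_comp_within (X Y U : topologicalType) (D : set Y) (f : X -> Y) (g : Y -> U) :
  continuous f -> (forall x, D (f x)) -> {within D, continuous g} -> continuous (g \o f).
Proof.
move=> cf fD /subspace_continuousP cg x.
apply: (@cvg_comp _ _ _ f g (nbhs x) (within D (nbhs (f x)))); last exact/cg/fD.
move=> A nA.
have h : \forall s \near x, D (f s) -> A (f s) by exact: (cf x _ nA).
have h' : \forall s \near x, A (f s) by apply: filterS h => s; apply.
exact: h'.
Qed.

Section Clamp.
Context {R : realType}.
Variable T : R.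

Definition clamp (t : R) : R := Num.max 0 (Num.min t T).

Hypothesis T0 : 0 < T.

Lemma clamp_itv t : 0 <= clamp t <= T.
Proof. by rewrite /clamp le_max lexx /= ge_max ltW //= ge_min lexx orbT. Qed.

Lemma clamp_id t : 0 <= t <= T -> clamp t = t.
Proof. by case/andP => t0 tT; rewrite /clamp min_l // max_r. Qed.

Lemma continuous_clamp : continuous clamp.
Proof.
move=> t.
have c1 : {for t, continuous ((id : R -> R^o) \min (cst T : R -> R^o))}.
  by apply: continuous_min; [exact: cvg_id | exact: cvg_cst].
have c0 : {for t, continuous (cst 0 : R -> R^o)} by exact: cvg_cst.
exact: (continuous_max c0 c1).
Qed.

Lemma near_clamp t : 0 < t < T -> \forall s \near t, clamp s = s.
Proof.
move=> tT; have ti : t \in `]0, T[ by rewrite in_itv.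
apply: filterS (near_in_itvoo ti) => s; rewrite in_itv /= => /andP[s0 sT].
by rewrite clamp_id // !ltW.
Qed.

Lemma continuous_clamped (U : topologicalType) (f : R -> U) :
  {within `[0, T], continuous f} -> continuous (f \o clamp).
Proof.
apply: continuous_comp_within; first exact: continuous_clamp.
by move=> t; rewrite /= in_itv /=; exact: clamp_itv.
Qed.

End Clamp.

Section Primitive.
Context {R : realType}.

(** Integrating from [-1] makes the derivative at 0 two-sided; the subtracted constant makes the
    primitive vanish at 0. *)
Definition primitive (f : R -> R) (t : R) : R :=
  (\int[lebesgue_measure]_(s in `[-1, t]) f s -
   \int[lebesgue_measure]_(s in `[-1, (0 : R)]) f s)%R.

Lemma primitive0 f : primitive f 0 = 0.
Proof. by rewrite /primitive subrr. Qed.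

Lemma is_derive_primitive f (t : R) : continuous f -> -1 < t ->
  is_derive t (1 : R) (primitive f) (f t).
Proof.
move=> cf t1.
have tt : t < t + 1 by rewrite ltrDl.
have fi : lebesgue_measure.-integrable `[-1, t + 1] (EFin \o f).
  apply: continuous_compact_integrable; first exact: segment_compact.
  exact: continuous_subspaceT.
have [d1 d2] := @continuous_FTC1_closed R f (-1) t (t + 1) tt fi t1 (cf t).
have dI := DeriveDef d1 (etrans (esym (derive1E _ _)) d2).
have d := is_deriveB dI
  (is_derive_cst (\int[lebesgue_measure]_(s in `[-1, (0 : R)]) f s)%R t (1 : R)).
by apply: (@is_derive_eq _ _ _ _ _ _ _ _ d); rewrite subr0.
Qed.

Lemma is_derive_le (f f' g g' : R -> R) (a b : R) : a <= b ->
  (forall t, a <= t <= b -> is_derive t (1 : R) f (f' t)) ->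
  (forall t, a <= t <= b -> is_derive t (1 : R) g (g' t)) ->
  (forall t, a <= t <= b -> f' t <= g' t) -> f a <= g a -> f b <= g b.
Proof.
move=> ab df dg fg fga.
have d t : a <= t <= b -> is_derive t (1 : R) (g - f) (g' t - f' t).
  by move=> tab; have := is_deriveB (dg t tab) (df t tab).
have : (g - f) a <= (g - f) b.
  apply: (@ger0_derive1_le_cc R (g - f) a b) => //; rewrite ?in_itv /= ?lexx ?ab //.
  - by move=> t; rewrite in_itv /= => /andP[/ltW ? /ltW ?]; apply: ex_derive; apply: d; apply/andP.
  - move=> t; rewrite in_itv /= => /andP[/ltW at_ /ltW tb].
    have dt : is_derive t (1 : R) (g - f) (g' t - f' t) by apply: d; rewrite at_.
    by rewrite derive1E derive_val subr_ge0 fg // at_.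
  - apply: derivable_within_continuous => t; rewrite in_itv /= => tab.
    by apply: ex_derive; exact: d.
rewrite !fctE; lra.
Qed.

End Primitive.

(** * Linear differential equations by Picard iteration *)

Section LinearODE.
Context {R : realType} {n k : nat}.

Definition mx_primitive (f : R -> 'M[R]_(n, k)) (t : R) : 'M[R]_(n, k) :=
  \matrix_(i, j) primitive (fun s => f s i j) t.

Lemma continuous_coord (f : R -> 'M[R]_(n, k)) i j :
  continuous f -> continuous (fun s => f s i j).
Proof. by move=> cf s; have := cf s; exact: cvg_mx_coord. Qed.

Lemma is_derive_mx_primitive (f : R -> 'M[R]_(n, k)) (t : R) : continuous f -> -1 < t ->
  is_derive t (1 : R) (mx_primitive f) (f t).
Proof.
move=> cf t1; apply: is_derive_mx => i j; under eq_fun do rewrite mxE.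
exact: (@is_derive_primitive _ (fun s => f s i j) t (@continuous_coord f i j cf) t1).
Qed.

Variables (A : R -> 'M[R]_n) (b : R -> 'M[R]_(n, k)) (x0 : 'M[R]_(n, k)) (T : R).
Hypothesis T0 : 0 < T.
Hypothesis cA : continuous A.
Hypothesis cb : continuous b.

Let rhs (Y : R -> 'M[R]_(n, k)) t := A t *m Y t + b t.
(** The clamped Picard map: its values are determined by times in [[0, T]], so estimates there hold
    on the whole line. *)
Let step (Y : R -> 'M[R]_(n, k)) t := x0 + mx_primitive (rhs Y) (clamp T t).
Let Y_ i := iter i step (fun=> x0).

Let continuous_rhs Y : continuous Y -> continuous (rhs Y).
Proof.
move=> cY t; apply: cvgD; last exact: cb.
by apply: cvg_mulmx; [exact: cA | exact: cY].
Qed.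

Let clamp_gt (t : R) : -1 < clamp T t.
Proof. have /andP[h _] := clamp_itv T0 t; lra. Qed.

Let continuous_step Y : continuous Y -> continuous (step Y).
Proof.
move=> cY t; apply: cvgD; first exact: cvg_cst.
have d := is_derive_mx_primitive (continuous_rhs cY) (clamp_gt t).
have c1 : {for clamp T t, continuous (mx_primitive (rhs Y))}.
  apply: differentiable_continuous; apply/derivable1_diffP; exact: ex_derive.
have c3 : {for t, continuous (mx_primitive (rhs Y) \o clamp T)}.
  exact: (continuous_comp (@continuous_clamp R T t) c1).
exact: c3.
Qed.

Let continuous_Y i : continuous (Y_ i).
Proof. by elim: i => [t|i IH]; [exact: cvg_cst | exact: continuous_step]. Qed.

(* The weight [expR (2 K t)] makes the Picard step a contraction of ratio 1/2. *)
Let step_contract (K c : R) (Y1 Y2 : R -> 'M[R]_(n, k)) : 0 < K -> 0 <= c ->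
  (forall t, 0 <= t <= T -> n%:R * `|A t| <= K) ->
  continuous Y1 -> continuous Y2 ->
  (forall t, 0 <= t <= T -> `|Y1 t - Y2 t| <= c * expR (2 * K * t)) ->
  forall t, 0 <= t <= T -> `|step Y1 t - step Y2 t| <= c / 2 * expR (2 * K * t).
Proof.
move=> K0 c0 AK c1 c2 Y12 t /andP[t0 tT].
have E0 s : 0 <= c / 2 * expR (2 * K * s) by rewrite mulr_ge0 ?expR_ge0 // divr_ge0.
apply: norm_mx_le => // i j.
have stE : (step Y1 t - step Y2 t) i j =
    primitive (fun s => rhs Y1 s i j) t - primitive (fun s => rhs Y2 s i j) t.
  by rewrite /step clamp_id ?t0 // opprD addrACA subrr add0r !mxE.
have dE (s : R) : 0 <= s <= t ->
    is_derive s (1 : R) (fun s => c / 2 * expR (2 * K * s)) (K * (c * expR (2 * K * s))).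
  move=> _; have d1 : is_derive s (1 : R) (fun s : R => 2 * K * s) (2 * K).
    apply: (@is_derive_eq _ _ _ _ _ _ _ _ (is_deriveZ (2 * K) (is_derive_id s (1 : R)))).
    by rewrite /GRing.scale /= mulr1.
  have d2 := @is_derive1_comp _ expR (fun s : R => 2 * K * s) s _ _ (is_derive_expR _) d1.
  apply: (@is_derive_eq _ _ _ _ _ _ _ _ (is_deriveZ (c / 2) d2)).
  by rewrite /GRing.scale /=; field.
have dP (s : R) : 0 <= s <= t -> is_derive s (1 : R)
    (fun s => primitive (fun s => rhs Y1 s i j) s - primitive (fun s => rhs Y2 s i j) s)
    ((rhs Y1 s - rhs Y2 s) i j).
  move=> /andP[s0 _].
  have -> : (rhs Y1 s - rhs Y2 s) i j = rhs Y1 s i j - rhs Y2 s i j.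
    by rewrite [LHS]mxE [X in _ + X]mxE.
  have s1 : -1 < s by lra.
  have d1 := is_derive_primitive (@continuous_coord _ i j (continuous_rhs c1)) s1.
  have d2 := is_derive_primitive (@continuous_coord _ i j (continuous_rhs c2)) s1.
  exact: is_deriveB d1 d2.
have bd s : 0 <= s <= t -> `|(rhs Y1 s - rhs Y2 s) i j| <= K * (c * expR (2 * K * s)).
  move=> /andP[s0 st]; have sT : 0 <= s <= T by rewrite s0 (le_trans st).
  apply: le_trans (le_norm_mx _ _ _) _.
  rewrite /rhs opprD addrACA subrr addr0 -mulmxBr.
  apply: le_trans (norm_mulmx _ _) _.
  by apply: ler_pM => //; [exact: AK | exact: Y12].
rewrite stE ler_norml; apply/andP; split.
- rewrite lerNl.
  apply: (@is_derive_le _ (fun s => - (primitive (fun s => rhs Y1 s i j) s - primitive (fun s => rhs Y2 s i j) s)) (fun s => - (rhs Y1 s - rhs Y2 s) i j) _ _ 0 t t0 _ dE).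
  + by move=> s st; have := is_deriveN (dP s st).
  + by move=> s st; rewrite (le_trans _ (bd s st)) // -normrN ler_norm.
  + by rewrite !primitive0 subrr oppr0.
- apply: (@is_derive_le _ _ _ _ _ 0 t t0 dP dE).
  + by move=> s st; rewrite (le_trans _ (bd s st)) // ler_norm.
  + by rewrite !primitive0 subrr.
Qed.

Lemma linear_ode : exists X : R -> 'M[R]_(n, k), [/\ continuous X, X 0 = x0 &
  forall t : R, 0 < t < T -> is_derive t (1 : R) X (A t *m X t + b t)].
Proof.
have aux (u1 u2 e : R) : 0 <= u1 -> u2 + u1 <= e -> u2 + u1 / 2 <= e by lra.
have [K [K0 AK]] : exists K, 0 < K /\ forall t, 0 <= t <= T -> n%:R * `|A t| <= K.
  have cn : {within `[0, T], continuous (fun t => n%:R * `|A t|)}.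
    apply: continuous_subspaceT => t; apply: cvgM; first exact: cvg_cst.
    by apply: cvg_norm; exact: cA.
  have [c _ hc] := EVT_max (ltW T0) cn.
  exists (n%:R * `|A c| + 1); split; first by rewrite ltr_wpDl // mulr_ge0.
  by move=> t tT; have := hc t; rewrite in_itv /= => /(_ tT); lra.
have [c [c0 hc]] : exists c, 0 <= c /\ forall t, 0 <= t <= T -> `|Y_ 1 t - Y_ 0 t| <= c.
  have cn : {within `[0, T], continuous (fun t => `|Y_ 1 t - Y_ 0 t|)}.
    apply: continuous_subspaceT => t; apply: cvg_norm.
    by apply: cvgB; exact: continuous_Y.
  have [d _ hmax] := EVT_max (ltW T0) cn.
  by exists `|Y_ 1 d - Y_ 0 d|; split => //.
have clampE i t : Y_ i t = Y_ i (clamp T t).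
  by case: i => [//|i]; rewrite /Y_ /= /step [clamp T (clamp T t)]clamp_id //; exact: clamp_itv.
have Yincr i t : 0 <= t <= T -> `|Y_ i.+1 t - Y_ i t| <= c / 2 ^+ i * expR (2 * K * t).
  elim: i t => [|i IH] t tT.
    rewrite expr0 divr1 (le_trans (hc t tT)) // ler_peMr //.
    rewrite -expR0 ler_expR !mulr_ge0 //; last by case/andP: tT.
    exact: ltW.
  have -> : c / 2 ^+ i.+1 = c / 2 ^+ i / 2 by rewrite exprSr invfM mulrA.
  by apply: (@step_contract K (c / 2 ^+ i) (Y_ i.+1) (Y_ i)) => //; rewrite divr_ge0 ?exprn_ge0.
pose c2 := c * expR (2 * K * T).
have c20 : 0 <= c2 by rewrite mulr_ge0 ?expR_ge0.
have Yincr2 i t : `|Y_ i.+1 t - Y_ i t| <= c2 / 2 ^+ i.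
  rewrite (clampE i.+1) (clampE i); have tT := clamp_itv T0 t.
  apply: le_trans (Yincr i _ tT) _; rewrite mulrAC ler_pM2r ?invr_gt0 ?exprn_gt0 //.
  rewrite ler_wpM2l // ler_expR ler_pM2l ?mulr_gt0 //.
  by case/andP: tT.
(* The right-hand side is the sum of the geometric bounds [c2 / 2 ^ k] for [i <= k < i + j], written
   so that it telescopes. *)
have Ydist i j t : `|Y_ (i + j) t - Y_ i t| <= 2 * c2 / 2 ^+ i - 2 * c2 / 2 ^+ (i + j).
  elim: j => [|j IH]; first by rewrite addn0 !subrr normr0.
  rewrite addnS -(subrKA (Y_ (i + j) t)) (le_trans (ler_normD _ _)) //.
  have h := Yincr2 (i + j) t.
  have -> : 2 * c2 / 2 ^+ (i + j).+1 = c2 / 2 ^+ (i + j).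
    by rewrite exprS invfM mulrACA mulfV // mul1r.
  have : 2 * c2 / 2 ^+ (i + j) = c2 / 2 ^+ (i + j) + c2 / 2 ^+ (i + j).
    by rewrite -mulrA mulr_natl mulr2n.
  lra.
pose err i := 2 * c2 / 2 ^+ i.
have Ydist2 i j t : (i <= j)%N -> `|Y_ j t - Y_ i t| <= err i.
  move=> ij; rewrite -(subnKC ij); apply: le_trans (Ydist _ _ _) _.
  by rewrite gerBl divr_ge0 ?mulr_ge0 ?exprn_ge0.
have err0 : err i @[i --> \oo] --> 0.
  have h : `|2^-1 : R| < 1 by rewrite ger0_norm; lra.
  rewrite -[X in _ --> X](mulr0 (2 * c2)).
  have -> : err = (fun i => 2 * c2 * 2^-1 ^+ i) by apply/funext => i; rewrite /err exprVn.
  by apply: cvgM; [exact: cvg_cst | exact: cvg_expr].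
have errlt e : 0 < e -> exists i, err i < e.
  move=> e0; have := cvgr_lt 0 err0 e e0 => -[N _ hN]; exists N; exact: hN (leqnn N).
have cvgY t : cvg (Y_ i t @[i --> \oo]).
  apply/cauchy_cvgP/cauchyP => e e0.
  have [i hi] := errlt e e0; exists (Y_ i t); exists i => // j /= ij.
  by rewrite -ball_normE /= distrC (le_lt_trans (Ydist2 i j t ij)).
pose Y t := lim (Y_ i t @[i --> \oo]).
have YY i t : `|Y t - Y_ i t| <= err i.
  apply/ler_addgt0Pr => e e0.
  have /cvgrPdist_le /(_ e e0) [N _ hN] := cvgY t.
  have h1 := hN _ (leq_maxl N i); have h2 := Ydist2 i (maxn N i) t (leq_maxr _ _).
  rewrite -(subrKA (Y_ (maxn N i) t)) (le_trans (ler_normD _ _)) //.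
  by rewrite addrC lerD.
have cY : continuous Y.
  move=> t; apply/cvgrPdist_le => e e0.
  have [i hi] : exists i, err i < e / 3 by apply: errlt; rewrite divr_gt0.
  have e3 : 0 < e / 3 by rewrite divr_gt0.
  have /cvgrPdist_le /(_ _ e3) := @continuous_Y i t.
  apply: filterS => s hs.
  rewrite -(subrKA (Y_ i t)) -[Y_ i t - Y s](subrKA (Y_ i s)).
  have h1 := YY i t; have h2 := YY i s; rewrite distrC in h2.
  apply: le_trans (ler_normD _ _) _; have h3 := ler_normD (Y_ i t - Y_ i s) (Y_ i s - Y s).
  have := splitr e; lra.
(* Both sides are close to the iterate [i.+1]: the left by the error bound, the right by the
   contraction estimate for [Y_ i] and its limit [Y]. *)
have YE t : Y t = step Y t.
  suff : forall e, 0 < e -> `|Y t - step Y t| <= e.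
    move=> h; apply/eqP; rewrite -subr_eq0 -normr_le0.
    by apply/ler_addgt0Pr => e e0; rewrite add0r h.
  move=> e e0.
  have tT := clamp_itv T0 t.
  have YcE : Y t = Y (clamp T t).
    by rewrite /Y (_ : (fun i => Y_ i t) = (fun i => Y_ i (clamp T t))) //; apply/funext => i; exact: clampE.
  have stE : step Y t = step Y (clamp T t).
    by rewrite /step [clamp T (clamp T t)]clamp_id.
  pose g := 1 + expR (2 * K * T); have g0 : 0 < g by rewrite addr_gt0 ?expR_gt0.
  have [i hi] : exists i, err i < e / g by apply: errlt; rewrite divr_gt0.
  have ei : 0 <= err i by rewrite divr_ge0 ?mulr_ge0 ?exprn_ge0.
  rewrite -(subrKA (Y_ i.+1 t)) (le_trans (ler_normD _ _)) //.
  have h1 : `|Y t - Y_ i.+1 t| <= err i.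
    apply: le_trans (YY _ _) _; have -> : err i.+1 = err i / 2; last by lra.
    by rewrite /err exprS invfM mulrCA mulrC.
  have h2 : `|Y_ i.+1 t - step Y t| <= err i / 2 * expR (2 * K * T).
    rewrite clampE stE.
    apply: (@le_trans _ _ (err i / 2 * expR (2 * K * clamp T t))).
      apply: (@step_contract K (err i) (Y_ i) Y) => //.
      move=> s sT; rewrite distrC (le_trans (YY i s)) // ler_peMr //.
      rewrite -expR0 ler_expR !mulr_ge0 //; last by case/andP: sT.
      exact: ltW.
    apply: ler_wpM2l; first by rewrite divr_ge0.
    rewrite ler_expR ler_pM2l ?mulr_gt0 //.
    by case/andP: tT.
  apply: le_trans (lerD h1 h2) _; rewrite mulrAC.
  have : err i * g <= e by rewrite -ler_pdivlMr // ltW.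
  have : 0 <= err i * expR (2 * K * T) by rewrite mulr_ge0 ?expR_ge0.
  rewrite /g mulrDr mulr1; exact: aux.
exists Y; split => //.
  rewrite YE /step clamp_id ?lexx ?ltW //.
  by rewrite (_ : mx_primitive _ _ = 0) ?addr0 //; apply/matrixP => i j; rewrite !mxE primitive0.
move=> t tT.
have d1 : is_derive t (1 : R) (cst x0 + mx_primitive (rhs Y)) (rhs Y t).
  have t1 : -1 < t by case/andP: tT => t0 _; lra.
  have d2 := is_deriveD (is_derive_cst x0 t 1) (is_derive_mx_primitive (continuous_rhs cY) t1).
  by apply: (@is_derive_eq _ _ _ _ _ _ _ _ d2); rewrite add0r.
apply: near_eq_is_derive d1.
apply: filterS (near_clamp tT) => s hs.
by rewrite YE /step hs.
Qed.

End LinearODE.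

Lemma hamiltonianD (R : realType) n (cpp cxx cxp : R -> 'M[R]_n) t (x p d : 'cV[R]_n) :
  (cpp t)^T = cpp t ->
  hamiltonian cpp cxx cxp t x (p + d) = hamiltonian cpp cxx cxp t x p +
    2^-1 * dot d (cpp t *m d) + dot d (cpp t *m p - cxp t *m x).
Proof.
move=> Cs; rewrite /hamiltonian !mulmxDr !(dotDl, dotDr, dotNl, dotNr).
have -> : dot p (cpp t *m d) = dot d (cpp t *m p) by rewrite dot_mull Cs dotC.
by field.
Qed.

Lemma psd_conj (R : realType) n (C N : 'M[R]_n) :
  possemidef C -> possemidef (N *m C *m N^T).
Proof.
move=> [Cs C0]; split; first by rewrite !trmx_mul trmxK Cs mulmxA.
by move=> x; rewrite -mulmxA dot_mull trmx_mul Cs; have := C0 (N^T *m x);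
  rewrite -!mulmxA dot_mull Cs.
Qed.

(** * The moving frame of the feedback dynamics *)

Section Frame.
Context {R : realType} {n : nat}.
Variables (T : R) (cpp cxx cxp P : R -> 'M[R]_n) (q : R -> 'cV[R]_n) (r : R -> R).
Hypothesis T0 : 0 < T.
Hypothesis ccpp : continuous cpp.
Hypothesis ccxp : continuous cxp.
Hypothesis cpp_psd : forall t, possemidef (cpp t).
Hypothesis cP : continuous P.
Hypothesis cq : continuous q.

(* Along the flow of [x' = drift t *m x + force t], the optimally controlled
   dynamics of the quadratic solution, any other solution minus the quadratic one
   solves a purely eikonal equation; [(Phi, z)] is the flow and [Psi] inverts [Phi]. *)
Let drift t := cxp t - cpp t *m P t.
Let force t := - (cpp t *m q t).

Let cdrift : continuous drift.
Proof.
move=> t; apply: cvgB; first exact: ccxp.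
by apply: cvg_mulmx; [exact: ccpp | exact: cP].
Qed.

Let cforce : continuous force.
Proof. by move=> t; apply: cvgN; apply: cvg_mulmx; [exact: ccpp | exact: cq]. Qed.

Let is_derive_clamp (U : normedModType R) (f : R -> U) (df : U) (t : R) : 0 < t < T ->
  is_derive t (1 : R) f df -> is_derive t (1 : R) (f \o clamp T) df.
Proof.
move=> tT; apply: near_eq_is_derive.
by apply: filterS (near_clamp tT) => s /= ->.
Qed.

Let continuous_clamp_comp (U : topologicalType) (f : R -> U) :
  continuous f -> continuous (f \o clamp T).
Proof.
by move=> cf t; apply: continuous_comp; [exact: continuous_clamp | exact: cf].
Qed.

Record flow_frame (Phi Psi : R -> 'M[R]_n) (z : R -> 'cV[R]_n) (M : R -> 'M[R]_n) : Prop :=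
  FlowFrame {
  ff_cPhi : continuous Phi;
  ff_cPsi : continuous Psi;
  ff_cz : continuous z;
  ff_cM : continuous M;
  ff_PsiPhi : forall t, Psi t *m Phi t = 1%:M;
  ff_Ms : forall t, (M t)^T = M t;
  ff_dPhi : forall t : R, 0 < t < T -> is_derive t (1 : R) Phi (drift t *m Phi t);
  ff_dPsi : forall t : R, 0 < t < T -> is_derive t (1 : R) Psi (- (Psi t *m drift t));
  ff_dz : forall t : R, 0 < t < T -> is_derive t (1 : R) z (drift t *m z t + force t);
  ff_dM : forall t : R, 0 < t < T -> is_derive t (1 : R) M (Psi t *m cpp t *m (Psi t)^T)
}.

Lemma flow_frame_exists : exists Phi Psi z M, flow_frame Phi Psi z M.
Proof.
have c0 (j : nat) : continuous (fun _ : R => 0 : 'M[R]_(n, j)) by move=> t; exact: cvg_cst.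
have [Phi [cPhi Phi0 dPhi]] := linear_ode 1%:M T0 cdrift (c0 n).
(* The inverse flow satisfies [Psi' = - Psi drift], with the unknown on the left of the coefficient;
   its transpose solves an equation of the form treated above. *)
have cdT : continuous (fun t => - (drift t)^T).
  by move=> t; apply: cvgN; apply: cvg_trmx; exact: cdrift.
have [PsiT [cPsiT PsiT0 dPsiT]] := linear_ode 1%:M T0 cdT (c0 n).
have [z [cz z0 dz]] := linear_ode 0 T0 cdrift cforce.
pose Psi t := (PsiT t)^T.
have cPsi : continuous Psi by move=> t; apply: cvg_trmx; exact: cPsiT.
have dPsi (t : R) : 0 < t < T -> is_derive t (1 : R) Psi (- (Psi t *m drift t)).
  move=> tT; have d := is_derive_trmx (dPsiT t tT).
  by apply: (@is_derive_eq _ _ _ _ _ _ _ _ d); rewrite addr0 mulNmx linearN /= trmx_mul trmxK.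
pose Ct t := Psi t *m cpp t *m (Psi t)^T.
have cCt : continuous Ct.
  move=> t; apply: cvg_mulmx; last by apply: cvg_trmx; exact: cPsi.
  by apply: cvg_mulmx; [exact: cPsi | exact: ccpp].
have [M [cM M0 dM]] := linear_ode 0 T0 (c0 n) cCt.
(* Replacing [M] by its symmetric part keeps the derivative, since [Ct t] is symmetric. *)
pose Ms t := 2^-1 *: (M t + (M t)^T).
have PP t : 0 <= t <= T -> Psi t *m Phi t = 1%:M.
  move=> /andP[t0 tT]; apply/matrixP => i j.
  have cPP : continuous (fun t => Psi t *m Phi t).
    by move=> s; apply: cvg_mulmx; [exact: cPsi | exact: cPhi].
  have cij : continuous (fun t => (Psi t *m Phi t) i j).
    by move=> s; have := cPP s; exact: cvg_mx_coord.
  have d (s : R) : 0 < s < T -> is_derive s (1 : R) (fun t => (Psi t *m Phi t) i j) 0.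
    move=> sT; have d := is_derive_coord i j (is_derive_mulmx (dPsi s sT) (dPhi s sT)).
    apply: (@is_derive_eq _ _ _ _ _ _ _ _ d).
    by rewrite addr0 mulNmx mulmxA addrC subrr mxE.
  have sub s : 0 < s < t -> 0 < s < T by move=> /andP[-> /= st]; exact: lt_le_trans tT.
  have h1 := @is_derive_ndecr _ _ (fun=> 0) 0 t t0 cij (fun s st => d s (sub s st)) (fun _ _ => lexx _).
  have cijN : continuous (fun t => - (Psi t *m Phi t) i j) by move=> s; apply: cvgN; exact: cij.
  have dN (s : R) : 0 < s < t -> is_derive s (1 : R) (fun t => - (Psi t *m Phi t) i j) 0.
    move=> st; have d' := is_deriveN (d s (sub s st)).
    by apply: (@is_derive_eq _ _ _ _ _ _ _ _ d'); rewrite oppr0.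
  have h2 := @is_derive_ndecr _ _ (fun=> 0) 0 t t0 cijN dN (fun _ _ => lexx _).
  have e0 : (Psi 0 *m Phi 0) i j = (1%:M : 'M[R]_n) i j by rewrite /Psi PsiT0 Phi0 trmx1 mulmx1.
  apply/eqP; rewrite eq_le -e0 h1 andbT -lerN2; exact: h2.
exists (Phi \o clamp T), (Psi \o clamp T), (z \o clamp T), (Ms \o clamp T); split.
- exact: continuous_clamp_comp.
- exact: continuous_clamp_comp.
- exact: continuous_clamp_comp.
- apply: continuous_clamp_comp => t; apply: cvgZ; first exact: cvg_cst.
  by apply: cvgD; [exact: cM | apply: cvg_trmx; exact: cM].
- by move=> t; apply: PP; exact: clamp_itv.
- by move=> t; rewrite /Ms /= linearZ linearD /= trmxK addrC.
- move=> t tT /=; rewrite clamp_id; last by case/andP: tT => /ltW -> /ltW ->.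
  by apply: is_derive_clamp => //; have := dPhi t tT; rewrite addr0.
- move=> t tT /=; rewrite clamp_id; last by case/andP: tT => /ltW -> /ltW ->.
  by apply: is_derive_clamp => //; exact: dPsi.
- move=> t tT /=; rewrite clamp_id; last by case/andP: tT => /ltW -> /ltW ->.
  by apply: is_derive_clamp => //; exact: dz.
- move=> t tT /=; rewrite clamp_id; last by case/andP: tT => /ltW -> /ltW ->.
  apply: is_derive_clamp => //.
  have d := dM t tT; rewrite mul0mx add0r in d.
  have d2 := is_deriveZ 2^-1 (is_deriveD d (is_derive_trmx d)).
  apply: (@is_derive_eq _ _ _ _ _ _ _ _ d2).
  have [Cs _] := psd_conj (Psi t) (cpp_psd t).
  by rewrite /Ct Cs; apply/matrixP => i j; rewrite [LHS]mxE [X in _ * X]mxE; field.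
Qed.

Variables (Phi Psi : R -> 'M[R]_n) (z : R -> 'cV[R]_n) (M : R -> 'M[R]_n).
Hypothesis ff : flow_frame Phi Psi z M.

Definition frame_speed t := Psi t *m cpp t *m (Psi t)^T.

Definition to_frame (w : R * 'cV[R]_n) : R * 'cV[R]_n :=
  (w.1, Psi w.1 *m w.2 - Psi w.1 *m z w.1).

Definition of_frame (w : R * 'cV[R]_n) : R * 'cV[R]_n := (w.1, Phi w.1 *m w.2 + z w.1).

Lemma PhiPsi t : Phi t *m Psi t = 1%:M.
Proof. exact: mulmx1C (ff_PsiPhi ff t). Qed.

Lemma to_frameK w : of_frame (to_frame w) = w.
Proof.
case: w => t x; rewrite /of_frame /to_frame /=; congr pair.
by rewrite mulmxBr !mulmxA PhiPsi !mul1mx subrK.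
Qed.

Lemma of_frameK w : to_frame (of_frame w) = w.
Proof.
case: w => t x; rewrite /of_frame /to_frame /=; congr pair.
by rewrite mulmxDr !mulmxA (ff_PsiPhi ff) !mul1mx addrK.
Qed.

Lemma continuous_affine (N : R -> 'M[R]_n) (w : R -> 'cV[R]_n) :
  continuous N -> continuous w ->
  continuous (fun u : R * 'cV[R]_n => (u.1, N u.1 *m u.2 + w u.1)).
Proof.
move=> cN cw u.
have c2 : (fun u : R * 'cV[R]_n => N u.1 *m u.2 + w u.1) v @[v --> u] --> N u.1 *m u.2 + w u.1.
  apply: cvgD; last exact: (continuous_comp_fst cw).
  by apply: cvg_mulmx; [exact: (continuous_comp_fst cN) | exact: cvg_snd].
have c1 : (fst : R * 'cV[R]_n -> R) v @[v --> u] --> u.1 by exact: cvg_fst.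
exact: (cvg_pair c1 c2).
Qed.

Lemma continuous_of_frame : continuous of_frame.
Proof. exact: (continuous_affine (ff_cPhi ff) (ff_cz ff)). Qed.

Lemma continuous_to_frame : continuous to_frame.
Proof.
have cw : continuous (fun t => - (Psi t *m z t)).
  by move=> t; apply: cvgN; apply: cvg_mulmx; [exact: (ff_cPsi ff) | exact: (ff_cz ff)].
exact: continuous_affine (ff_cPsi ff) cw.
Qed.

Lemma frame_speed_psd t : possemidef (frame_speed t).
Proof. exact: psd_conj (cpp_psd t). Qed.

Lemma continuous_frame_speed : continuous frame_speed.
Proof.
move=> t; apply: cvg_mulmx; last by apply: cvg_trmx; exact: (ff_cPsi ff).
by apply: cvg_mulmx; [exact: (ff_cPsi ff) | exact: ccpp].
Qed.

Let H (w : R * 'cV[R]_n) p := hamiltonian cpp cxx cxp w.1 w.2 p.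

Variables (v vt : R * 'cV[R]_n -> R).
Hypothesis cv : continuous v.
Hypothesis tv : tfun T v vt (fun w => P w.1 *m w.2 + q w.1).
Hypothesis vH : forall w, vt w = H w (P w.1 *m w.2 + q w.1).

(** A test function for the difference [W - v] in the frame becomes one for [W] after pulling it
    back and adding [v], which is itself C^1. The motion of the frame contributes the transport term
    in the time derivative. *)
Lemma tfun_to_frame phi pt px : tfun T phi pt px ->
  tfun T (fun w => v w + phi (to_frame w))
    (fun w => vt w + (pt (to_frame w) -
       dot ((Psi w.1)^T *m px (to_frame w)) (drift w.1 *m w.2 + force w.1)))
    (fun w => P w.1 *m w.2 + q w.1 + (Psi w.1)^T *m px (to_frame w)).
Proof.
move=> tphi; apply: tfunD tv _.
have dw (t : R) : 0 < t < T ->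
    is_derive t (1 : R) (fun t => - (Psi t *m z t)) (- (Psi t *m force t)).
  move=> tT; have d := is_deriveN (is_derive_mulmx (ff_dPsi ff tT) (ff_dz ff tT)).
  apply: (@is_derive_eq _ _ _ _ _ _ _ _ d).
  by rewrite mulmxDr mulNmx !mulmxA addrA [- _ + _]addrC subrr add0r.
have cN (t : R) : 0 < t < T -> {for t, continuous (fun t => - (Psi t *m drift t))}.
  by move=> _; apply: cvgN; apply: cvg_mulmx; [exact: (ff_cPsi ff) | exact: cdrift].
have cw (t : R) : 0 < t < T -> {for t, continuous (fun t => - (Psi t *m force t))}.
  by move=> _; apply: cvgN; apply: cvg_mulmx; [exact: (ff_cPsi ff) | exact: cforce].
have h := tfun_affine_change (@ff_dPsi _ _ _ _ ff) cN dw cw tphi.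
apply: tfun_ext h _ _ _ => w //=.
by rewrite mulNmx -opprD -mulmxA -mulmxDr dotNr dot_mull.
Qed.

Lemma tfun_of_frame phi pt px : tfun T phi pt px ->
  tfun T (fun w => phi (of_frame w))
    (fun w => pt (of_frame w) + dot (px (of_frame w))
       (drift w.1 *m (of_frame w).2 + force w.1))
    (fun w => (Phi w.1)^T *m px (of_frame w)).
Proof.
move=> tphi.
have cN (t : R) : 0 < t < T -> {for t, continuous (fun t => drift t *m Phi t)}.
  by move=> _; apply: cvg_mulmx; [exact: cdrift | exact: (ff_cPhi ff)].
have cw (t : R) : 0 < t < T -> {for t, continuous (fun t => drift t *m z t + force t)}.
  move=> _; apply: cvgD; last exact: cforce.
  by apply: cvg_mulmx; [exact: cdrift | exact: (ff_cz ff)].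
have h := tfun_affine_change (@ff_dPhi _ _ _ _ ff) cN (@ff_dz _ _ _ _ ff) cw tphi.
apply: tfun_ext h _ _ _ => w //=.
by rewrite mulmxDr !mulmxA addrA.
Qed.

Variable W : R * 'cV[R]_n -> R.
Definition frame_diff (w : R * 'cV[R]_n) := W (of_frame w) - v (of_frame w).

(** Expanding the quadratic Hamiltonian around the gradient [p] of [v], the zeroth-order term
    cancels because [v] solves the equation. The first-order term is minus the pairing of [d] with
    the frame velocity and cancels the transport term, so only the second-order term survives. *)
Let frame_hamiltonian t x p (d : 'cV[R]_n) (a b : R) :
  p = P t *m x + q t -> a = H (t, x) p ->
  - (a + (b - dot d (drift t *m x + force t))) + H (t, x) (p + d) =
  - b + 2^-1 * dot d (cpp t *m d).
Proof.
move=> pE ->; rewrite /H /= hamiltonianD; last by have [] := cpp_psd t.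
rewrite /drift /force pE mulmxBl mulmxDr mulmxA.
rewrite !(dotDr, dotNr); ring.
Qed.

Let eikonal_frame w p : eikonal frame_speed w p =
  2^-1 * dot ((Psi w.1)^T *m p) (cpp w.1 *m ((Psi w.1)^T *m p)).
Proof. by rewrite /eikonal /frame_speed -!mulmxA dot_mull. Qed.

Lemma frame_vsub : vsub T H W -> vsub T (eikonal frame_speed) frame_diff.
Proof.
move=> sW phi pt px tphi w wT mx.
have := sW _ _ _ (tfun_to_frame tphi) (of_frame w) wT.
rewrite of_frameK eikonal_frame.
case: w wT mx => t y /= wT mx.
rewrite (frame_hamiltonian _ _ erefl (vH _)) /=; apply.
have c : to_frame u @[u --> of_frame (t, y)] --> (t, y).
  by rewrite -[X in _ --> X]of_frameK; exact: continuous_to_frame.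
have nu : \forall u \near of_frame (t, y), frame_diff (to_frame u) - phi (to_frame u) <= frame_diff (t, y) - phi (t, y).
  exact: (c _ mx).
apply: filterS nu => u; rewrite /frame_diff !to_frameK /=.
lra.
Qed.

Lemma frame_vsuper : vsuper T H W -> vsuper T (eikonal frame_speed) frame_diff.
Proof.
move=> sW phi pt px tphi w wT mn.
have := sW _ _ _ (tfun_to_frame tphi) (of_frame w) wT.
rewrite of_frameK eikonal_frame.
case: w wT mn => t y /= wT mn.
rewrite (frame_hamiltonian _ _ erefl (vH _)) /=; apply.
have c : to_frame u @[u --> of_frame (t, y)] --> (t, y).
  by rewrite -[X in _ --> X]of_frameK; exact: continuous_to_frame.
have nu : \forall u \near of_frame (t, y), frame_diff (t, y) - phi (t, y) <= frame_diff (to_frame u) - phi (to_frame u).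
  exact: (c _ mn).
apply: filterS nu => u; rewrite /frame_diff !to_frameK /=.
lra.
Qed.

Lemma frame_classical_sub f ft fx : continuous f -> tfun T f ft fx ->
  (forall w, ft w = H w (fx w)) ->
  classical_sub T 0 T frame_speed (fun w => f (of_frame w) - v (of_frame w)).
Proof.
move=> cf tf fH; split.
  have cof (g : R * 'cV[R]_n -> R) : continuous g -> continuous (g \o of_frame).
    by move=> cg w; apply: continuous_comp; [exact: continuous_of_frame | exact: cg].
  by move=> w; apply: cvgB; [exact: (cof _ cf w) | exact: (cof _ cv w)].
have h := tfunD (tfun_of_frame tf) (tfunN (tfun_of_frame tv)).
eexists; eexists; split; first exact: h.
move=> w _; rewrite eikonal_frame -mulmxBr.
set D := _ *m _ + force _; set p := P _ *m _ + q _; set d := fx _ - p.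
have -> : (Psi w.1)^T *m ((Phi w.1)^T *m d) = d.
  by rewrite mulmxA -trmx_mul PhiPsi trmx1 mul1mx.
set b := ft _ + _ - _.
have := frame_hamiltonian d b erefl (vH (of_frame w)).
rewrite -/p -/D [p + d]addrC subrK -[H _ _]fH => e.
have : dot d D = dot (fx (of_frame w)) D - dot p D by rewrite dotDl dotNl.
by move: e; rewrite /b /=; lra.
Qed.

End Frame.

(** * Uniqueness *)

Section MinOrd.
Context {R : realType} {m : nat}.
Variables (hm : (0 < m)%N) (F : 'I_m -> R).

Lemma min_ord_le i : min_ord hm F <= F i.
Proof. by apply: bigmin_le_cond. Qed.

Lemma min_ord_ex : exists i, min_ord hm F = F i.
Proof.
rewrite /min_ord; elim/big_ind : _ => [|x y [i ->] [j ->]|i _].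
- by exists (Ordinal hm).
- by have [_|_] := leP (F i) (F j); [exists i | exists j].
- by exists i.
Qed.

End MinOrd.

Section Uniqueness.
Context {R : realType} {n m : nat}.
Variables (hm : (0 < m)%N) (T : R) (cpp cxx cxp : R -> 'M[R]_n).
Variables (P : 'I_m -> R -> 'M[R]_n) (q : 'I_m -> R -> 'cV[R]_n) (r : 'I_m -> R -> R).
Hypothesis T0 : 0 < T.
Hypothesis ccpp : continuous cpp.
Hypothesis ccxx : continuous cxx.
Hypothesis ccxp : continuous cxp.
Hypothesis cpp_psd : forall t, possemidef (cpp t).
Hypothesis cP : forall i, continuous (P i).
Hypothesis Ps : forall i t, (P i t)^T = P i t.
Hypothesis cq : forall i, continuous (q i).
Hypothesis cr : forall i, continuous (r i).
Let dP i t := (P i t)^T *m cpp t *m P i t - (P i t)^T *m cxp t - (cxp t)^T *m P i t - cxx t.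
Let dq i t := (P i t)^T *m cpp t *m q i t - (cxp t)^T *m q i t.
Let dr i t := 2^-1 * dot (q i t) (cpp t *m q i t).
Hypothesis P_ode : forall i (t : R), 0 < t < T -> is_derive t (1 : R) (P i) (dP i t).
Hypothesis q_ode : forall i (t : R), 0 < t < T -> is_derive t (1 : R) (q i) (dq i t).
Hypothesis r_ode : forall i (t : R), 0 < t < T -> is_derive t (1 : R) (r i) (dr i t).

Let H (w : R * 'cV[R]_n) p := hamiltonian cpp cxx cxp w.1 w.2 p.
Let v i := vquad (P i) (q i) (r i).
Let vt i := vquad (dP i) (dq i) (dr i).
Let vx i (w : R * 'cV[R]_n) := P i w.1 *m w.2 + q i w.1.

Lemma riccati_continuous i : continuous (v i).
Proof. exact: continuous_vquad. Qed.

Lemma riccati_tfun i : tfun T (v i) (vt i) (vx i).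
Proof.
have at_int (U : topologicalType) (f : R -> U) : continuous f ->
    forall t : R, 0 < t < T -> {for t, continuous f} by move=> cf t _; exact: cf.
have cPT : continuous (fun t => (P i t)^T) by move=> t; apply: cvg_trmx; exact: cP.
have cxT : continuous (fun t => (cxp t)^T) by move=> t; apply: cvg_trmx; exact: ccxp.
have cPC : continuous (fun t => (P i t)^T *m cpp t).
  by move=> t; apply: cvg_mulmx; [exact: cPT | exact: ccpp].
apply: (tfun_vquad (Ps i) (P_ode i) _ (q_ode i) _ (r_ode i));
  apply: at_int => t.
- apply: cvgB; last exact: ccxx.
  apply: cvgB; last by apply: cvg_mulmx; [exact: cxT | exact: cP].
  by apply: cvgB; apply: cvg_mulmx; [exact: cPC | exact: cP | exact: cPT | exact: ccxp].
- by apply: cvgB; apply: cvg_mulmx; [exact: cPC | exact: cq | exact: cxT | exact: cq].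
- apply: cvgM; first exact: cvg_cst.
  by apply: cvg_dot; [exact: cq | apply: cvg_mulmx; [exact: ccpp | exact: cq]].
Qed.

Lemma riccati_hamiltonian i w : vt i w = H w (vx i w).
Proof. by rewrite /vt /dP /dq /dr vquad_hamiltonian //; have [] := cpp_psd w.1. Qed.

Variable W : R * 'cV[R]_n -> R.
Hypothesis cW : continuous W.
Hypothesis subW : vsub T H W.
Hypothesis superW : vsuper T H W.
Let V w := min_ord hm (fun i => v i w).
Hypothesis WT : forall x, W (T, x) = V (T, x).

Lemma min_le_solution w : 0 <= w.1 <= T -> V w <= W w.
Proof.
(* Any index can serve as reference. Subtracting [v i0] from [W] and from every [v j] reduces the
   claim to a comparison for the eikonal equation. *)
move=> wT; pose i0 := Ordinal hm.
have [Phi [Psi [z [M ff]]]] := flow_frame_exists T0 ccpp ccxp cpp_psd (@cP i0) (@cq i0).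
have cv0 := @riccati_continuous i0; have tv0 := riccati_tfun i0.
have vH0 := riccati_hamiltonian i0.
pose Z := frame_diff Phi z (v i0) W.
pose f j u := v j (of_frame Phi z u) - v i0 (of_frame Phi z u).
have cof (g : R * 'cV[R]_n -> R) : continuous g -> continuous (g \o of_frame Phi z).
  by move=> cg u; apply: continuous_comp; [exact: (continuous_of_frame ff) | exact: cg].
have cZ : continuous Z.
  by move=> u; apply: cvgB; [exact: (cof _ cW u) | exact: (cof _ cv0 u)].
have subZ := frame_vsub ccpp ccxp cpp_psd (@cP i0) (@cq i0) ff tv0 vH0 subW.
have superZ := frame_vsuper ccpp ccxp cpp_psd (@cP i0) (@cq i0) ff tv0 vH0 superW.
have f_sub j : classical_sub T 0 T (frame_speed cpp Psi) (f j).
  exact: (frame_classical_sub ccpp ccxp cpp_psd (@cP i0) (@cq i0) ff cv0 tv0 vH0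
    (@riccati_continuous j) (riccati_tfun j) (riccati_hamiltonian j)).
have fT y : exists j, f j (T, y) <= Z (T, y).
  have [j Vj] := min_ord_ex hm (fun j => v j (of_frame Phi z (T, y))).
  exists j; rewrite /f /Z /frame_diff lerD2r {2}/of_frame /= WT /V.
  by rewrite -Vj.
have := lower_bound (continuous_frame_speed ccpp ff) (frame_speed_psd cpp_psd Psi)
  (ff_cM ff) (ff_Ms ff) (ff_dM ff) cZ subZ superZ i0 f_sub T0 fT.
move=> /(_ w.1 (to_frame Psi z w).2 wT) [j].
have -> : (w.1, (to_frame Psi z w).2) = to_frame Psi z w by [].
rewrite /f /Z /frame_diff !(to_frameK ff) lerD2r; apply: le_trans.
exact: min_ord_le.
Qed.

Lemma solution_le_quadratic i w : 0 < w.1 < T -> W w <= v i w.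
Proof.
case: w => t x /= /andP[t0 tT].
have [Phi [Psi [z [M ff]]]] := flow_frame_exists T0 ccpp ccxp cpp_psd (@cP i) (@cq i).
have cv0 := @riccati_continuous i; have tv0 := riccati_tfun i.
have vH0 := riccati_hamiltonian i.
pose Z := frame_diff Phi z (v i) W.
have cof (g : R * 'cV[R]_n -> R) : continuous g -> continuous (g \o of_frame Phi z).
  by move=> cg u; apply: continuous_comp; [exact: (continuous_of_frame ff) | exact: cg].
have cZ : continuous Z.
  by move=> u; apply: cvgB; [exact: (cof _ cW u) | exact: (cof _ cv0 u)].
have subZ := frame_vsub ccpp ccxp cpp_psd (@cP i) (@cq i) ff tv0 vH0 subW.
have := sub_curve (continuous_frame_speed ccpp ff) (frame_speed_psd cpp_psd Psi)
  (ff_cM ff) (ff_dM ff) cZ subZ (to_frame Psi z (t, x)).2 0 t0 tT (lexx T).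
have -> : (t, (to_frame Psi z (t, x)).2) = to_frame Psi z (t, x) by [].
rewrite !mulmx0 addr0 dot0r mulr0 addr0 /Z /frame_diff (to_frameK ff) => h.
rewrite -subr_le0 (le_trans h) // subr_le0 {1}/of_frame /= WT.
exact: min_ord_le.
Qed.

Lemma solution_unique w : 0 <= w.1 <= T -> W w = V w.
Proof.
move=> wT; apply/eqP; rewrite eq_le min_le_solution // andbT.
have [i Vi] := min_ord_ex hm (fun i => v i w); rewrite /V {}Vi.
case: w wT => t x /= /andP[t0 tT].
have [->|tneT] := eqVneq t T; first by rewrite WT; exact: min_ord_le.
have tltT : t < T by rewrite lt_neqAle tneT.
have [t00|tgt0] := eqVneq t 0; last first.
  by apply: solution_le_quadratic; rewrite /= tltT andbT lt_neqAle eq_sym tgt0.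
(* The Hopf-Lax inequality starts from positive times; the time 0 is reached by continuity. *)
rewrite t00 -subr_ge0 leNgt; apply/negP => lt0.
have c : {for 0, continuous (fun s : R => v i (s, x) - W (s, x))}.
  have c1 : continuous (fun w => v i w - W w).
    by move=> w; apply: cvgB; [exact: riccati_continuous | exact: cW].
  exact: (continuous_comp (@continuous_pairl R _ x 0) (c1 (0, x))).
have : \forall s \near (0 : R), v i (s, x) - W (s, x) < 0 by exact: (c _ (lt_nbhsl lt0)).
move=> /nbhs_ballP [d /= d0 hd].
pose s := Num.min (d / 2) (T / 2).
have s0 : 0 < s by rewrite lt_min !divr_gt0.
have sd : s <= d / 2 by rewrite ge_min lexx.
have sT : s <= T / 2 by rewrite ge_min lexx orbT.
have : v i (s, x) - W (s, x) < 0.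
  by apply: hd; rewrite -ball_normE /= sub0r normrN ger0_norm; lra.
rewrite subr_lt0 ltNge => /negP; apply; apply: solution_le_quadratic.
by rewrite /= s0; lra.
Qed.

End Uniqueness.

(** * The value function *)

Section RealInduction.
Context {R : realType}.

(** Applied at the supremum of the points where [X] holds, the local step carries [X] from a nearby
    point on the left across the supremum, which is impossible unless the supremum is [b]. *)
Lemma real_induction (X : R -> Prop) (a b : R) : a <= b -> X a ->
  (forall s, a <= s <= b -> exists2 d, 0 < d & forall c e, s - d < c -> c <= s ->
     s <= e -> e < s + d -> a <= c -> e <= b -> X c -> X e) ->
  X b.
Proof.
move=> ab Xa step.
pose S := [set s | a <= s <= b /\ X s].
have Sa : S a by split; rewrite // lexx.
have hS : has_sup S by split; [exists a | exists b => s [/andP[]]].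
have as_ : a <= sup S by apply: sup_upper_bound.
have sb : sup S <= b by apply: ge_sup; [exists a | move=> s [/andP[]]].
have [|d d0 hd] := step (sup S); first by rewrite as_.
have [c [/andP[ac cb] Xc] cd] := sup_adherent d0 hS.
have cs : c <= sup S by apply: sup_upper_bound => //; split=> //; rewrite ac.
have Xe e : sup S <= e -> e < sup S + d -> e <= b -> X e.
  by move=> h1 h2 h3; apply: (hd c e).
have [sltb|] := ltP (sup S) b; last first.
  by move=> bs; apply: Xe => //; rewrite (le_lt_trans bs) // ltrDl.
pose e := Num.min (sup S + d / 2) b.
have Se : S e.
  have es : sup S <= e by rewrite le_min sb andbT; lra.
  have eb : e <= b by rewrite ge_min lexx orbT.
  have ed : e <= sup S + d / 2 by rewrite ge_min lexx.
  split; first by rewrite eb (le_trans as_).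
  by apply: Xe => //; lra.
have := sup_upper_bound hS Se; rewrite ge_min => /orP[]; lra.
Qed.

Lemma is_derive_near_ge (h : R -> R) (s d e : R) : is_derive s (1 : R) h d -> 0 <= d -> 0 < e ->
  exists2 del, 0 < del & forall t, `|t - s| < del ->
    (s <= t -> h s - e * (t - s) <= h t) /\ (t <= s -> h t - e * (s - t) <= h s).
Proof.
move=> dh d0 e0.
have hd : u^-1 *: ((h \o shift s) (u *: 1) - h s) @[u --> (0 : R)^'] --> d.
  by have [ex <-] := dh; exact: ex.
have lt : - e < d by apply: lt_le_trans d0; rewrite oppr_lt0.
have : \forall u \near (0 : R)^', - e < u^-1 *: ((h \o shift s) (u *: 1) - h s).
  exact: (cvgr_gt d hd _ lt).
rewrite near_withinE => /nbhs_ballP [del /= del0 hdel].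
exists del => // t ts.
have [->|tns] := eqVneq t s; first by rewrite subrr mulr0 subr0.
have := hdel (t - s); rewrite -ball_normE /= sub0r normrN => /(_ ts).
rewrite subr_eq0 => /(_ tns); rewrite /GRing.scale /= mulr1 subrK => q.
split=> h1.
  have t0 : 0 < t - s by rewrite subr_gt0 lt_neqAle eq_sym tns.
  have : (t - s) * - e <= (t - s) * ((t - s)^-1 * (h t - h s)) by rewrite ler_pM2l // ltW.
  rewrite mulVKf ?gt_eqF //; lra.
have t0 : 0 < s - t by rewrite subr_gt0 lt_neqAle tns.
have : (s - t) * - e <= (s - t) * ((t - s)^-1 * (h t - h s)) by rewrite ler_pM2l // ltW.
have -> : (s - t) * ((t - s)^-1 * (h t - h s)) = h s - h t by field; rewrite subr_eq0.
lra.
Qed.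

Variables (n : nat) (a b K : R) (x : R -> 'cV[R]_n) (f G : R -> R).
Hypothesis ab : a <= b.
Hypothesis K0 : 0 <= K.
Hypothesis acx : abs_continuous a b x.
Hypothesis f_lip : forall c d, a <= c -> c <= d -> d <= b ->
  `|f d - f c| <= K * ((d - c) + `|x d - x c|).
Hypothesis G_ndecr : forall c d, a <= c -> c <= d -> d <= b -> G c <= G d.
Hypothesis fG_ae : {ae lebesgue_measure, forall s : R, s \in `]a, b[ ->
  exists2 d : R, 0 <= d & is_derive s (1 : R) (fun s => f s + G s) d}.

(* Real induction along [a, b]: away from an open set [U] of small measure
   containing the exceptional points, the sum decreases at most at rate [e]; across
   an interval contained in [U] it loses at most the oscillation of [f], which
   absolute continuity controls. *)
Lemma ac_monotone : f a + G a <= f b + G b.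
Proof.
pose h s := f s + G s.
have aux (S ha hb u w : R) : S <= w -> ha - u - S <= hb -> ha - (u + w) <= hb by lra.
suff key e : 0 < e -> h a - (e * (b - a) + K * (e + e)) <= h b.
  apply/ler_addgt0Pr => e e0.
  pose c := b - a + 2 * K + 1; have c0 : 0 < c by move: ab K0; rewrite /c; lra.
  have := key (e / c); rewrite divr_gt0 // => /(_ isT).
  have : e / c * c = e by rewrite divfK ?gt_eqF.
  have : 0 < e / c by rewrite divr_gt0.
  have : e / c * c = e / c * (b - a) + K * (e / c + e / c) + e / c by rewrite {2}/c; ring.
  by rewrite /h; lra.
move=> e0.
have [d1 d10 hd1] := acx e0.
(* A total length below [d1] keeps the variation of [x] below [e]; a total length below [e] controls
   the time part of the Lipschitz bound. *)
pose del := Num.min d1 e; have del0 : 0 < del by rewrite lt_min d10.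
have [N0 [mN0 N00 badN0]] := fG_ae.
(* The end points are treated as exceptional, since the derivative is prescribed only in the open
   interval. *)
pose N := N0 `|` [set a; b].
have mab : measurable [set a; b] by apply: measurableU; exact: measurable_set1.
have mN : measurable N by exact: measurableU.
have N_0 : lebesgue_measure N = 0%E.
  apply/(negligibleP _ mN); apply: negligibleU.
    by exists N0; split; [exact: mN0 | exact: N00 | exact: subset_refl].
  have n1 (c : R) : lebesgue_measure.-negligible [set c].
    by apply/negligibleP; [exact: measurable_set1 | exact: lebesgue_measure_set1].
  exact: negligibleU.
have Nfin : (lebesgue_measure N < +oo)%E by rewrite N_0 ltry.
have [U [oU NU Ulam]] := lebesgue_regularity_outer mN Nfin del0.
have mU : measurable U by exact: measurable_realfun.open_measurable.
have Usmall : (lebesgue_measure U < del%:E)%E.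
  have mUN : measurable (U `\` N) by exact: measurableD.
  apply: (@le_lt_trans _ _ (lebesgue_measure ((U `\` N) `|` N))).
    apply: le_measure; rewrite ?inE //; first exact: measurableU.
    by move=> u Uu; have [Nu|nNu] := pselect (N u); [right | left].
  apply: le_lt_trans (measureU2 _ _ _) _ => //.
  have -> : (lebesgue_measure (U `\` N) + lebesgue_measure N =
      lebesgue_measure (U `\` N))%E by rewrite N_0 adde0.
  exact: Ulam.
have {Ulam} good s : a <= s <= b -> ~ U s ->
    exists2 d, 0 <= d & is_derive s (1 : R) h d.
  move=> /andP[as_ sb] nU.
  have [//|ns] := pselect (exists2 d, 0 <= d & is_derive s (1 : R) h d).
  exfalso; apply: nU; apply: NU.
  have [->|sa] := eqVneq s a; first by right; left.
  have [->|sb'] := eqVneq s b; first by right; right.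
  left; apply: badN0 => /= hs; apply: ns; apply: hs.
  by rewrite in_itv /= !lt_neqAle eq_sym sa as_ sb' sb.
(* The invariant records the finitely many pieces crossed inside [U]. Bounding their total length by
   the measure of [U] to the left of [s], and not by a sum of local bounds, makes the final estimate
   independent of their number. *)
pose X s := exists N (al be : nat -> R),
  [/\ forall k, (k < N)%N -> [/\ a <= al k, al k <= be k & be k <= s],
      forall j k, (j < k)%N -> (k < N)%N -> be j <= al k,
      ((\sum_(k < N) (be k - al k))%:E <= lebesgue_measure (U `&` `]-oo, s[%classic))%E
    & h a - e * (s - a) - \sum_(k < N) `|f (be k) - f (al k)| <= h s].
have Xb : X b.
  apply: (real_induction ab).
    exists 0, (fun=> 0), (fun=> 0); split=> //.
      by rewrite big_ord0.
    by rewrite big_ord0 subrr mulr0 !subr0.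
  move=> s sab; have [Us|nUs] := pselect (U s).
    have /nbhs_ballP [d /= d0 hd] := open_nbhs_nbhs (conj oU Us).
    exists d => // c t sc cs st tsd ac tb [M [al [be [h1 h2 h3 h4]]]].
    have ctU : `]c, t[ `<=` U.
      move=> u /=; rewrite in_itv /= => /andP[cu ut]; apply: hd.
      by rewrite -ball_normE /= ltr_norml; lra.
    have ct : c <= t by exact: le_trans st.
    (* As [G] is nondecreasing, only [f] can make [h] drop from [c] to [t]. The drop is charged to
       the new last interval, which lies inside [U]. *)
    exists M.+1, (fun k => if (k == M)%N then c else al k), (fun k => if (k == M)%N then t else be k).
    have neq k : (k < M)%N -> (k == M)%N = false by move=> kM; apply: ltn_eqF.
    split.
    - move=> k; rewrite ltnS leq_eqVlt => /orP[/eqP ->|kM]; first by rewrite eqxx.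
      rewrite neq //; have [k1 k2 k3] := h1 k kM; split=> //.
      by rewrite (le_trans k3) // (le_trans cs).
    - move=> j k jk; rewrite ltnS leq_eqVlt => /orP[/eqP kM|kM].
        have jM : (j < M)%N by rewrite -kM.
        by rewrite kM eqxx neq //; have [_ _ bj] := h1 j jM.
      by rewrite !neq //; [exact: h2 | exact: ltn_trans kM].
    - rewrite big_ord_recr /= eqxx.
      have -> : \sum_(i < M) ((if (i == M :> nat) then t else be i) - (if (i == M :> nat) then c else al i)) =
          \sum_(i < M) (be i - al i) by apply: eq_bigr => i _; rewrite neq.
      have sub : (U `&` `]-oo, c[) `|` `]c, t[ `<=` U `&` `]-oo, t[.
        move=> u [[Uu]|uct]; rewrite /= !in_itv /=.
          by move=> uc; split=> //; exact: lt_le_trans ct.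
        by split; [exact: ctU | move: uct; rewrite /= in_itv /= => /andP[]].
      have m1 : measurable (U `&` `]-oo, c[) by exact: measurableI.
      apply: (@le_trans _ _ (lebesgue_measure ((U `&` `]-oo, c[) `|` `]c, t[))); last first.
        by apply: le_measure => //; rewrite inE; [exact: measurableU | exact: measurableI].
      rewrite measureU //; last first.
        rewrite -subset0 => u [[_]] /=; rewrite !in_itv /= => uc /andP[cu _].
        by have := lt_trans uc cu; rewrite ltxx.
      have l : ((t - c)%:E <= lebesgue_measure (`]c, t[%classic : set R))%E.
        rewrite lebesgue_measure_itv /= lte_fin.
        have [_|tc] := ltP c t; first by rewrite EFinD.
        by rewrite lee_fin subr_le0.
      by rewrite EFinD; apply: leeD; [exact: h3 | exact: l].
    - rewrite big_ord_recr /= eqxx.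
      have -> : \sum_(i < M) `|f (if (i == M :> nat) then t else be i) - f (if (i == M :> nat) then c else al i)| =
          \sum_(i < M) `|f (be i) - f (al i)| by apply: eq_bigr => i _; rewrite neq.
      have := G_ndecr ac ct tb; have := ler_norm (f c - f t); rewrite distrC => n1 n2.
      have : e * (c - a) <= e * (t - a) by rewrite ler_pM2l // lerD2r.
      by move: h4; rewrite /h; lra.
  have [d d0 dh] := good s sab nUs.
  have [del1 del10 hdel] := is_derive_near_ge dh d0 e0.
  exists del1 => // c t sc cs st tsd ac tb [M [al [be [h1 h2 h3 h4]]]].
  exists M, al, be; split=> //.
  - by move=> k kM; have [k1 k2 k3] := h1 k kM; split=> //; rewrite (le_trans k3) // (le_trans cs).
  - apply: le_trans h3 _; apply: le_measure; rewrite ?inE; try exact: measurableI.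
    move=> u [Uu]; rewrite /= !in_itv /= => uc; split=> //.
    by rewrite (lt_le_trans uc) // (le_trans cs).
  - have [|_ hc] := hdel c; first by rewrite ltr_norml; lra.
    have [|ht _] := hdel t; first by rewrite ltr_norml; lra.
    have := hc cs; have := ht st; nra.
have [M [al [be [h1 h2 h3 h4]]]] := Xb.
have sumlt : \sum_(k < M) (be k - al k) < del.
  rewrite -lte_fin; apply: le_lt_trans h3 _; apply: le_lt_trans Usmall.
  by apply: le_measure; rewrite ?inE //; exact: measurableI.
have /hd1 : forall k : 'I_M, [/\ a <= al k, al k <= be k & be k <= b] by move=> k; exact: h1.
move=> /(_ _ (lt_le_trans sumlt _)).
have triv : trivIset setT (fun k : 'I_M => `]al k, be k[%classic).
  apply/trivIsetP => i j _ _ ij; rewrite -subset0 => u [] /=; rewrite !in_itv /=.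
  move=> /andP[i1 i2] /andP[j1 j2].
  have [lt|gt|eq] := ltngtP i j.
  - by have := h2 i j lt (ltn_ord j); rewrite leNgt (lt_trans j1 i2).
  - by have := h2 j i gt (ltn_ord i); rewrite leNgt (lt_trans i1 j2).
  - by move/eqP: ij; apply; exact: val_inj.
move=> /(_ triv); rewrite ge_min lexx => /(_ isT) sumx.
have : \sum_(k < M) `|f (be k) - f (al k)| <= K * (e + e); last first.
  by move=> hS; exact: aux hS h4.
have : \sum_(k < M) `|f (be k) - f (al k)| <=
    \sum_(k < M) (K * ((be k - al k) + `|x (be k) - x (al k)|)).
  by apply: ler_sum => k _; have [k1 k2 k3] := h1 k (ltn_ord k); exact: f_lip.
rewrite -mulr_sumr big_split /= => hs; apply: le_trans hs _.
apply: ler_wpM2l => //; apply: lerD; last exact: ltW.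
by apply: (le_trans (ltW sumlt)); rewrite ge_min lexx orbT.
Qed.

End RealInduction.

(** * Lower bound on the cost of an admissible pair *)

Section Verification.
Context {R : realType} {n l : nat}.
Variables (T : R) (A : R -> 'M[R]_n) (B S : R -> 'M[R]_(n, l)) (Q : R -> 'M[R]_n).
Variable Rw : R -> 'M[R]_l.
Hypothesis T0 : 0 < T.
Hypothesis cA : continuous A.
Hypothesis cB : continuous B.
Hypothesis cS : continuous S.
Hypothesis cQ : continuous Q.
Hypothesis cRw : continuous Rw.
Hypothesis Rw_posdef : forall t, posdef (Rw t).
Hypothesis Cxx_posdef : forall t, posdef (Cxx Q S Rw t).

Definition running_cost (t : R) (x : 'cV[R]_n) (u : 'cV[R]_l) : R :=
  2^-1 * dot x (Q t *m x) + 2^-1 * dot u (Rw t *m u) + dot x (S t *m u).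

Lemma posdef_psd k (M : 'M[R]_k) : posdef M -> possemidef M.
Proof.
move=> [MT M0]; split=> // x; have [->|x0] := eqVneq x 0; first by rewrite dot0l.
exact/ltW/M0.
Qed.

Lemma posdef_unit k (M : 'M[R]_k) : posdef M -> M \in unitmx.
Proof.
move=> [MT M0]; rewrite -row_free_unit -kermx_eq0; apply/eqP/row_matrixP => i.
rewrite row0; set u := row i _; apply/eqP; apply/negPn/negP => u0.
have uM : u *m M = 0 by rewrite -row_mul mulmx_ker row0.
have := M0 u^T; rewrite trmx_eq0 => /(_ u0).
have -> : M *m u^T = 0 by apply: trmx_inj; rewrite trmx_mul trmxK MT uM trmx0.
by rewrite dot0r ltxx.
Qed.

(** The map [u |-> L(t, x, u) + p . (A x + B u)] is minimal at [u = - R^-1 (B^T p + S^T x)], with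
    minimum [- H(t, x, p)]; [w] is the deviation from this minimiser. *)
Lemma completion_of_squares t x u p :
  let w := u + invmx (Rw t) *m ((B t)^T *m p + (S t)^T *m x) in
  running_cost t x u + hamiltonian (Cpp B Rw) (Cxx Q S Rw) (Cxp A B S Rw) t x p
    + dot p (A t *m x + B t *m u) = 2^-1 * dot w (Rw t *m w).
Proof.
have [RT _] := Rw_posdef t; have Ru := posdef_unit (Rw_posdef t).
have RiT : (invmx (Rw t))^T = invmx (Rw t) by rewrite trmx_inv RT.
set g := (B t)^T *m p + (S t)^T *m x; have gE : (B t)^T *m p + (S t)^T *m x = g by [].
clearbody g => w; rewrite /w mulmxDr mulmxA mulmxV // mul1mx !(dotDl, dotDr).
have -> : dot (invmx (Rw t) *m g) (Rw t *m u) = dot u g.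
  by rewrite dot_mull RT mulmxA mulmxV // mul1mx dotC.
have -> : dot (invmx (Rw t) *m g) g = dot g (invmx (Rw t) *m g) by rewrite dotC.
rewrite /running_cost /hamiltonian /Cpp /Cxx /Cxp !mulmxBl !(dotDr, dotNr).
have eg : dot g (invmx (Rw t) *m g) = dot p (B t *m invmx (Rw t) *m (B t)^T *m p) +
    2 * dot p (B t *m invmx (Rw t) *m (S t)^T *m x) + dot x (S t *m invmx (Rw t) *m (S t)^T *m x).
  have m1 (N N' : 'M[R]_(n, l)) (y h : 'cV[R]_n) : dot (N^T *m y) (invmx (Rw t) *m (N'^T *m h)) =
      dot y (N *m invmx (Rw t) *m N'^T *m h) by rewrite -!mulmxA [RHS]dot_mull.
  rewrite -gE mulmxDr !(dotDl, dotDr) !m1.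
  have -> : dot x (S t *m invmx (Rw t) *m (B t)^T *m p) =
      dot p (B t *m invmx (Rw t) *m (S t)^T *m x).
    by rewrite dot_mull !trmx_mul trmxK RiT mulmxA dotC.
  by ring.
rewrite eg.
have -> : dot u g = dot p (B t *m u) + dot x (S t *m u).
  by rewrite -gE dotDr !(dotC u) -[X in dot (X *m _)]trmxK -[X in _ + dot (X *m _) _]trmxK -!dot_mull !trmxK.
by field.
Qed.

(** For [p = 0] the completed square writes the running cost as [1/2 w . R w + 1/2 x . Cxx x]. Its
    sign makes the accumulated cost monotone and reduces integrability to finiteness of the
    integral. *)
Lemma running_cost_ge0 t x u : 0 <= running_cost t x u.
Proof.
have := @completion_of_squares t x u 0; rewrite dot0l addr0 /hamiltonian !dot0l mulr0 subr0 sub0r.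
set w := u + _ => /= e.
have h1 : 0 <= dot w (Rw t *m w) by exact: (posdef_psd (Rw_posdef t)).2.
have h2 : 0 <= dot x (Cxx Q S Rw t *m x) by exact: (posdef_psd (Cxx_posdef t)).2.
lra.
Qed.

Lemma running_cost_measurable (D : set R) (x : R -> 'cV[R]_n) (u : R -> 'cV[R]_l) :
  (forall i, measurable_fun D (fun s => x s i ord0)) ->
  (forall i, measurable_fun D (fun s => u s i ord0)) ->
  measurable_fun D (fun s => running_cost s (x s) (u s)).
Proof.
move=> mx mu.
have mdot k j (N : R -> 'M[R]_(k, j)) (y : R -> 'cV[R]_k) (z : R -> 'cV[R]_j) :
    continuous N -> (forall i, measurable_fun D (fun s => y s i ord0)) ->
    (forall i, measurable_fun D (fun s => z s i ord0)) ->
    measurable_fun D (fun s => dot (y s) (N s *m z s)).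
  move=> cN my mz; under eq_fun do rewrite dotE.
  apply: measurable_sum => i; apply: measurable_funM => //.
  under eq_fun do rewrite mxE; apply: measurable_sum => i'; apply: measurable_funM => //.
  apply: measurable_funTS; apply: continuous_measurable_fun.
  by move=> s; have := cN s; exact: cvg_mx_coord.
apply: measurable_funD; last exact: mdot.
by apply: measurable_funD; apply: measurable_funM => //; exact: mdot.
Qed.

Variables (P : R -> 'M[R]_n) (q : R -> 'cV[R]_n) (v vt : R * 'cV[R]_n -> R).
Hypothesis cP : continuous P.
Hypothesis cq : continuous q.
Hypothesis cv : continuous v.
Hypothesis cvt : continuous vt.
Hypothesis tv : tfun T v vt (fun w => P w.1 *m w.2 + q w.1).
Hypothesis vH : forall w, vt w =
  hamiltonian (Cpp B Rw) (Cxx Q S Rw) (Cxp A B S Rw) w.1 w.2 (P w.1 *m w.2 + q w.1).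

Lemma is_derive_along (x : R -> 'cV[R]_n) dx (s : R) : 0 < s < T -> is_derive s (1 : R) x dx ->
  is_derive s (1 : R) (fun s => v (s, x s)) (vt (s, x s) + dot (P s *m x s + q s) dx).
Proof.
move=> sT hx; have [dv _ _] := tfunP tv (z := (s, x s)) sT.
have xd : is_diff s x (fun h => h *: dx).
  apply: DiffDef; first exact/derivable1_diffP/ex_derive.
  by rewrite deriv1E ?derive1E ?derive_val //; exact: ex_derive.
have id1 : is_diff s (fun u : R => u) id by exact: is_diff_id.
have := @is_diff_comp _ _ _ _ _ _ _ _ _ (is_diff_pair id1 xd) dv => -[d1 d2].
apply: DeriveDef; first exact: diff_derivable.
rewrite deriveE //; have := congr1 (fun f : R -> R => f 1) d2; rewrite /= => ->.
by rewrite mulr1 scale1r.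
Qed.

Lemma abs_continuous_bounded (x : R -> 'cV[R]_n) (a b : R) : a <= b ->
  abs_continuous a b x -> exists C, 0 < C /\ forall s, a <= s <= b -> `|x s| <= C.
Proof.
move=> ab ac.
have uc e : 0 < e -> exists2 d, 0 < d & forall s t, a <= s -> s <= t -> t <= b ->
    t - s < d -> `|x t - x s| < e.
  move=> e0; have [d d0 hd] := ac e e0; exists d => // s t as_ st tb std.
  have := hd 1 (fun=> s) (fun=> t); rewrite !big_ord1; apply => //.
  by apply/trivIsetP => i j _ _; rewrite !ord1 eqxx.
have cx : {within `[a, b], continuous (fun s => `|x s|)}.
  apply/subspace_continuousP => s; rewrite /= in_itv /= => /andP[as_ sb].
  apply: cvg_norm; apply/cvgrPdist_lt => e e0; have [d d0 hd] := uc e e0.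
  rewrite near_withinE; apply/nbhs_ballP; exists d => // t.
  rewrite -ball_normE /= in_itv /= => std /andP[at_ tb].
  have [st|/ltW ts] := leP s t.
    by rewrite distrC; apply: hd => //; move: std; rewrite ltr_norml => /andP[]; lra.
  by apply: hd => //; move: std; rewrite ltr_norml => /andP[]; lra.
have [c _ hc] := EVT_max ab cx.
exists (`|x c| + 1); split; first by rewrite ltr_wpDl.
by move=> s sab; have := hc s; rewrite in_itv /= => /(_ sab); lra.
Qed.

(** The trajectory may fail to be differentiable, so the mean value theorem is applied to [v] along
    the chord from [(c, x c)] to [(d, x d)], which stays in the same ball by convexity of the
    norm. *)
Lemma lipschitz_along (x : R -> 'cV[R]_n) (a C : R) : 0 <= a -> 0 < C ->
  (forall s, a <= s <= T -> `|x s| <= C) ->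
  exists K, 0 <= K /\ forall c d, a <= c -> c <= d -> d <= T ->
    `|v (d, x d) - v (c, x c)| <= K * ((d - c) + `|x d - x c|).
Proof.
move=> a0 C0 xC.
have cg : continuous (fun w : R * 'cV[R]_n => `|P w.1 *m w.2 + q w.1|).
  move=> w; apply: cvg_norm; apply: cvgD; last exact: (continuous_comp_fst cq).
  by apply: cvg_mulmx; [exact: (continuous_comp_fst cP) | exact: cvg_snd].
have [K1 [K10 hK1]] := cylinder_bound 0 T C cvt.
have [K2 [K20 hK2]] := cylinder_bound 0 T C cg.
exists (K1 + n%:R * K2); split; first by rewrite addr_ge0 ?mulr_ge0 // ltW.
move=> c d ac cd dT; have c0 : 0 <= c by exact: le_trans ac.
have xc : `|x c| <= C by apply: xC; rewrite ac (le_trans cd).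
have xd : `|x d| <= C by apply: xC; rewrite dT (le_trans ac).
have [->|cned] := eqVneq c d; first by rewrite !subrr !normr0 addr0 mulr0.
have cltd : c < d by rewrite lt_neqAle cned.
have dc0 : 0 < d - c by rewrite subr_gt0.
pose slope := (d - c)^-1 *: (x d - x c).
pose y s := x c + (s - c) *: slope.
have yc : y c = x c by rewrite /y subrr scale0r addr0.
have yd : y d = x d by rewrite /y scalerA divff ?gt_eqF // scale1r addrC subrK.
have dy s : is_derive s (1 : R) y slope.
  have d1 : is_derive s (1 : R) (fun s : R => s - c) (1 - 0).
    exact: is_deriveB (is_derive_id s (1 : R)) (is_derive_cst c s 1).
  have d2 : is_derive s (1 : R) (fun s : R => (s - c) *: slope) slope.
    apply: is_derive_mx => i j.
    have -> : (fun s : R => ((s - c) *: slope) i j) = (slope i j \*: (fun s : R => s - c)).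
      by apply/funext => u; rewrite mxE mulrC.
    apply: (@is_derive_eq _ _ _ _ _ _ _ _ (is_deriveZ (slope i j) d1)).
    by rewrite /GRing.scale /= subr0 mulr1.
  have d3 := is_deriveD (is_derive_cst (x c) s (1 : R)) d2.
  by apply: (@is_derive_eq _ _ _ _ _ _ _ _ d3); rewrite add0r.
have aux (th u w : R) : 0 <= th -> th <= 1 -> u <= C -> w <= C -> (1 - th) * u + th * w <= C.
  move=> h0 h1 uC wC; have h1' : 0 <= 1 - th by lra.
  have := ler_wpM2l h0 wC; have := ler_wpM2l h1' uC; lra.
have yC s : c <= s <= d -> `|y s| <= C.
  move=> /andP[cs sd]; pose th := (s - c) / (d - c).
  have th0 : 0 <= th by rewrite divr_ge0 ?subr_ge0 // ltW.
  have th1 : th <= 1 by rewrite ler_pdivrMr // mul1r lerD2r.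
  have -> : y s = (1 - th) *: x c + th *: x d.
    by rewrite /y /slope scalerA -/th scalerBr scalerBl scale1r addrCA [RHS]addrC addrA.
  have n1 : `|th *: x d| = th * `|x d| by rewrite normrZ ger0_norm.
  have n2 : `|(1 - th) *: x c| = (1 - th) * `|x c| by rewrite normrZ ger0_norm // subr_ge0.
  apply: le_trans (ler_normD _ _) _; rewrite n1 n2.
  exact: aux.
have cy : continuous y.
  move=> s; have := dy s => -[e _]; apply: differentiable_continuous.
  exact/derivable1_diffP.
have cf : {within `[c, d], continuous (fun s => v (s, y s))}.
  have cg' : continuous (fun s : R => (s, y s)).
    move=> s; have c0' : (fun u : R => u) u @[u --> s] --> s by exact: cvg_id.
    exact: (cvg_pair c0' (cy s)).
  have cc : continuous (v \o (fun s : R => (s, y s))).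
    by move=> s; apply: continuous_comp; [exact: cg' | exact: cv].
  exact: continuous_subspaceT.
have df s : s \in `]c, d[ -> is_derive s (1 : R) (fun s => v (s, y s))
    (vt (s, y s) + dot (P s *m y s + q s) slope).
  rewrite in_itv /= => /andP[cs sd]; apply: is_derive_along => //.
  by rewrite (le_lt_trans c0 cs) (lt_le_trans sd).
have [s] := MVT cltd df cf; rewrite in_itv /= => /andP[cs sd].
rewrite yc yd => ->; rewrite normrM (ger0_norm (ltW dc0)).
have scd : c <= s <= d by rewrite !ltW.
have sT : 0 <= s <= T.
  by apply/andP; split; [exact: le_trans c0 (ltW cs) | exact: le_trans (ltW sd) dT].
have b1 : `|vt (s, y s)| <= K1 by apply: hK1 => //=; exact: yC.
have b2 : `|P s *m y s + q s| <= K2.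
  by have := hK2 (s, y s) sT (yC _ scd); rewrite /= normr_id.
have b3 : `|dot (P s *m y s + q s) slope| * (d - c) <= n%:R * K2 * `|x d - x c|.
  apply: (@le_trans _ _ (n%:R * K2 * `|slope| * (d - c))).
    rewrite ler_wpM2r ?(ltW dc0) // (le_trans (norm_dot _ _)) // ler_wpM2r //.
    by rewrite ler_wpM2l.
  rewrite /slope normrZ gtr0_norm ?invr_gt0 //.
  by rewrite -!mulrA [_ * (d - c)]mulrC mulKf ?gt_eqF.
have b4 := ler_wpM2r (ltW dc0) b1.
have b5 := ler_wpM2r (ltW dc0) (ler_normD (vt (s, y s)) (dot (P s *m y s + q s) slope)).
apply: (le_trans b5); rewrite mulrDl [leRHS]mulrDr !mulrDl.
have : 0 <= n%:R * K2 * (d - c) by rewrite !mulr_ge0 // ltW.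
have : 0 <= K1 * `|x d - x c| by rewrite mulr_ge0 // ltW.
lra.
Qed.

Lemma verification (t0 : R) (x0 : 'cV[R]_n) (x : R -> 'cV[R]_n) (u : R -> 'cV[R]_l) :
  0 <= t0 <= T -> admissible A B T t0 x0 x u ->
  ((v (t0, x0))%:E <= \int[lebesgue_measure]_(s in `]t0, T[) (running_cost s (x s) (u s))%:E
     + (v (T, x T))%:E)%E.
Proof.
move=> /andP[t00 t0T] [[mx _] [mu _] acx dx xt0].
pose L s := running_cost s (x s) (u s).
have mL : measurable_fun `]t0, T[ L by exact: running_cost_measurable.
have L0 s : 0 <= L s by exact: running_cost_ge0.
(* An infinite cost bounds everything; otherwise the nonnegative running cost is integrable. *)
have [-> //|foo] := eqVneq (\int[lebesgue_measure]_(s in `]t0, T[) (L s)%:E)%E +oo%E.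
  by rewrite addye // leey.
have intL : lebesgue_measure.-integrable `]t0, T[ (EFin \o L).
  apply/integrableP; split; first exact/measurable_EFinP.
  under eq_integral => s _ do rewrite /= ger0_norm //.
  by rewrite ltey.
pose Lt := L \_ `]t0, T[.
have Lt0 s : 0 <= Lt s by rewrite /Lt patchE; case: ifP.
have intLt : lebesgue_measure.-integrable setT (EFin \o Lt).
  by have := intL; rewrite integrable_mkcond //= restrict_EFin.
(* The accumulated cost. The integrand is only integrable, so [G] has derivative [L] just almost
   everywhere; but [G] is nondecreasing, which is what the monotonicity argument asks of its second
   summand. *)
pose G y := (\int[lebesgue_measure]_(s in `]-oo, y]) Lt s)%R.
have intLty y : lebesgue_measure.-integrable `]-oo, y] (EFin \o Lt).
  by apply: integrableS intLt.
have Gfin y : (G y)%:E = (\int[lebesgue_measure]_(s in `]-oo, y]) (Lt s)%:E)%E.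
  by rewrite /G /Rintegral fineK //; exact: integrable_fin_num.
have mLt : measurable_fun setT (EFin \o Lt) by have /integrableP[] := intLt.
have Gnd c d : c <= d -> G c <= G d.
  move=> cd; rewrite -lee_fin !Gfin; apply: ge0_subset_integral => //.
  - exact: measurable_funTS.
  - by move=> s _; rewrite lee_fin.
  - by move=> s; rewrite /= !in_itv /= => /le_trans; apply.
have GT : ((G T)%:E <= \int[lebesgue_measure]_(s in `]t0, T[) (L s)%:E)%E.
  rewrite Gfin; apply: (@le_trans _ _ (\int[lebesgue_measure]_s (Lt s)%:E)%E).
    by apply: ge0_subset_integral => // s _; rewrite lee_fin.
  rewrite [leRHS]integral_mkcond le_eqVlt; apply/orP; left; apply/eqP.
  by apply: eq_integral => s _; rewrite /Lt !patchE; case: ifP.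
have G0 : 0 <= G t0 by apply: Rintegral_ge0.
have [C [C0 xC]] := abs_continuous_bounded t0T acx.
have [K [K0 fK]] := lipschitz_along t00 C0 xC.
have GF := FTC1Ny intLty (open_integrable_locally openT intLt).
have ae : {ae lebesgue_measure, forall s : R, s \in `]t0, T[ ->
    exists2 d : R, 0 <= d & is_derive s (1 : R) (fun s => v (s, x s) + G s) d}.
  move: dx GF; apply: filterS2; first exact: (ae_filter_ringOfSetsType lebesgue_measure).
  move=> s hs [G1 G2] st.
  have hx := hs st; move: (st); rewrite in_itv /= => /andP[ts sT].
  have sT' : 0 < s < T by rewrite (le_lt_trans t00 ts).
  have d1 := is_derive_along sT' hx.
  have d2 : is_derive s (1 : R) G (L s).
    apply: DeriveDef => //; rewrite -derive1E G2 /Lt patchE mem_set //.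
  eexists; last exact: is_deriveD d1 d2.
  have := completion_of_squares s (x s) (u s) (P s *m x s + q s).
  set w := u s + _ => /= e.
  have := (posdef_psd (Rw_posdef s)).2 w; rewrite vH /= /L; lra.
have := ac_monotone t0T K0 acx fK (fun c d _ cd _ => Gnd c d cd) ae.
rewrite xt0 => h.
apply: (@le_trans _ _ ((G T)%:E + (v (T, x T))%:E)%E); last exact: leeD.
by rewrite -EFinD lee_fin; lra.
Qed.

End Verification.

(** * The optimal feedback control *)

Section Feedback.
Context {R : realType} {n l : nat}.
Variables (T : R) (A : R -> 'M[R]_n) (B S : R -> 'M[R]_(n, l)) (Q : R -> 'M[R]_n).
Variable Rw : R -> 'M[R]_l.
Hypothesis T0 : 0 < T.
Hypothesis cA : continuous A.
Hypothesis cB : continuous B.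
Hypothesis cS : continuous S.
Hypothesis cQ : continuous Q.
Hypothesis cRw : continuous Rw.
Hypothesis Rw_posdef : forall t, posdef (Rw t).

Let continuous_inv : continuous (fun t => invmx (Rw t)).
Proof.
move=> t; apply: cvg_invmx; [move=> s | | exact: cRw]; exact: posdef_unit (Rw_posdef _).
Qed.

Let continuous_tr k j (N : R -> 'M[R]_(k, j)) : continuous N -> continuous (fun t => (N t)^T).
Proof. by move=> cN t; apply: cvg_trmx; exact: cN. Qed.

Let continuous_mul i j k (N : R -> 'M[R]_(i, j)) (N' : R -> 'M[R]_(j, k)) :
  continuous N -> continuous N' -> continuous (fun t => N t *m N' t).
Proof. by move=> cN cN' t; apply: cvg_mulmx; [exact: cN | exact: cN']. Qed.

Lemma continuous_Cpp : continuous (Cpp B Rw).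
Proof. by apply: continuous_mul; [exact: continuous_mul | exact: continuous_tr]. Qed.

Lemma continuous_Cxx : continuous (Cxx Q S Rw).
Proof.
move=> t; apply: cvgB; first exact: cQ.
by apply: continuous_mul; [exact: continuous_mul | exact: continuous_tr].
Qed.

Lemma continuous_Cxp : continuous (Cxp A B S Rw).
Proof.
move=> t; apply: cvgB; first exact: cA.
by apply: continuous_mul; [exact: continuous_mul | exact: continuous_tr].
Qed.

Variables (P : R -> 'M[R]_n) (q : R -> 'cV[R]_n) (v vt : R * 'cV[R]_n -> R).
Hypothesis cpp_psd : forall t, possemidef (Cpp B Rw t).
Hypothesis cP : continuous P.
Hypothesis cq : continuous q.
Hypothesis cv : continuous v.
Hypothesis tv : tfun T v vt (fun w => P w.1 *m w.2 + q w.1).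
Hypothesis vH : forall w, vt w =
  hamiltonian (Cpp B Rw) (Cxx Q S Rw) (Cxp A B S Rw) w.1 w.2 (P w.1 *m w.2 + q w.1).

(** Identifies the velocity of the moving frame with the closed-loop dynamics under the minimising
    control for the costate [K y + g]. *)
Lemma feedback_drift t (K : 'M[R]_n) (y g : 'cV[R]_n) :
  (Cxp A B S Rw t - Cpp B Rw t *m K) *m y + - (Cpp B Rw t *m g) =
  A t *m y + B t *m - (invmx (Rw t) *m ((B t)^T *m (K *m y + g) + (S t)^T *m y)).
Proof.
rewrite /Cxp /Cpp !mulmxBl mulmxN !mulmxDr !mulmxA !opprD !addrA.
by rewrite [RHS]addrAC; congr (_ - _); rewrite addrAC.
Qed.

Lemma lipschitz_abs_continuous (x dx : R -> 'cV[R]_n) (a b : R) : a <= b ->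
  continuous x -> continuous dx ->
  (forall s : R, a < s < b -> is_derive s (1 : R) x (dx s)) -> abs_continuous a b x.
Proof.
move=> ab cx cdx dxE.
have cn : {within `[a, b], continuous (fun s => `|dx s|)}.
  by apply: continuous_subspaceT => s; apply: cvg_norm; exact: cdx.
have [c _ hc] := EVT_max ab cn.
pose K := `|dx c| + 1; have K0 : 0 < K by rewrite ltr_wpDl.
have lip s t : a <= s -> s <= t -> t <= b -> `|x t - x s| <= K * (t - s).
  move=> as_ st tb; apply: norm_mx_le => [|i j]; first by rewrite mulr_ge0 ?subr_ge0 // ltW.
  rewrite !mxE; have [->|snet] := eqVneq s t; first by rewrite !subrr normr0 mulr0.
  have slt : s < t by rewrite lt_neqAle snet.
  have cij : {within `[s, t], continuous (fun u => x u i j)}.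
    by apply: continuous_subspaceT => u; have := cx u; exact: cvg_mx_coord.
  have dij u : u \in `]s, t[ -> is_derive u (1 : R) (fun u => x u i j) (dx u i j).
    rewrite in_itv /= => /andP[su ut]; apply: is_derive_coord; apply: dxE.
    by rewrite (le_lt_trans as_ su) (lt_le_trans ut).
  have [u] := MVT slt dij cij; rewrite in_itv /= => /andP[su ut] ->.
  have ts0 : 0 <= t - s by rewrite subr_ge0.
  rewrite normrM (ger0_norm ts0) ler_wpM2r //.
  apply: le_trans (le_norm_mx _ _ _) _.
  have := hc u; rewrite in_itv /= (le_trans as_ (ltW su)) (le_trans (ltW ut) tb).
  by move=> /(_ isT); rewrite /K; lra.
move=> e e0; exists (e / K); first by rewrite divr_gt0.
move=> N al be hab _ hsum.
apply: (@le_lt_trans _ _ (\sum_(k < N) K * (be k - al k))).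
  by apply: ler_sum => k _; have [h1 h2 h3] := hab k; exact: lip.
by rewrite -mulr_sumr mulrC -ltr_pdivlMr.
Qed.

Lemma continuous_L2 k (y : R -> 'cV[R]_k) (a b : R) : continuous y -> L2 a b y.
Proof.
move=> cy; split.
  move=> i; apply: measurable_funTS; apply: continuous_measurable_fun.
  by move=> s; have := cy s; exact: cvg_mx_coord.
have cd : continuous (fun s => dot (y s) (y s)).
  by move=> s; apply: cvg_dot; exact: cy.
have /integrableP[_] : lebesgue_measure.-integrable `]a, b[ (EFin \o (fun s => dot (y s) (y s))).
  have h : lebesgue_measure.-integrable `[a, b] (EFin \o (fun s => dot (y s) (y s))).
    by apply: continuous_compact_integrable; [exact: segment_compact | exact: continuous_subspaceT].
  by apply: integrableS h => //; exact: subset_itv_oo_cc.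
apply: le_lt_trans; rewrite le_eqVlt; apply/orP; left; apply/eqP.
by apply: eq_integral => s _ /=; rewrite ger0_norm ?dot_sqr_ge0.
Qed.

(** The flow that served for uniqueness is the closed-loop flow, so its curve through [(t0, x0)] is
    the optimal trajectory. Along it the completed square is identically zero, and [v] decreases
    exactly at the rate of the running cost. *)
Lemma feedback_trajectory (t0 : R) (x0 : 'cV[R]_n) : 0 <= t0 <= T ->
  exists x u, admissible A B T t0 x0 x u /\
    (\int[lebesgue_measure]_(s in `]t0, T[) (running_cost S Q Rw s (x s) (u s))%:E
       + (v (T, x T))%:E = (v (t0, x0))%:E)%E.
Proof.
move=> /andP[t00 t0T].
have [Phi [Psi [z [M ff]]]] :=
  flow_frame_exists T0 continuous_Cpp continuous_Cxp cpp_psd cP cq.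
pose y0 := (to_frame Psi z (t0, x0)).2.
pose x s := Phi s *m y0 + z s.
pose u s := - (invmx (Rw s) *m ((B s)^T *m (P s *m x s + q s) + (S s)^T *m x s)).
have xt0 : x t0 = x0.
  by have := to_frameK ff (t0, x0); rewrite /of_frame /= => -[].
have cx : continuous x.
  move=> s; apply: cvgD; last exact: (ff_cz ff).
  by apply: cvg_mulmx; [exact: (ff_cPhi ff) | exact: cvg_cst].
have cu : continuous u.
  move=> s; apply: cvgN; apply: cvg_mulmx; first exact: continuous_inv.
  apply: cvgD; apply: cvg_mulmx; [exact: continuous_tr | | exact: continuous_tr | exact: cx].
  by apply: cvgD; [apply: cvg_mulmx; [exact: cP | exact: cx] | exact: cq].
pose dx s := A s *m x s + B s *m u s.
have cdx : continuous dx.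
  by move=> s; apply: cvgD; apply: cvg_mulmx; [exact: cA | exact: cx | exact: cB | exact: cu].
have dxE (s : R) : 0 < s < T -> is_derive s (1 : R) x (dx s).
  move=> sT.
  have d1 := is_derive_mulmx (ff_dPhi ff sT) (is_derive_cst y0 s (1 : R)).
  have d := is_deriveD d1 (ff_dz ff sT).
  apply: (@is_derive_eq _ _ _ _ _ _ _ _ d).
  rewrite mulmx0 addr0 -mulmxA addrA -mulmxDr -/(x s); exact: feedback_drift.
have sub s : t0 < s < T -> 0 < s < T by move=> /andP[ts ->]; rewrite (le_lt_trans t00).
have adm : admissible A B T t0 x0 x u.
  split=> //.
  - exact: continuous_L2.
  - exact: continuous_L2.
  - by apply: (lipschitz_abs_continuous t0T cx cdx) => s st; exact: dxE (sub s st).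
  - apply: aeW => s; rewrite in_itv /= => st; exact: dxE (sub s st).
exists x, u; split=> //.
pose L s := running_cost S Q Rw s (x s) (u s).
have cL : continuous L.
  move=> s; have h (j k : nat) (N : R -> 'M[R]_(j, k)) (a : R -> 'cV[R]_j) (b : R -> 'cV[R]_k) :
      continuous N -> continuous a -> continuous b -> {for s, continuous (fun s => dot (a s) (N s *m b s))}.
    by move=> cN ca cb; apply: cvg_dot; [exact: ca | apply: cvg_mulmx; [exact: cN | exact: cb]].
  apply: cvgD; last exact: h.
  by apply: cvgD; apply: cvgM; [exact: cvg_cst | exact: h | exact: cvg_cst | exact: h].
pose f s := v (s, x s).
have cf : continuous f.
  have c1 : continuous (fun s : R => (s, x s)).
    move=> s; have c0 : (fun u : R => u) u @[u --> s] --> s by exact: cvg_id.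
    exact: (cvg_pair c0 (cx s)).
  have cc : continuous (v \o (fun s : R => (s, x s))).
    by move=> s; apply: continuous_comp; [exact: c1 | exact: cv].
  exact: cc.
have df (s : R) : 0 < s < T -> is_derive s (1 : R) f (- L s).
  move=> sT; have d := is_derive_along tv sT (dxE s sT).
  apply: (@is_derive_eq _ _ _ _ _ _ _ _ d).
  have := completion_of_squares A B S Q Rw_posdef s (x s) (u s) (P s *m x s + q s).
  have -> : u s + invmx (Rw s) *m ((B s)^T *m (P s *m x s + q s) + (S s)^T *m x s) = 0.
    exact: addNr.
  cbv zeta; rewrite dot0l mulr0 vH /= -/(dx s) /L => e.
  have aux (a b c : R) : a + b + c = 0 -> b + c = - a by lra.
  exact: aux.
have -> : (\int[lebesgue_measure]_(s in `]t0, T[) (L s)%:E = (v (t0, x0) - v (T, x T))%:E)%E.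
  have [t0E|neq] := eqVneq t0 T.
    by rewrite set_itv_ge ?bnd_simp -?leNgt ?t0E // integral_set0 -{1}xt0 t0E subrr.
  have ltt : t0 < T by rewrite lt_neqAle neq.
  have mE (D : set R) : measurable D -> measurable_fun D (EFin \o L).
    move=> mD; apply/measurable_EFinP; apply: measurable_funTS.
    exact: continuous_measurable_fun.
  rewrite integral_itv_obnd_cbnd; last exact: mE.
  rewrite integral_itv_bndo_bndc; last exact: mE.
  rewrite (@continuous_FTC2 R L (fun s => - f s) t0 T ltt).
  - by rewrite /f xt0 -EFinB opprK addrC.
  - exact: continuous_subspaceT.
  - have cNf : continuous (fun s => - f s) by move=> s; apply: cvgN; exact: cf.
    split=> [s||].
    + rewrite in_itv /= => st; have [e _] := df s (sub s st).
      exact: derivableN.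
    + by apply: cvg_at_right_filter; exact: cNf.
    + by apply: cvg_at_left_filter; exact: cNf.
  - move=> s; rewrite in_itv /= => st; have d := is_deriveN (df s (sub s st)).
    by rewrite derive1E derive_val opprK.
by rewrite -EFinD subrK.
Qed.

End Feedback.

(** * The main result *)

Lemma continuous_min_ord (R : realType) (X : topologicalType) m (hm : (0 < m)%N)
    (f : 'I_m -> X -> R) :
  (forall i, continuous (f i)) -> continuous (fun w => min_ord hm (fun i => f i w)).
Proof.
move=> cf; rewrite /min_ord; elim: (index_enum _) => [|i s IHs].
  by under eq_fun do rewrite big_nil; exact: cf.
by under eq_fun do rewrite big_cons; move=> w; exact: continuous_min (cf i w) (IHs w).
Qed.

Section GlobalData.
Context {R : realType} {n l m : nat}.
Variables (hm : (0 < m)%N) (T : R) (A : R -> 'M[R]_n) (B S : R -> 'M[R]_(n, l)).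
Variables (Q : R -> 'M[R]_n) (Rw : R -> 'M[R]_l).
Variables (P : 'I_m -> R -> 'M[R]_n) (q : 'I_m -> R -> 'cV[R]_n) (r : 'I_m -> R -> R).
Hypothesis T0 : 0 < T.
Hypothesis cA : continuous A.
Hypothesis cB : continuous B.
Hypothesis cS : continuous S.
Hypothesis cQ : continuous Q.
Hypothesis cRw : continuous Rw.
Hypothesis Rw_posdef : forall t, posdef (Rw t).
Hypothesis Cpp_psd : forall t, possemidef (Cpp B Rw t).
Hypothesis Cxx_posdef : forall t, posdef (Cxx Q S Rw t).
Hypothesis cP : forall i, continuous (P i).
Hypothesis Ps : forall i t, (P i t)^T = P i t.
Hypothesis cq : forall i, continuous (q i).
Hypothesis cr : forall i, continuous (r i).
Let cpp := Cpp B Rw.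
Let cxx := Cxx Q S Rw.
Let cxp := Cxp A B S Rw.
Let dP i t := (P i t)^T *m cpp t *m P i t - (P i t)^T *m cxp t - (cxp t)^T *m P i t - cxx t.
Let dq i t := (P i t)^T *m cpp t *m q i t - (cxp t)^T *m q i t.
Let dr i t := 2^-1 * dot (q i t) (cpp t *m q i t).
Hypothesis P_ode : forall i (t : R), 0 < t < T -> is_derive t (1 : R) (P i) (dP i t).
Hypothesis q_ode : forall i (t : R), 0 < t < T -> is_derive t (1 : R) (q i) (dq i t).
Hypothesis r_ode : forall i (t : R), 0 < t < T -> is_derive t (1 : R) (r i) (dr i t).

Let ccpp : continuous cpp. Proof. exact: (continuous_Cpp cB cRw Rw_posdef). Qed.
Let ccxx : continuous cxx. Proof. exact: (continuous_Cxx cS cQ cRw Rw_posdef). Qed.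
Let ccxp : continuous cxp. Proof. exact: (continuous_Cxp cA cB cS cRw Rw_posdef). Qed.

Let v i := vquad (P i) (q i) (r i).
Let vt i := vquad (dP i) (dq i) (dr i).
Let vx i (w : R * 'cV[R]_n) := P i w.1 *m w.2 + q i w.1.

Let cv i : continuous (v i).
Proof. exact: (@riccati_continuous _ _ _ _ _ _ cP cq cr i). Qed.

Let tv i : tfun T (v i) (vt i) (vx i).
Proof. exact: (riccati_tfun ccpp ccxx ccxp cP Ps cq P_ode q_ode r_ode). Qed.

Let vH i w : vt i w = hamiltonian cpp cxx cxp w.1 w.2 (vx i w).
Proof. exact: (riccati_hamiltonian cxx cxp q Cpp_psd Ps). Qed.

Let cvt i : continuous (vt i).
Proof.
have cvx : continuous (vx i).
  move=> w; apply: cvgD; last exact: (continuous_comp_fst (@cq i)).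
  by apply: cvg_mulmx; [exact: (continuous_comp_fst (@cP i)) | exact: cvg_snd].
have -> : vt i = fun w => hamiltonian cpp cxx cxp w.1 w.2 (vx i w) by apply/funext => w.
have h (N : R -> 'M[R]_n) (a b : R * 'cV[R]_n -> 'cV[R]_n) : continuous N ->
    continuous a -> continuous b -> continuous (fun w => dot (a w) (N w.1 *m b w)).
  move=> cN ca cb w; apply: cvg_dot; first exact: ca.
  by apply: cvg_mulmx; [exact: (continuous_comp_fst cN) | exact: cb].
have c2 : continuous (snd : R * 'cV[R]_n -> 'cV[R]_n) by move=> w; exact: cvg_snd.
move=> w; apply: cvgB; last exact: (@h cxp (vx i) snd ccxp cvx c2).
by apply: cvgB; apply: cvgM; [exact: cvg_cst | exact: (@h cpp (vx i) (vx i) ccpp cvx cvx) | exact: cvg_cst | exact: (@h cxx snd snd ccxx c2 c2)].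
Qed.

Let V (w : R * 'cV[R]_n) := V_NN hm P q r w.1 w.2.

Lemma V_NN_continuous : continuous V.
Proof. exact: (@continuous_min_ord _ _ _ hm v (@cv)). Qed.

Lemma V_NN_vsub : vsub T (fun w => hamiltonian cpp cxx cxp w.1 w.2) V.
Proof.
exact: (min_vsub tv (fun i w => min_ord_le hm (fun i => v i w) i)
  (fun w => min_ord_ex hm (fun i => v i w)) (fun i w _ => vH i w) Cpp_psd).
Qed.

Lemma V_NN_vsuper : vsuper T (fun w => hamiltonian cpp cxx cxp w.1 w.2) V.
Proof.
exact: (min_vsuper tv (fun i w => min_ord_le hm (fun i => v i w) i)
  (fun w => min_ord_ex hm (fun i => v i w)) (fun i w _ => vH i w)).
Qed.

Lemma V_NN_unique W : continuous W ->
  vsub T (fun w => hamiltonian cpp cxx cxp w.1 w.2) W ->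
  vsuper T (fun w => hamiltonian cpp cxx cxp w.1 w.2) W ->
  (forall x, W (T, x) = V (T, x)) -> forall w, 0 <= w.1 <= T -> W w = V w.
Proof.
move=> cW subW superW WT w.
exact: (solution_unique T0 ccpp ccxx ccxp Cpp_psd cP Ps cq cr P_ode q_ode r_ode cW).
Qed.

(** The index is chosen at opposite ends. For the lower bound it attains the minimum at the final
    state of the given trajectory; for the upper bound it attains the minimum at [(t0, x0)], and the
    feedback of that index is followed. *)
Lemma V_NN_value (t0 : R) (x0 : 'cV[R]_n) : 0 <= t0 <= T ->
  (V (t0, x0))%:E = ereal_inf [set cost Q Rw S (fun x => V (T, x)) T t0 xu.1 xu.2
    | xu in [set xu : (R -> 'cV[R]_n) * (R -> 'cV[R]_l)
            | admissible A B T t0 x0 xu.1 xu.2]].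
Proof.
move=> t0T; apply/eqP; rewrite eq_le; apply/andP; split.
  apply: le_ereal_inf_tmp => _ [[x u] /= adm <-].
  have [i Vi] := min_ord_ex hm (fun i => v i (T, x T)).
  rewrite /cost (_ : V (T, x T) = v i (T, x T)); last exact: Vi.
  apply: le_trans (verification cS cQ cRw Rw_posdef Cxx_posdef (@cP i) (@cq i)
    (@cv i) (@cvt i) (tv i) (vH i) t0T adm).
  by rewrite lee_fin; exact: min_ord_le.
have [i Vi] := min_ord_ex hm (fun i => v i (t0, x0)).
rewrite (_ : V (t0, x0) = v i (t0, x0)); last exact: Vi.
have [x [u [adm <-]]] := feedback_trajectory T0 cA cB cS cQ cRw Rw_posdef Cpp_psd
  (@cP i) (@cq i) (@cv i) (tv i) (vH i) x0 t0T.
apply: ge_ereal_inf; exists (cost Q Rw S (fun x => V (T, x)) T t0 x u); first by exists (x, u).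
apply: leeD; first exact: lexx.
by rewrite lee_fin; exact: min_ord_le.
Qed.

End GlobalData.

(** * Data that agree on the time interval *)

Section Transfer.
Context {R : realType} {n : nat}.
Implicit Types (T : R) (Z : R * 'cV[R]_n -> R).

Lemma eq_vsub T (H H' : R * 'cV[R]_n -> 'cV[R]_n -> R) Z :
  (forall z p, 0 < z.1 < T -> H z p = H' z p) -> vsub T H Z -> vsub T H' Z.
Proof. by move=> HH h phi pt px hp z zT mx; rewrite -HH //; exact: (h phi pt px hp z zT mx). Qed.

Lemma eq_vsuper T (H H' : R * 'cV[R]_n -> 'cV[R]_n -> R) Z :
  (forall z p, 0 < z.1 < T -> H z p = H' z p) -> vsuper T H Z -> vsuper T H' Z.
Proof. by move=> HH h phi pt px hp z zT mx; rewrite -HH //; exact: (h phi pt px hp z zT mx). Qed.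

Context {l : nat}.

Lemma eq_admissible (A A' : R -> 'M[R]_n) (B B' : R -> 'M[R]_(n, l)) T t0 x0 x u :
  (forall t, t \in `]t0, T[ -> A t = A' t) -> (forall t, t \in `]t0, T[ -> B t = B' t) ->
  admissible A B T t0 x0 x u -> admissible A' B' T t0 x0 x u.
Proof.
move=> AA BB [L2x L2u acx dx xt0]; split=> //.
apply: filterS dx; first exact: (ae_filter_ringOfSetsType lebesgue_measure).
by move=> s h st; rewrite -AA // -BB //; exact: h.
Qed.

Lemma eq_cost (Q Q' : R -> 'M[R]_n) (Rw Rw' : R -> 'M[R]_l) (S S' : R -> 'M[R]_(n, l))
    (Psi Psi' : 'cV[R]_n -> R) T t0 x u :
  (forall t, t \in `]t0, T[ -> Q t = Q' t) -> (forall t, t \in `]t0, T[ -> Rw t = Rw' t) ->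
  (forall t, t \in `]t0, T[ -> S t = S' t) -> Psi =1 Psi' ->
  cost Q Rw S Psi T t0 x u = cost Q' Rw' S' Psi' T t0 x u.
Proof.
move=> QQ RR SS PP; rewrite /cost PP; congr (_ + _)%E.
by apply: eq_integral => s; rewrite inE /= => st; rewrite QQ // RR // SS.
Qed.

End Transfer.

Theorem proposition1 (R : realType) (n l m : nat)
  (hn : (0 < n)%N) (hl : (0 < l)%N) (hm : (0 < m)%N)
  (T : R) (hT : 0 < T)
  (A : R -> 'M[R]_n) (B S : R -> 'M[R]_(n, l))
  (Q : R -> 'M[R]_n) (Rw : R -> 'M[R]_l)
  (G : 'I_m -> 'M[R]_n) (a : 'I_m -> 'cV[R]_n) (b : 'I_m -> R)
  (cA : {within `[0, T], continuous A})
  (cB : {within `[0, T], continuous B})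
  (cS : {within `[0, T], continuous S})
  (cQ : {within `[0, T], continuous Q})
  (cR : {within `[0, T], continuous Rw})
  (Q_posdef : forall t, t \in `[0, T] -> posdef (Q t))
  (R_posdef : forall t, t \in `[0, T] -> posdef (Rw t))
  (G_psd : forall i, possemidef (G i))
  (Cpp_psd : forall t, t \in `[0, T] -> possemidef (Cpp B Rw t))
  (Cxx_posdef : forall t, t \in `[0, T] -> posdef (Cxx Q S Rw t))
  (P : 'I_m -> R -> 'M[R]_n) (q : 'I_m -> R -> 'cV[R]_n) (r : 'I_m -> R -> R)
  (cP : forall i, {within `[0, T], continuous (P i)})
  (P_sym : forall i t, t \in `[0, T] -> (P i t)^T = P i t)
  (cq : forall i, {within `[0, T], continuous (q i)})
  (cr : forall i, {within `[0, T], continuous (r i)})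
  (P_ode : forall i t, t \in `]0, T[ ->
    is_derive t (1 : R) (P i)
      ((P i t)^T *m Cpp B Rw t *m P i t - (P i t)^T *m Cxp A B S Rw t
       - (Cxp A B S Rw t)^T *m P i t - Cxx Q S Rw t))
  (P_T : forall i, P i T = G i)
  (q_ode : forall i t, t \in `]0, T[ ->
    is_derive t (1 : R) (q i)
      ((P i t)^T *m Cpp B Rw t *m q i t - (Cxp A B S Rw t)^T *m q i t))
  (q_T : forall i, q i T = a i)
  (r_ode : forall i t, t \in `]0, T[ ->
    is_derive t (1 : R) (r i) (2^-1 * dot (q i t) (Cpp B Rw t *m q i t)))
  (r_T : forall i, r i T = b i) :
  let H := hamiltonian (Cpp B Rw) (Cxx Q S Rw) (Cxp A B S Rw) in
  let Psi := terminal_cost hm G a b in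
  let V := V_NN hm P q r in
  [/\ viscosity_solution T H Psi V,
      forall W : R -> 'cV[R]_n -> R, viscosity_solution T H Psi W ->
        forall t x, t \in `[0, T] -> W t x = V t x
    & forall (t0 : R) (x0 : 'cV[R]_n), t0 \in `[0, T] ->
        (V t0 x0)%:E =
        ereal_inf [set cost Q Rw S Psi T t0 xu.1 xu.2
                  | xu in [set xu : (R -> 'cV[R]_n) * (R -> 'cV[R]_l)
                          | admissible A B T t0 x0 xu.1 xu.2]]].
Proof.
move=> H Psi V; pose cl := clamp T.
have itv t : cl t \in `[0, T] by rewrite in_itv /=; exact: clamp_itv.
have ode (U : normedModType R) (f : R -> U) (D : R -> U) :
    (forall t, t \in `]0, T[ -> is_derive t (1 : R) f (D t)) ->
    forall t : R, 0 < t < T -> is_derive t (1 : R) (f \o cl) (D (cl t)).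
  move=> df t tT; have /andP[t0 tT'] := tT.
  have clt : cl t = t by rewrite /cl clamp_id // !ltW.
  have d : is_derive t (1 : R) f (D (cl t)) by rewrite clt; apply: df; rewrite in_itv.
  apply: near_eq_is_derive d.
  by apply: filterS (near_clamp tT) => s; rewrite /= /cl => ->.
pose Pc i := P i \o cl; pose qc i := q i \o cl; pose rc i := r i \o cl.
have cAc : continuous (A \o cl) by exact: continuous_clamped.
have cBc : continuous (B \o cl) by exact: continuous_clamped.
have cSc : continuous (S \o cl) by exact: continuous_clamped.
have cQc : continuous (Q \o cl) by exact: continuous_clamped.
have cRc : continuous (Rw \o cl) by exact: continuous_clamped.
have cPc i : continuous (Pc i) by exact: continuous_clamped.
have cqc i : continuous (qc i) by exact: continuous_clamped.
have crc i : continuous (rc i) by exact: continuous_clamped.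
have Rc_posdef t : posdef ((Rw \o cl) t) by exact/R_posdef/itv.
have Cc_psd t : possemidef (Cpp (B \o cl) (Rw \o cl) t) by exact: (Cpp_psd _ (itv t)).
have Cc_posdef t : posdef (Cxx (Q \o cl) (S \o cl) (Rw \o cl) t) by exact: (Cxx_posdef _ (itv t)).
have Pc_sym i t : (Pc i t)^T = Pc i t by exact/P_sym/itv.
have P_odec i := ode _ _ _ (P_ode i).
have q_odec i := ode _ _ _ (q_ode i).
have r_odec i := ode _ _ _ (r_ode i).
pose Hc := hamiltonian (Cpp (B \o cl) (Rw \o cl)) (Cxx (Q \o cl) (S \o cl) (Rw \o cl))
  (Cxp (A \o cl) (B \o cl) (S \o cl) (Rw \o cl)).
pose Vc (w : R * 'cV[R]_n) := V_NN hm Pc qc rc w.1 w.2.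
have VcE w : 0 <= w.1 <= T -> Vc w = V w.1 w.2.
  by move=> wT; rewrite -[in RHS](clamp_id wT).
have ooW (z : R * 'cV[R]_n) : 0 < z.1 < T -> 0 <= z.1 <= T.
  by case/andP => /ltW -> /ltW ->.
have HcE (z : R * 'cV[R]_n) p : 0 < z.1 < T -> Hc z.1 z.2 p = H z.1 z.2 p.
  by move=> /ooW zT; rewrite -[in RHS](clamp_id zT).
have HE (z : R * 'cV[R]_n) p : 0 < z.1 < T -> H z.1 z.2 p = Hc z.1 z.2 p.
  by move=> /HcE ->.
have VT x : V T x = Psi x.
  by congr (min_ord hm _); apply/funext => i; rewrite P_T q_T r_T.
have TT : 0 <= T <= T by rewrite lexx ltW.
have cVc : continuous Vc by exact: V_NN_continuous.
split.
- split=> //.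
  + apply: (@subspace_eq_continuous _ _ _ Vc); last exact: continuous_subspaceT.
    by move=> z; rewrite inE => -[/= zT _]; apply: VcE; rewrite in_itv in zT.
  + apply: (@vsub_viscosity _ _ T H V Vc) => [z /ooW|]; first exact: VcE.
    apply: (eq_vsub HcE).
    exact: (V_NN_vsub cAc cBc cSc cQc cRc Rc_posdef Cc_psd cPc Pc_sym cqc P_odec q_odec r_odec).
  + apply: (@vsuper_viscosity _ _ T H V Vc) => [z /ooW|]; first exact: VcE.
    apply: (eq_vsuper HcE).
    exact: (V_NN_vsuper cAc cBc cSc cQc cRc Rc_posdef Cc_psd cPc Pc_sym cqc P_odec q_odec r_odec).
- move=> W [cW subW superW WT] t x; rewrite in_itv /= => tT.
  (* A competitor is continuous only on the closed slab, so it is extended in time like the data;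
     the viscosity inequalities are unaffected inside. *)
  pose Wc (w : R * 'cV[R]_n) := W (cl w.1) w.2.
  have WcE w : 0 <= w.1 <= T -> Wc w = W w.1 w.2 by move=> wT; rewrite /Wc /cl clamp_id.
  have WcE' w : 0 < w.1 < T -> Wc w = W w.1 w.2 by move=> /ooW; exact: WcE.
  have cWc : continuous Wc.
    have cc : continuous (fun w : R * 'cV[R]_n => (cl w.1, w.2)).
      move=> w; have c1 : (fun w : R * 'cV[R]_n => cl w.1) u @[u --> w] --> cl w.1.
        exact: (continuous_comp_fst (@continuous_clamp R T)).
      have c2 : (snd : R * 'cV[R]_n -> 'cV[R]_n) u @[u --> w] --> w.2 by exact: cvg_snd.
      exact: (cvg_pair c1 c2).
    apply: (continuous_comp_within cc _ cW) => w; split=> //=; exact: itv.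
  rewrite -(WcE (t, x) tT) -(VcE (t, x) tT).
  apply: (V_NN_unique hT cAc cBc cSc cQc cRc Rc_posdef Cc_psd cPc Pc_sym cqc crc
    P_odec q_odec r_odec cWc) => //=.
  + exact: (eq_vsub HE (viscosity_vsub WcE' subW)).
  + exact: (eq_vsuper HE (viscosity_vsuper WcE' superW)).
  + by move=> y; rewrite (WcE (T, y) TT) WT -VT; apply/esym; exact: (VcE (T, y)).
- move=> t0 x0; rewrite in_itv /= => t0T.
  have clE t : t \in `]t0, T[ -> cl t = t.
    rewrite in_itv /= => /andP[tt tT]; rewrite /cl clamp_id // (ltW tT) andbT.
    by case/andP: t0T => /le_trans t00 _; apply/t00/ltW.
  rewrite -(VcE (t0, x0) t0T).
  rewrite [LHS](V_NN_value hm hT cAc cBc cSc cQc cRc Rc_posdef Cc_psd Cc_posdef cPc Pc_sym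
    cqc crc P_odec q_odec r_odec x0 t0T).
  have clo (U : Type) (f : R -> U) t : t \in `]t0, T[ -> (f \o cl) t = f t.
    by move=> tT; rewrite /= clE.
  have clo' (U : Type) (f : R -> U) t : t \in `]t0, T[ -> f t = (f \o cl) t.
    by move=> tT; rewrite clo.
  congr ereal_inf; apply/seteqP; split=> _ [[x u] /= adm <-].
  + exists (x, u); first exact: eq_admissible (clo _ A) (clo _ B) adm.
    apply: eq_cost; [exact: clo' | exact: clo' | exact: clo' |].
    by move=> y; rewrite -VT; apply/esym; exact: (VcE (T, y)).
  + exists (x, u); first exact: eq_admissible (clo' _ A) (clo' _ B) adm.
    apply: eq_cost; [exact: clo | exact: clo | exact: clo |].
    by move=> y; rewrite -VT; exact: (VcE (T, y)).
Qed.
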